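(* Let $X$ be a complex manifold and let $\mathcal{V}$ be an infinitesimally equivariant bundle on $X$ with Lie map $L:\Theta_{X}\rightarrow\operatorname{At}_{X}(\mathcal{V})$; that is, $\mathcal{V}$ is a holomorphic vector bundle of finite rank on $X$ and $L$ is a continuous morphism of sheaves of $\mathbf{C}$-Lie algebras (not assumed $\mathcal{O}_X$-linear) with $\sigma\circ L=\operatorname{id}_{\Theta_X}$, where $\sigma$ is the symbol map. Then $L$ is a differential operator of order at most $\operatorname{rank}(\mathcal{V})+1$. If $\mathcal{V}$ is a line bundle, then in fact $L$ is a differential operator of order at most $1$.
   Context: Let $X$ be a complex manifold with sheaf of holomorphic functions $\mathcal{O}_X$ and sheaf of holomorphic vector fields $\Theta_X$. For a holomorphic vector bundle $\mathcal{V}$ of finite rank on $X$ (identified with its sheaf of holomorphic sections), the Atiyah algebra $\operatorname{At}_X(\mathcal{V})$ is the sheaf whose local sections are pairs $(\eta,\widetilde{\eta})$, where $\eta$ is a holomorphic vector field and $\widetilde{\eta}$ is a $\mathbf{C}$-linear endomorphism of (the sheaf) $\mathcal{V}$ satisfying the Leibniz rule $\widetilde{\eta}(fs)=f\,\widetilde{\eta}(s)+\eta(f)s$ for local functions $f$ and local sections $s$. It is a locally free $\mathcal{O}_X$-module of finite rank (via left multiplication) and a sheaf of $\mathbf{C}$-Lie algebras under the commutator bracket; the symbol map $\sigma:\operatorname{At}_X(\mathcal{V})\rightarrow\Theta_X$, $(\eta,\widetilde{\eta})\mapsto\eta$, is $\mathcal{O}_X$-linear and a map of sheaves of Lie algebras.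 Continuity: $\mathcal{O}_X$ is a sheaf of topological vector spaces, with the topology of uniform convergence on compact subsets. A $\mathbf{C}$-linear morphism of sheaves between trivial bundles $\mathcal{O}^{\oplus m}\rightarrow\mathcal{O}^{\oplus n}$ is continuous if it is continuous for these topologies; a $\mathbf{C}$-linear morphism of sheaves between (sheaves of sections of) holomorphic vector bundles is continuous if it is so with respect to a trivialising open cover (this does not depend on the choice of trivialisation). Infinitesimally equivariant bundle: a pair $(\mathcal{V},L)$ with $\mathcal{V}$ a holomorphic vector bundle of finite rank and $L:\Theta_X\rightarrow\operatorname{At}_X(\mathcal{V})$ a continuous $\mathbf{C}$-linear morphism of sheaves of Lie algebras with $\sigma\circ L=\operatorname{id}$. The map $L$ is called the Lie map. ''Differential operator of order at most $k$'' is meant in the usual sense for $\mathbf{C}$-linear sheaf morphisms between locally free $\mathcal{O}_X$-modules, here from $\Theta_X$ to $\operatorname{At}_X(\mathcal{V})$: locally, in coordinates and trivialisations, it is given by a matrix of operators $\sum_{|I|\leq k}a_I(z)\partial^I$ with holomorphic coefficients. *)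

(* Defs.v *)
From HB Require Import structures.
From mathcomp Require Import all_boot all_order all_algebra.
From mathcomp Require Import complex.
From mathcomp Require Import all_classical all_reals all_analysis.

Set Implicit Arguments.
Unset Strict Implicit.
Unset Printing Implicit Defensive.

Import Order.TTheory GRing.Theory Num.Theory.
Import numFieldNormedType.Exports.

Local Open Scope classical_set_scope.
Local Open Scope ring_scope.

(* [R[i]] itself is not recognised as a normed module; packed as a
   [numClosedFieldType] it is, with the topology of the complex norm. *)
Definition Cx (R : realType) : numClosedFieldType := R[i].

Section DifferentiableFacts.
Variables (K : numFieldType) (V W : normedModType K).

Lemma near_eq_differentiable (f g : V -> W) (x : V) :
  (\forall z \near x, f z = g z) -> differentiable f x -> differentiable g x.
Proof.
move=> fg df.
have gx : f x = g x := nbhs_singleton fg.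
have dc : continuous ('d f x) by case/diff_locallyP: df.
have dg : g \o shift x = cst (g x) + 'd f x +o_ 0 id.
  apply/eqaddoP => e e0.
  have /eqaddoP/(_ e e0) := diff_locally df.
  move: fg; rewrite (near_shift 0) subr0 => fg0.
  by apply: filterS2 fg0 => h /= fgh; rewrite /= !fctE /= fgh gx.
by apply/diff_locallyP; rewrite (diff_unique dc dg).
Qed.

Lemma differentiable_scale (k : V -> K) (f : V -> W) (x : V) :
  differentiable k x -> differentiable f x ->
  differentiable (fun z => k z *: f z) x.
Proof.
move=> dk df.
have bilB : bilinear_for
    (GRing.Scale.Law.clone _ _ *:%R _) (GRing.Scale.Law.clone _ _ *:%R _)
    (@GRing.scale K W).
  split=> [w|c] a y z /=; first by rewrite scalerDl scalerA.
  by rewrite scalerDr !scalerA mulrC.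
pose mB := bilinear_isBilinear.Build K K W W _ _ (@GRing.scale K W) bilB.
pose B : {bilinear K -> W -> W} := HB.pack (@GRing.scale K W) mB.
apply: (@differentiable_comp _ _ _ _ (fun z => (k z, f z))
          (fun p => B p.1 p.2)); first exact: differentiable_pair.
by apply: differentiable_bilin => p; exact: scale_continuous.
Qed.

End DifferentiableFacts.

Record complexManifold (R : realType) (n : nat) := ComplexManifold {
  manifold_space :> topologicalType ;
  manifold_hausdorff : hausdorff_space manifold_space ;
  manifold_second_countable : @second_countable manifold_space ;
  atlas : Type ;
  dom : atlas -> set manifold_space ;
  chart : atlas -> manifold_space -> 'rV[Cx R]_n ;
  chartV : atlas -> 'rV[Cx R]_n -> manifold_space ;
  chart_at : manifold_space -> atlas ;
  mem_chart_at : forall x, dom (chart_at x) x ;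
  open_dom : forall c, open (dom c) ;
  open_chart : forall c, open (chart c @` dom c) ;
  chartK : forall c x, dom c x -> chartV c (chart c x) = x ;
  chart_continuous : forall c x, dom c x -> {for x, continuous (chart c)} ;
  chartV_continuous : forall c x, dom c x ->
    {for chart c x, continuous (chartV c)} ;
  transition_holomorphic : forall c c' x, dom c x -> dom c' x ->
    differentiable (chart c' \o chartV c) (chart c x) }.

Arguments dom {R n M} c : rename.
Arguments chart {R n M} c : rename.
Arguments chartV {R n M} c : rename.
Arguments chart_at {R n M} x : rename.

Record opens (T : topologicalType) := Opens {
  opens_set :> set T ;
  openP : open opens_set }.

Identity Coercion fun_of_set : set >-> Funclass.

Section Bundles.
Variables (R : realType) (n : nat) (M : complexManifold R n).
Local Notation C := (Cx R).

Definition holomorphic_on (W : normedModType C) (U : set M) (f : M -> W) :=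
  forall c x, U x -> dom c x -> differentiable (f \o chartV c) (chart c x).

(* The data of a vector bundle of rank [r]: its fibres and, over the open sets
   [tdom a], the trivialisations [tmap a x] with inverses [tinv a x]. *)
Record bundleData (r : nat) := BundleData {
  fiber :> M -> lmodType C ;
  triv : Type ;
  tdom : triv -> set M ;
  tmap : triv -> forall x, {linear fiber x -> 'rV[C]_r} ;
  tinv : triv -> forall x, 'rV[C]_r -> fiber x }.

Record vectorBundle (r : nat) := VectorBundle {
  bundle_data :> bundleData r ;
  tdom_cover : forall x, exists a : triv bundle_data, tdom a x ;
  open_tdom : forall a : triv bundle_data, open (tdom a) ;
  tmapK : forall (a : triv bundle_data) x, tdom a x ->
    cancel (tmap a x) (tinv a x) ;
  tinvK : forall (a : triv bundle_data) x, tdom a x ->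
    cancel (tinv a x) (tmap a x) ;
  cocycle_holomorphic : forall (a b : triv bundle_data) (v : 'rV[C]_r),
    holomorphic_on (tdom a `&` tdom b) (fun x => tmap b x (tinv a x v)) }.

(* The tangent bundle: a tangent vector at [x] is given by its coordinates in
   the chart [chart_at x], and the trivialisation over [dom c] turns these into
   the coordinates in the chart [c] by the Jacobian of the change of charts. *)
Definition tangentBundle : bundleData n := @BundleData n
  (fun _ => 'rV[C]_n : lmodType C) (atlas M) dom
  (fun c x => 'd (chart c \o chartV (chart_at x)) (chart (chart_at x) x))
  (fun c x => 'd (chart (chart_at x) \o chartV c) (chart c x)).

(* Sections over [U] are encoded as functions on [M] that vanish outside of
   [U], so that two sections over [U] are equal iff they agree on [U]. *)
Definition is_section r (E : bundleData r) (U : opens M) (s : forall x, E x) :=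
  (forall a : triv E, holomorphic_on (U `&` tdom a) (fun x => tmap a x (s x)))
  /\ forall x, ~ U x -> s x = 0.

Record sect r (E : bundleData r) (U : opens M) := Sect {
  sect_fun :> forall x, E x ;
  sectP : is_section U sect_fun }.

Section SectModule.
Variables (r : nat) (E : bundleData r) (U : opens M).

Lemma sect_ext (s t : sect E U) : (forall x, s x = t x) -> s = t.
Proof.
case: s t => [s sP] [t tP] /= st.
have {}st : s = t by exact: functional_extensionality_dep.
by case: t / st tP => tP; rewrite (Prop_irrelevance sP tP).
Qed.

HB.instance Definition _ := gen_eqMixin (sect E U).
HB.instance Definition _ := gen_choiceMixin (sect E U).

Lemma is_section0 : is_section U (fun x => 0 : E x).
Proof.
split=> // a c x _ _.
rewrite (_ : _ \o _ = cst 0); first exact: differentiable_cst.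
by apply/funext => z /=; rewrite linear0.
Qed.

Lemma is_sectionD (s t : sect E U) : is_section U (fun x => s x + t x : E x).
Proof.
case: s t => [s [sh s0]] [t [th t0]] /=; split=> [a c x Ux cx|x Ux].
  rewrite (_ : _ \o _ = ((fun x => tmap a x (s x)) \o chartV c)
    + ((fun x => tmap a x (t x)) \o chartV c)).
    by apply: differentiableD; [exact: sh|exact: th].
  by apply/funext => z /=; rewrite linearD.
by rewrite s0 // t0 // addr0.
Qed.

Lemma is_sectionZ (k : C) (s : sect E U) : is_section U (fun x => k *: s x : E x).
Proof.
case: s => [s [sh s0]] /=; split=> [a c x Ux cx|x Ux].
  rewrite (_ : _ \o _ = k *: ((fun x => tmap a x (s x)) \o chartV c)).
    by apply: differentiableZ; exact: sh.
  by apply/funext => z /=; rewrite linearZ.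
by rewrite s0 // scaler0.
Qed.

Definition sect0 : sect E U := Sect is_section0.
Definition sectD (s t : sect E U) : sect E U := Sect (is_sectionD s t).
Definition sectZ (k : C) (s : sect E U) : sect E U := Sect (is_sectionZ k s).
Definition sectN (s : sect E U) : sect E U := sectZ (-1) s.

Let sectDA : associative sectD.
Proof. by move=> s t u; apply: sect_ext => x /=; rewrite addrA. Qed.
Let sectDC : commutative sectD.
Proof. by move=> s t; apply: sect_ext => x /=; rewrite addrC. Qed.
Let sect0D : left_id sect0 sectD.
Proof. by move=> s; apply: sect_ext => x /=; rewrite add0r. Qed.
Let sectND : left_inverse sect0 sectN sectD.
Proof. by move=> s; apply: sect_ext => x /=; rewrite scaleN1r addNr. Qed.

HB.instance Definition _ :=
  GRing.isZmodule.Build (sect E U) sectDA sectDC sect0D sectND.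

Let sectZA (a b : C) (s : sect E U) : sectZ a (sectZ b s) = sectZ (a * b) s.
Proof. by apply: sect_ext => x /=; rewrite scalerA. Qed.
Let sect1Z : left_id 1 sectZ.
Proof. by move=> s; apply: sect_ext => x /=; rewrite scale1r. Qed.
Let sectZDr : right_distributive sectZ +%R.
Proof. by move=> a s t; apply: sect_ext => x /=; rewrite scalerDr. Qed.
Let sectZDl (s : sect E U) : {morph sectZ^~ s : a b / a + b}.
Proof. by move=> a b; apply: sect_ext => x /=; rewrite scalerDl. Qed.

HB.instance Definition _ := GRing.Zmodule_isLmodule.Build C (sect E U)
  sectZA sect1Z sectZDr sectZDl.

Lemma sectDE (s t : sect E U) x : (s + t) x = s x + t x. Proof. by []. Qed.
Lemma sectZE k (s : sect E U) x : (k *: s) x = k *: s x. Proof. by []. Qed.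
Lemma sect0E x : (0 : sect E U) x = 0. Proof. by []. Qed.

Lemma is_section_scale (f : M -> C) (fh : holomorphic_on U f) (s : sect E U) :
  is_section U (fun x => f x *: s x : E x).
Proof.
case: s => [s [sh s0]] /=; split=> [a c x [Ux ax] cx|x Ux].
  rewrite (_ : _ \o _ = (fun z => (f \o chartV c) z *:
      ((fun x => tmap a x (s x)) \o chartV c) z)).
    by apply: differentiable_scale; [exact: fh|exact: sh].
  by apply/funext => z /=; rewrite linearZ.
by rewrite s0 // scaler0.
Qed.

Definition fsect (f : M -> C) (fh : holomorphic_on U f) (s : sect E U) :
  sect E U := Sect (is_section_scale fh s).

End SectModule.

Lemma holomorphic_near (W : normedModType C) (U V : set M) (f g : M -> W) :
  open U -> {in U, f =1 g} -> V `<=` U -> holomorphic_on V f ->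
  holomorphic_on V g.
Proof.
move=> Uo fg VU fh c x Vx cx.
apply: (near_eq_differentiable _ (fh c x Vx cx)).
have Ux : nbhs (chartV c (chart c x)) U.
  by rewrite chartK //; apply: open_nbhs_nbhs; split => //; exact: VU.
have Uz : \forall z \near chart c x, U (chartV c z).
  exact: (chartV_continuous cx Ux).
by apply: filterS Uz => z Uz /=; apply: fg; rewrite inE.
Qed.

Section Restriction.
Variables (r : nat) (E : bundleData r).

Definition restr_fun (W : set M) (s : forall x, E x) x : E x :=
  if `[< W x >] then s x else 0.

Lemma is_section_restr (W : opens M) (s : forall x, E x) :
  (forall a : triv E, holomorphic_on (W `&` tdom a) (fun x => tmap a x (s x)))
  -> is_section W (restr_fun W s).
Proof.
move=> sh; split=> [a|x Wx]; last by rewrite /restr_fun; case: asboolP.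
apply: holomorphic_near (sh a); [exact: (openP W)| |by move=> x []].
by move=> x; rewrite inE /restr_fun => Wx; case: asboolP.
Qed.

Lemma restr_subproof (W U : opens M) (WU : W `<=` U) (s : sect E U) :
  is_section W (restr_fun W s).
Proof.
apply: is_section_restr => a c x [Wx ax] cx.
by apply: (sectP s).1 => //; split=> //; exact: WU.
Qed.

Definition restr (W U : opens M) (WU : W `<=` U) (s : sect E U) : sect E W :=
  Sect (restr_subproof WU s).

End Restriction.
End Bundles.

Section AtiyahAlgebra.
Variables (R : realType) (n : nat) (M : complexManifold R n).
Local Notation C := (Cx R).
Local Notation TM := (tangentBundle M).

(* The derivative [v(f)] of a function along a vector field. *)
Definition vf_act (v : forall x, TM x) (f : M -> C) (x : M) : C :=
  'd (f \o chartV (chart_at x)) (chart (chart_at x) x) (v x).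

Lemma vf_actD (v w : forall x, TM x) f x :
  vf_act (fun x => v x + w x) f x = vf_act v f x + vf_act w f x.
Proof. exact: linearD. Qed.

Lemma vf_actZ k (v : forall x, TM x) f x :
  vf_act (fun x => k *: v x) f x = k * vf_act v f x.
Proof. exact: linearZ. Qed.

Lemma vf_act0 f x : vf_act (fun x => 0) f x = 0.
Proof. exact: linear0. Qed.

(* [z] is the Lie bracket of [v] and [w]. There is exactly one such [z], but
   its holomorphy rests on derivatives of holomorphic functions being
   holomorphic, so the bracket is given by its graph. *)
Definition is_vf_bracket (U : opens M) (v w z : sect TM U) :=
  forall (W : opens M) (f : M -> C), W `<=` U -> holomorphic_on W f ->
  forall x, W x ->
    vf_act z f x = vf_act v (vf_act w f) x - vf_act w (vf_act v f) x.

Variable r : nat.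

Section Bundle.
Variable V : bundleData M r.

(* Sections over [U] of the Atiyah algebra: a vector field [symbol] on [U] and
   an endomorphism [at_op] of the sheaf of sections of [V] restricted to [U]. *)
Record atiyah (U : opens M) := Atiyah {
  symbol : sect TM U ;
  at_op : forall W : opens M, W `<=` U -> sect V W -> sect V W ;
  at_op_linear : forall (W : opens M) (WU : W `<=` U), linear (at_op WU) ;
  at_op_restr : forall (W W' : opens M) (WU : W `<=` U) (WU' : W' `<=` U)
    (WW : W' `<=` W) (s : sect V W),
    at_op WU' (restr WW s) = restr WW (at_op WU s) ;
  at_op_leibniz : forall (W : opens M) (WU : W `<=` U) (f : M -> C)
    (fh : holomorphic_on W f) (s : sect V W) x, W x ->
    at_op WU (fsect fh s) x = f x *: at_op WU s x + vf_act symbol f x *: s x }.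

Section AtiyahModule.
Variable U : opens M.

Lemma atiyah_ext (A B : atiyah U) : symbol A = symbol B ->
  (forall (W : opens M) (WU : W `<=` U) s, at_op A WU s = at_op B WU s) ->
  A = B.
Proof.
case: A B => [v p p1 p2 p3] [w q q1 q2 q3] /= vw pq.
have {}pq : p = q.
  apply: functional_extensionality_dep => W.
  apply: functional_extensionality_dep => WU.
  exact: functional_extensionality_dep.
case: w / vw q3 => q3; case: q / pq q1 q2 q3 => q1 q2 q3.
by rewrite (Prop_irrelevance p1 q1) (Prop_irrelevance p2 q2)
  (Prop_irrelevance p3 q3).
Qed.

HB.instance Definition _ := gen_eqMixin (atiyah U).
HB.instance Definition _ := gen_choiceMixin (atiyah U).

Lemma restr0 (W W' : opens M) (WW : W' `<=` W) :
  restr WW (0 : sect V W) = 0.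
Proof. by apply: sect_ext => x /=; rewrite /restr_fun; case: asboolP. Qed.

Lemma restrD (W W' : opens M) (WW : W' `<=` W) (s t : sect V W) :
  restr WW (s + t) = restr WW s + restr WW t.
Proof.
apply: sect_ext => x /=; rewrite /restr_fun.
by case: asboolP => // _; rewrite addr0.
Qed.

Lemma restrZ (W W' : opens M) (WW : W' `<=` W) k (s : sect V W) :
  restr WW (k *: s) = k *: restr WW s.
Proof.
apply: sect_ext => x /=; rewrite /restr_fun.
by case: asboolP => // _; rewrite scaler0.
Qed.

Program Definition at0 : atiyah U :=
  @Atiyah U 0 (fun W WU s => 0) _ _ _.
Next Obligation. by move=> W WU k s t; rewrite scaler0 addr0. Qed.
Next Obligation. by move=> *; rewrite restr0. Qed.
Next Obligation.
by move=> W WU f fh s x Wx; rewrite /= vf_act0 scale0r scaler0 addr0.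
Qed.

Program Definition atD (A B : atiyah U) : atiyah U :=
  @Atiyah U (symbol A + symbol B) (fun W WU s => at_op A WU s + at_op B WU s)
    _ _ _.
Next Obligation.
by move=> A B W WU k s t; rewrite !at_op_linear scalerDr addrACA.
Qed.
Next Obligation.
by move=> A B W W' WU WU' WW s; rewrite restrD; congr (_ + _);
  exact: at_op_restr.
Qed.
Next Obligation.
move=> A B W WU f fh s x Wx; rewrite sectDE !at_op_leibniz // vf_actD.
by rewrite scalerDl sectDE scalerDr addrACA.
Qed.

Program Definition atZ (k : C) (A : atiyah U) : atiyah U :=
  @Atiyah U (k *: symbol A) (fun W WU s => k *: at_op A WU s) _ _ _.
Next Obligation.
by move=> k A W WU l s t; rewrite at_op_linear scalerDr !scalerA mulrC.
Qed.
Next Obligation.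
by move=> k A W W' WU WU' WW s; rewrite restrZ; congr (_ *: _);
  exact: at_op_restr.
Qed.
Next Obligation.
move=> k A W WU f fh s x Wx; rewrite !sectZE at_op_leibniz // vf_actZ.
by rewrite scalerDr !scalerA mulrC.
Qed.

Let atDA : associative atD.
Proof. by move=> *; apply: atiyah_ext => *; rewrite /= addrA. Qed.
Let atDC : commutative atD.
Proof. by move=> *; apply: atiyah_ext => *; rewrite /= addrC. Qed.
Let at0D : left_id at0 atD.
Proof. by move=> *; apply: atiyah_ext => *; rewrite /= add0r. Qed.
Let atND : left_inverse at0 (atZ (-1)) atD.
Proof. by move=> *; apply: atiyah_ext => *; rewrite /= scaleN1r addNr. Qed.

HB.instance Definition _ :=
  GRing.isZmodule.Build (atiyah U) atDA atDC at0D atND.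

Let atZA (k l : C) (A : atiyah U) : atZ k (atZ l A) = atZ (k * l) A.
Proof. by apply: atiyah_ext => *; rewrite /= scalerA. Qed.
Let at1Z : left_id 1 atZ.
Proof. by move=> *; apply: atiyah_ext => *; rewrite /= scale1r. Qed.
Let atZDr : right_distributive atZ +%R.
Proof. by move=> *; apply: atiyah_ext => *; rewrite /= scalerDr. Qed.
Let atZDl (A : atiyah U) : {morph atZ^~ A : k l / k + l}.
Proof. by move=> *; apply: atiyah_ext => *; rewrite /= scalerDl. Qed.

HB.instance Definition _ := GRing.Zmodule_isLmodule.Build C (atiyah U)
  atZA at1Z atZDr atZDl.

End AtiyahModule.

Program Definition at_restr (W U : opens M) (WU : W `<=` U) (A : atiyah U) :
    atiyah W :=
  @Atiyah W (restr WU (symbol A))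
    (fun W' WW => at_op A (subset_trans WW WU)) _ _ _.
Next Obligation. by move=> *; apply: at_op_linear. Qed.
Next Obligation. by move=> *; apply: at_op_restr. Qed.
Next Obligation.
move=> W U WU A W' WW f fh s x Wx; rewrite at_op_leibniz //.
rewrite /vf_act /= /restr_fun; case: asboolP => // nWx.
by case: nWx; exact: WW.
Qed.

Definition is_at_bracket (U : opens M) (A B D : atiyah U) :=
  is_vf_bracket (symbol A) (symbol B) (symbol D) /\
  forall (W : opens M) (WU : W `<=` U) (s : sect V W),
    at_op D WU s = at_op A WU (at_op B WU s) - at_op B WU (at_op A WU s).

End Bundle.

Variable V : vectorBundle M r.
Local Notation At := (atiyah V).

Lemma is_section_frame (a : triv V) (i : 'I_r) (W : opens M) :
  W `<=` tdom a -> is_section W (restr_fun W (fun x => tinv a x (delta_mx 0 i))).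
Proof.
move=> Wa; apply: is_section_restr => b c x [Wx bx] cx.
by apply: cocycle_holomorphic => //; split => //; exact: Wa.
Qed.

Definition frame (a : triv V) (W : opens M) (Wa : W `<=` tdom a) (i : 'I_r) :
  sect V W := Sect (is_section_frame i Wa).

Definition vf_coord (c : atlas M) (W : opens M) (v : sect TM W) (x : M) :
  'rV[C]_n := @tmap _ _ _ _ TM c x (v x).

(* Coordinates of a section [A] of the Atiyah algebra, as an element of a free
   module: by the Leibniz rule [A] is determined by its symbol and by the
   images of the sections of a frame. *)
Definition at_coord (c : atlas M) (a : triv V) (W : opens M)
    (Wa : W `<=` tdom a) (A : At W) (x : M) : 'rV[C]_n * 'M[C]_r :=
  (vf_coord c (symbol A) x,
   \matrix_(i < r) tmap a x (at_op A (@subset_refl _ W) (frame Wa i) x)).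

Definition compacts_of (W : opens M) : set (set M) :=
  [set K | compact K /\ K `<=` W].

(* Continuity with respect to a trivialising open cover: on every open subset
   [W] of a member [W0], the map between spaces of coordinate functions is
   continuous for uniform convergence on the compact subsets of [W]. *)
Definition continuous_morphism (L : forall U, sect TM U -> At U) :=
  forall x, exists (W0 : opens M) (c : atlas M) (a : triv V)
      (W0a : W0 `<=` tdom a),
    [/\ W0 x, W0 `<=` dom c &
      forall (W : opens M) (WW : W `<=` W0),
        continuous ((fun v => at_coord c (subset_trans WW W0a) (L W v)) :
          initial_topology (vf_coord c (W := W) :
            sect TM W -> {family compacts_of W, M -> 'rV[C]_n})
          -> {family compacts_of W, M -> ('rV[C]_n * 'M[C]_r)%type})].

Record lieMap := LieMap {
  lie :> forall U : opens M, {linear sect TM U -> At U} ;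
  lie_restr : forall (W U : opens M) (WU : W `<=` U) (v : sect TM U),
    lie W (restr WU v) = at_restr WU (lie U v) ;
  lie_bracket : forall (U : opens M) (v w z : sect TM U),
    is_vf_bracket v w z -> is_at_bracket (lie U v) (lie U w) (lie U z) ;
  lie_symbol : forall (U : opens M) (v : sect TM U), symbol (lie U v) = v ;
  lie_continuous : continuous_morphism (fun U => lie U) }.

End AtiyahAlgebra.

Record infEquivariantBundle (R : realType) (n : nat) (M : complexManifold R n)
    (r : nat) := InfEquivariantBundle {
  equiv_bundle :> vectorBundle M r ;
  equiv_lie : lieMap equiv_bundle }.

Section DifferentialOperators.
Variables (R : realType) (n : nat).
Local Notation C := (Cx R).

(* Multi-indices with all entries at most [k]; these include all those of
   total degree at most [k]. *)
Definition multiIndex (k : nat) := {ffun 'I_n -> 'I_k.+1}.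

Definition mi_deg k (I : multiIndex k) : nat := (\sum_(i < n) I i)%N.

Definition mi_derive k (I : multiIndex k) (f : 'rV[C]_n -> C) : 'rV[C]_n -> C :=
  foldr (fun i g => iter (I i) (fun h z => 'D_(delta_mx 0 i) h z) g) f
    (enum 'I_n).

Variables (M : complexManifold R n) (r : nat) (V : vectorBundle M r).
Local Notation TM := (tangentBundle M).

Definition diff_op_le (k : nat) (L : forall U, sect TM U -> atiyah V U) :=
  forall (c : atlas M) (a : triv V) x, dom c x -> tdom a x ->
  exists (W0 : opens M) (W0a : W0 `<=` tdom a)
      (coef : multiIndex k -> 'I_n -> M -> 'rV[C]_n * 'M[C]_r),
    [/\ W0 x, W0 `<=` dom c, forall I j, holomorphic_on W0 (coef I j) &
      forall (W : opens M) (WW : W `<=` W0) (v : sect TM W) y, W y ->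
        at_coord c (subset_trans WW W0a) (L W v) y =
        \sum_(I : multiIndex k | (mi_deg I <= k)%N) \sum_(j < n)
          mi_derive I (fun z => vf_coord c v (chartV c z) 0 j) (chart c y)
            *: coef I j y].

End DifferentialOperators.

(* Main.v *)
(* At a point p, evaluate the Lie map on germs of vector fields in the coordinates of
   a chart and a trivialisation. On fields vanishing at p this is, up to sign, a
   representation rho of their Lie algebra by r x r matrices. The bracket with the
   Euler field z - p shows that a monomial field of degree d + 1 acts with weight d
   for the action of a fixed matrix; since d > 0 moves generalized eigenspaces, a
   product of r matrices of positive weight vanishes. Monomial fields of degree at
   least r + 2 are iterated brackets of fields of positive weight, hence are sums of
   words of length r and act by zero; for r = 1 the weights already kill all degrees
   at least 2, as 1 x 1 matrices commute. If rho kills the monomial fields of degree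
   greater than k, it also kills x_i^(k+2) h d_j for every holomorphic germ h, since
   this is a combination of brackets of x_i^a d_i (a > k) with fields x_i^b h d_j.
   With Hadamard's lemma, rho depends only on the Taylor polynomial of order k, which
   is the asserted formula. The coefficients are holomorphic because a monomial
   centred at p is a finite sum of functions of p times functions of z. *)

Require Import Defs.
From HB Require Import structures.
From mathcomp Require Import all_boot all_order all_algebra.
From mathcomp Require Import complex ring lra zify.
From mathcomp Require Import all_classical all_reals all_analysis.

Set Implicit Arguments.
Unset Strict Implicit.
Unset Printing Implicit Defensive.

Import Order.TTheory GRing.Theory Num.Theory.
Import numFieldNormedType.Exports.

Local Open Scope classical_set_scope.
Local Open Scope ring_scope.

(** * Cauchy's estimate by trapezoidal sums *)

(** Holomorphic means complex differentiable near the point, so every analytic fact used on germs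
    (derivatives are again differentiable, mixed derivatives commute, divided differences are
    holomorphic) has to come from bare differentiability. Finite trapezoidal sums give Cauchy's
    bound with a crude constant; powers of the difference quotient turn it into a Lipschitz bound,
    and this into a quadratic Taylor error that is uniform over bounded families. Pointwise limits
    of bounded holomorphic functions are then holomorphic, and both derivatives and Hadamard
    quotients are such limits. The order [r + 1] reflects where the recursion on brackets starts:
    the bracket of [x_j^2 d_j] with itself is zero, so it does not produce [x_j^3 d_j], and a
    monomial field of degree [d] is turned into words of [d - 2] letters only. Killing monomial
    fields says nothing directly about a Taylor remainder, since the Lie map is only C-linear. This
    is why the fields [x_i^(k+2) h d_j] need brackets of their own, with the germ [h] carried
    along. *)

Lemma nested_dyadic (R : realType) (a : nat -> R) : 0 <= a 0%N -> a 0%N <= 0 ->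
  (forall k, a k <= a k.+1) ->
  (forall k, a k.+1 + 2^-1 ^+ k.+1 <= a k + 2^-1 ^+ k) ->
  exists2 x, 0 <= x <= 1 & forall k, a k <= x <= a k + 2^-1 ^+ k.
Proof.
move=> a00 a0 amono bmono.
have am j k : (j <= k)%N -> a j <= a k.
  elim: k => [|k ih]; first by rewrite leqn0 => /eqP ->.
  by rewrite leq_eqVlt => /predU1P[->//|/ih/le_trans]; apply.
have bm j k : (j <= k)%N -> a k + 2^-1 ^+ k <= a j + 2^-1 ^+ j.
  elim: k => [|k ih]; first by rewrite leqn0 => /eqP ->.
  by rewrite leq_eqVlt => /predU1P[->//|/ih]; exact: le_trans.
have ge0 k : 0 <= 2^-1 ^+ k :> R by rewrite exprn_ge0 // invr_ge0 ler0n.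
have ab j k : a j <= a k + 2^-1 ^+ k.
  have [jk|/ltnW kj] := leqP j k.
    by apply: le_trans (am _ _ jk) _; rewrite lerDl.
  by apply: le_trans (bm _ _ kj); rewrite lerDl.
have ub k : ubound (range a) (a k + 2^-1 ^+ k) by move=> _ [j _ <-].
have rs : has_sup (range a).
  by split; [exists (a 0%N), 0%N|exists (a 0%N + 2^-1 ^+ 0); exact: ub].
have H k : a k <= sup (range a) <= a k + 2^-1 ^+ k.
  rewrite ub_le_sup //=; [|by case: rs|by exists k].
  by apply: ge_sup => //; case: rs.
exists (sup (range a)) => //.
have /andP[] := H 0%N; rewrite expr0 => h1 h2; apply/andP; split; lra.
Qed.

(** Compactness of the unit square by bisection: if the conclusion failed, every bad square would
    have a bad quarter, and nested bad squares shrink to a point, where the local hypothesis is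
    violated. The index [k] records the side [2^-1 ^+ k], and [p] the lower left corner. *)
Lemma dyadic_square_induction (R : realType) (P : nat -> R * R -> Prop) :
  (forall k p, (forall b c : bool,
      P k.+1 (p.1 + 2^-1 ^+ k.+1 *+ b, p.2 + 2^-1 ^+ k.+1 *+ c)) -> P k p) ->
  (forall x y, 0 <= x <= 1 -> 0 <= y <= 1 ->
    exists K, forall k p, (K <= k)%N -> p.1 <= x <= p.1 + 2^-1 ^+ k ->
      p.2 <= y <= p.2 + 2^-1 ^+ k -> P k p) ->
  P 0%N (0, 0).
Proof.
move=> Psub Ploc; apply: contrapT => nP.
have ex (kp : nat * (R * R)) : exists d : bool * bool, ~ P kp.1 kp.2 ->
    ~ P kp.1.+1 (kp.2.1 + 2^-1 ^+ kp.1.+1 *+ d.1, kp.2.2 + 2^-1 ^+ kp.1.+1 *+ d.2).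
  case: kp => k p /=.
  have [|nPk] := pselect (P k p); first by exists (false, false).
  have [b /existsNP[c Pbc]] : exists b : bool, ~ forall c : bool,
      P k.+1 (p.1 + 2^-1 ^+ k.+1 *+ b, p.2 + 2^-1 ^+ k.+1 *+ c).
    by apply: contrapT => /forallNP H; apply: nPk; apply: Psub => b c;
      move: c; apply: contrapT; exact: H.
  by exists (b, c).
have [step stepP] := boolp.choice ex.
pose s := fix s n : R * R := if n is m.+1 then
  let d := step (m, s m) in
  ((s m).1 + 2^-1 ^+ m.+1 *+ d.1, (s m).2 + 2^-1 ^+ m.+1 *+ d.2) else (0, 0).
have nPs n : ~ P n (s n).
  by elim: n => // n ih; exact: (stepP (n, s n)).
have half k (b : bool) (x : R) :
    (x <= x + 2^-1 ^+ k.+1 *+ b) *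
    (x + 2^-1 ^+ k.+1 *+ b + 2^-1 ^+ k.+1 <= x + 2^-1 ^+ k).
  have ge0 : 0 <= 2^-1 ^+ k :> R by rewrite exprn_ge0 // invr_ge0 ler0n.
  by rewrite exprS; case: b; rewrite ?mulr1n ?mulr0n; split; lra.
have [x x01 xs] : exists2 x, 0 <= x <= 1 &
    forall k, (s k).1 <= x <= (s k).1 + 2^-1 ^+ k.
  by apply: nested_dyadic => //= k; rewrite half.
have [y y01 ys] : exists2 y, 0 <= y <= 1 &
    forall k, (s k).2 <= y <= (s k).2 + 2^-1 ^+ k.
  by apply: nested_dyadic => //= k; rewrite half.
have [K PK] := Ploc x y x01 y01.
by apply: (nPs K); exact: PK.
Qed.

Section Cx.
Variable R : realType.
Local Notation C := (Cx R).

Lemma Cx_realE (x : C) : x \is Num.real -> x = (complex.Re x)%:C%C.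
Proof. by move=> /RRe_real. Qed.

Lemma Cx_ge0E (x : C) : 0 <= x -> x = (complex.Re x)%:C%C.
Proof. by move=> /ger0_real /Cx_realE. Qed.

Lemma Cx_natr_bound (x : C) : 0 <= x -> exists n : nat, x <= n%:R.
Proof.
move=> x0; exists (Num.bound (complex.Re x)).
have := Cx_ge0E x0; set r := complex.Re x => xE; have r0 : 0 <= r.
  by move: x0; rewrite xE; rewrite (lecR 0 r).
have : (r%:C <= (Num.bound r)%:R%:C)%C.
  by rewrite lecR; exact/ltW/archi_boundP.
by rewrite xE rmorph_nat.
Qed.

Lemma Cx_half_small (M d : C) : 0 <= M -> 0 < d ->
  exists K, forall k, (K <= k)%N -> M * 2^-1 ^+ k <= d.
Proof.
move=> M0 d0; have [K hK] := Cx_natr_bound (divr_ge0 M0 (ltW d0)).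
exists K => k Kk; rewrite exprVn ler_pdivrMr ?exprn_gt0 ?ltr0n//.
move: hK; rewrite ler_pdivrMr// => /le_trans; apply.
rewrite mulrC ler_pM2l// -natrX ler_nat.
by rewrite (leq_trans Kk)// ltnW// ltn_expl.
Qed.

End Cx.

Lemma differentiable_near_linear (K : numFieldType) (V W : normedModType K)
  (f : V -> W) x : differentiable f x -> forall e, 0 < e ->
  \forall z \near x, `|f z - f x - 'd f x (z - x)| <= e * `|z - x|.
Proof.
move=> df e e0; have /eqaddoP/(_ e e0) := diff_locally df.
rewrite [in X in _ -> X](near_shift 0) subr0; apply: filterS => h /=.
by rewrite !fctE /= addrK opprD addrA.
Qed.

Section Trapezoid.
Variable C : numClosedFieldType.
Implicit Types (f g : C -> C) (a b u z : C) (m : nat) (D : set C).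

(* Composite trapezoidal rule with [2 ^ m] steps for the integral of [f] along the
   segment from [a] to [b]. It satisfies exactly the additivity under halving that
   Goursat's argument needs, so no integral has to be constructed. *)
Fixpoint trap f m a b : C :=
  if m is m'.+1 then trap f m' a ((a + b) / 2) + trap f m' ((a + b) / 2) b
  else (f a + f b) / 2 * (b - a).

(** All sample points of [trap] arise from the end points by repeated midpoints, so this weak form
    of convexity is enough for the estimates. *)
Definition midconvex D := forall x y, D x -> D y -> D ((x + y) / 2).

Lemma trapN f m a b : trap f m b a = - trap f m a b.
Proof.
elim: m a b => [|m ih] a b /=; first by field.
rewrite (addrC b a) [X in X + _]ih [X in _ + X]ih; ring.
Qed.

Lemma trap_lin f g k m a b :
  trap (fun z => f z + k * g z) m a b = trap f m a b + k * trap g m a b.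
Proof.
elim: m a b => [|m ih] a b /=; first by field.
by rewrite !ih mulrDr addrACA.
Qed.

Lemma trap_affine al be m a b :
  trap (fun z => al + be * z) m a b = al * (b - a) + be * (b ^+ 2 - a ^+ 2) / 2.
Proof.
elim: m a b => [|m ih] a b /=; first by field.
by rewrite !ih; field.
Qed.

Lemma le_trap f m a b D M : midconvex D -> D a -> D b ->
  (forall z, D z -> `|f z| <= M) -> `|trap f m a b| <= M * `|b - a|.
Proof.
move=> mD Da Db fM; elim: m a b Da Db => [|m ih] a b Da Db /=.
  rewrite normrM ler_wpM2r// normf_div [`|2|]ger0_norm// ler_pdivrMr//.
  by rewrite (le_trans (ler_normD _ _))// mulr_natr mulr2n lerD// fM.
have Dc := mD _ _ Da Db.
apply: le_trans (ler_normD _ _) _.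
apply: le_trans (lerD (ih _ _ Da Dc) (ih _ _ Dc Db)) _.
rewrite -mulrDr (_ : (a + b) / 2 - a = (b - a) / 2); last by field.
rewrite (_ : b - (a + b) / 2 = (b - a) / 2); last by field.
rewrite normf_div [`|2|]ger0_norm// -mulr2n -[_ *+ 2]mulr_natr divfK//.
Qed.

Definition square_trap f m a u : C :=
  trap f m a (a + u) + trap f m (a + u) (a + u + 'i * u)
  + trap f m (a + u + 'i * u) (a + 'i * u) + trap f m (a + 'i * u) a.

(** At level [m.+1] each outer edge is exactly the sum of its two halves at level [m], and the inner
    edges cancel by [trapN]. *)
Lemma square_trap_split f m a u : square_trap f m.+1 a u =
  square_trap f m a (u / 2) + square_trap f m (a + u / 2) (u / 2) +
  square_trap f m (a + 'i * (u / 2)) (u / 2) +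
  square_trap f m (a + u / 2 + 'i * (u / 2)) (u / 2).
Proof.
rewrite /square_trap /=.
set v := u / 2; have -> : u = v + v by rewrite /v; field.
set w := 'i * v.
have -> : (a + (a + (v + v))) / 2 = a + v by field.
have -> : 'i * (v + v) = w + w by rewrite mulrDr.
have -> : (a + (v + v) + (a + (v + v) + (w + w))) / 2 = a + v + v + w by field.
have -> : (a + (v + v) + (w + w) + (a + (w + w))) / 2 = a + v + w + w by field.
have -> : (a + (w + w) + a) / 2 = a + w by field.
rewrite !addrA.
have -> : a + v + w + v = a + v + v + w by ring.
have -> : a + w + v = a + v + w by ring.
rewrite (trapN f m (a + v) (a + v + w)) (trapN f m (a + w) (a + v + w)).
rewrite (trapN f m (a + v + w) (a + v + v + w)).
rewrite (trapN f m (a + v + w) (a + v + w + w)).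
ring.
Qed.

(** The trapezoidal rule is exact on affine functions, so the linear approximation in Goursat's
    argument leaves only its error term. *)
Lemma square_trap_affine al be m a u :
  square_trap (fun z => al + be * z) m a u = 0.
Proof. by rewrite /square_trap !trap_affine; field. Qed.

Lemma square_trap_lin f g k m a u :
  square_trap (fun z => f z + k * g z) m a u =
  square_trap f m a u + k * square_trap g m a u.
Proof. by rewrite /square_trap !trap_lin; ring. Qed.

Lemma le_square_trap f m a u D M : midconvex D ->
  D a -> D (a + u) -> D (a + u + 'i * u) -> D (a + 'i * u) ->
  (forall z, D z -> `|f z| <= M) -> `|square_trap f m a u| <= 4 * M * `|u|.
Proof.
move=> mD D0 D1 D2 D3 fM.
have iu : `|'i * u| = `|u| by rewrite normrM normCi mul1r.
have le4 (w x y z : C) K : `|w| <= K -> `|x| <= K -> `|y| <= K -> `|z| <= K ->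
    `|w + x + y + z| <= 4 * K.
  move=> *; have -> : 4 * K = K + K + K + K by ring.
  by rewrite !(le_trans (ler_normD _ _)) ?lerD// !(le_trans (ler_normD _ _)) ?lerD//
     (le_trans (ler_normD _ _)) ?lerD.
rewrite -mulrA; apply: le4.
- by have := le_trap m mD D0 D1 fM; rewrite (_ : _ - _ = u)//; ring.
- by have := le_trap m mD D1 D2 fM; rewrite (_ : _ - _ = 'i * u) ?iu//; ring.
- have := le_trap m mD D2 D3 fM.
  by rewrite (_ : _ - _ = - u) ?normrN//; ring.
- have := le_trap m mD D3 D0 fM.
  by rewrite (_ : a - _ = - ('i * u)) ?normrN ?iu//; ring.
Qed.

End Trapezoid.

Lemma diff_scale1 (K : numFieldType) (W : normedModType K) (f : K -> W) (x h : K) :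
  'd f x h = h *: 'd f x 1.
Proof. by rewrite -linearZ /= [h *: 1]mulr1. Qed.

(** * Goursat's theorem on squares *)

Section Goursat.
Variable R : realType.
Local Notation C := (Cx R).
Implicit Types (f : C -> C) (a u z : C) (m k : nat).

Definition RtoC (x : R) : C := x%:C%C.

Lemma RtoCB x y : RtoC (x - y) = RtoC x - RtoC y.
Proof. exact: (rmorphB (real_complex R)). Qed.

Lemma RtoCD x y : RtoC (x + y) = RtoC x + RtoC y.
Proof. exact: (rmorphD (real_complex R)). Qed.

Lemma RtoC0 : RtoC 0 = 0. Proof. by []. Qed.

Lemma RtoC_half k : RtoC (2^-1 ^+ k) = 2^-1 ^+ k.
Proof. by rewrite /RtoC rmorphXn/= fmorphV/= rmorph_nat. Qed.

Lemma RtoC_norm_le x k : `|x| <= 2^-1 ^+ k -> `|RtoC x| <= 2^-1 ^+ k.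
Proof.
move=> xk; rewrite -RtoC_half /RtoC normc_def/= expr0n/= addr0 sqrtr_sqr.
by rewrite lecR.
Qed.

Definition grid_point a u (p : R * R) : C := a + u * (RtoC p.1 + 'i * RtoC p.2).

Lemma grid_point_dist a u (x y : R) (p : R * R) k :
  `|x - p.1| <= 2^-1 ^+ k -> `|y - p.2| <= 2^-1 ^+ k ->
  `|grid_point a u p - grid_point a u (x, y)| <= 2 * `|u| * 2^-1 ^+ k.
Proof.
move=> hx hy.
have -> : grid_point a u p - grid_point a u (x, y) =
    u * - (RtoC (x - p.1) + 'i * RtoC (y - p.2)).
  by rewrite /grid_point !RtoCB /=; ring.
rewrite normrM mulrAC mulrC ler_wpM2r// normrN (le_trans (ler_normD _ _))//.
rewrite normrM normCi mul1r mulrDl mul1r lerD//; exact: RtoC_norm_le.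
Qed.

Lemma goursat f a u :
  (forall x y : R, 0 <= x <= 1 -> 0 <= y <= 1 ->
     differentiable f (grid_point a u (x, y))) ->
  forall e, 0 < e -> exists N, forall m, (N <= m)%N ->
    `|square_trap f m a u| <= e.
Proof.
move=> df e e0.
(* The tolerance [e * 4^-1 ^+ k] is proportional to the area, so it adds up over the four quarters;
   each subdivision lowers the level of the sums by one. *)
pose P k p := exists N, forall m, (N <= m)%N ->
  `|square_trap f m (grid_point a u p) (u * 2^-1 ^+ k)| <= e * 4^-1 ^+ k.
suff : P 0%N (0, 0).
  by rewrite /P /grid_point /= RtoC0 !(mulr0, addr0) !expr0 !mulr1.
apply: dyadic_square_induction => [k p Psub|x y x01 y01].
  have [N00 h00] := Psub false false; have [N10 h10] := Psub true false.
  have [N01 h01] := Psub false true; have [N11 h11] := Psub true true.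
  exists (maxn (maxn N00 N10) (maxn N01 N11)).+1 => -[//|m].
  rewrite ltnS !geq_max => /andP[/andP[m00 m10] /andP[m01 m11]].
  move: (h00 m m00) (h10 m m10) (h01 m m01) (h11 m m11).
  rewrite square_trap_split /grid_point /=.
  rewrite !mulr0n !mulr1n !addr0 !RtoCD !RtoC_half.
  have -> : u * 2^-1 ^+ k / 2 = u * 2^-1 ^+ k.+1 by rewrite exprSr mulrA.
  set h := 2^-1 ^+ k.+1.
  have -> : a + u * (RtoC p.1 + h + 'i * RtoC p.2) =
    a + u * (RtoC p.1 + 'i * RtoC p.2) + u * h by ring.
  have -> : a + u * (RtoC p.1 + 'i * (RtoC p.2 + h)) =
    a + u * (RtoC p.1 + 'i * RtoC p.2) + 'i * (u * h) by ring.
  have -> : a + u * (RtoC p.1 + h + 'i * (RtoC p.2 + h)) =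
    a + u * (RtoC p.1 + 'i * RtoC p.2) + u * h + 'i * (u * h) by ring.
  have -> : e * 4^-1 ^+ k = e * 4^-1 ^+ k.+1 + e * 4^-1 ^+ k.+1 +
      e * 4^-1 ^+ k.+1 + e * 4^-1 ^+ k.+1 by rewrite exprS; field.
  by move=> *; rewrite !(le_trans (ler_normD _ _)) ?lerD// !(le_trans (ler_normD _ _))
    ?lerD// (le_trans (ler_normD _ _)) ?lerD.
set c := grid_point a u (x, y).
have dfc := df x y x01 y01.
(* The disc [D] below has radius [4 * |u| * h], and the small square has perimeter [4 * |u| * h];
   this [e'] brings the resulting bound below [e * h ^+ 2], also when [u = 0]. *)
pose e' := e / (16 * `|u| ^+ 2 + 1).
have den : 0 < 16 * `|u| ^+ 2 + 1 :> C.
  by rewrite ltr_wpDl// mulr_ge0// exprn_ge0.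
have e'0 : 0 < e' by rewrite divr_gt0.
have /nbhs_ballP[d /= d0 hd] := differentiable_near_linear dfc e'0.
have M0 : 0 <= 4 * `|u| + 1 by rewrite addr_ge0// mulr_ge0.
have d20 : 0 < d / 2 by rewrite divr_gt0.
have [K hK] := Cx_half_small M0 d20.
exists K => k p Kk /andP[x1 x2] /andP[y1 y2]; exists 0%N => m _.
set h := 2^-1 ^+ k.
have h0 : 0 <= h :> C by rewrite exprn_ge0// invr_ge0 ler0n.
have hh : (2^-1 ^+ k : C) = h by [].
set D := [set z : C | `|z - c| <= 4 * `|u| * h].
have mD : midconvex D.
  move=> z w; rewrite /D /= => zD wD.
  have -> : (z + w) / 2 - c = (z - c) / 2 + (w - c) / 2 by field.
  rewrite (le_trans (ler_normD _ _))// !normf_div [`|2|]ger0_norm//.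
  by rewrite [leRHS]splitr lerD// ler_pM2r// invr_gt0.
set q := grid_point a u p.
have qc : `|q - c| <= 2 * `|u| * h.
  by apply: grid_point_dist; rewrite ger0_norm ?subr_ge0// lerBlDl.
have uh : `|u * h| = `|u| * h by rewrite normrM (ger0_norm h0).
have iuh : `|'i * (u * h)| = `|u| * h by rewrite normrM normCi mul1r uh.
have inD w : `|w| <= 2 * `|u| * h -> D (q + w).
  move=> hw; rewrite /D /= addrAC (le_trans (ler_normD _ _))//.
  have -> : 4 * `|u| * h = 2 * `|u| * h + 2 * `|u| * h by ring.
  exact: lerD.
have hD z : D z -> `|f z - f c - 'd f c (z - c)| <= e' * (4 * `|u| * h).
  move=> Dz; apply: le_trans (hd z _) _.
    rewrite /= -ball_normE /= distrC (le_lt_trans Dz)//.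
    apply: le_lt_trans (_ : (4 * `|u| + 1) * h < d).
      by rewrite ler_wpM2r// lerDl.
    rewrite (le_lt_trans (hK k Kk))// [ltRHS]splitr ltrDl//.
  by rewrite ler_pM2l.
pose al := f c - 'd f c 1 * c; pose be := 'd f c 1.
have -> : square_trap f m q (u * h) =
    square_trap (fun z => (f z - f c - 'd f c (z - c))
      + 1 * (al + be * z)) m q (u * h).
  congr (square_trap _ _ _ _); apply/funext => z.
  have -> : 'd f c (z - c) = be * (z - c).
    by rewrite [LHS]diff_scale1 mulrC.
  by rewrite /al /be; ring.
rewrite square_trap_lin square_trap_affine mulr0 addr0.
apply: le_trans (le_square_trap _ mD _ _ _ _ hD) _.
- by rewrite -[q]addr0; apply: inD; rewrite normr0 mulr_ge0// mulr_ge0.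
- by apply: inD; rewrite uh ler_wpM2r// ler_peMl// ler1n.
- rewrite -addrA; apply: inD; rewrite (le_trans (ler_normD _ _))// uh iuh.
  by rewrite (_ : 2 * _ * _ = `|u| * h + `|u| * h)//; ring.
- by apply: inD; rewrite iuh ler_wpM2r// ler_peMl// ler1n.
rewrite uh /e'.
have -> : 4^-1 ^+ k = h * h.
  by rewrite /h -exprMn; congr (_ ^+ _); field.
have -> : 4 * (e / (16 * `|u| ^+ 2 + 1) * (4 * `|u| * h)) * (`|u| * h) =
  e * (h * h) * (16 * `|u| ^+ 2 / (16 * `|u| ^+ 2 + 1)).
  by field; rewrite gt_eqF.
rewrite ler_piMr// ?mulr_ge0// ?(ltW e0)//.
by rewrite ler_pdivrMr// mul1r lerDl.
Qed.

End Goursat.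

Lemma le_absorb (K : numFieldType) (x a : K) :
  (forall e, 0 < e -> x <= e + a) -> x <= a.
Proof. by move=> h; apply/ler_addgt0Pl. Qed.

Section TrapezoidOutline.
Variable C : numClosedFieldType.
Implicit Types (g : C -> C) (a b u z : C) (m : nat) (D : set C).

Lemma trap_Re g m a b D v ka c : midconvex D -> D a -> D b -> 0 <= c ->
  b - a = c * v -> (forall z, D z -> ka <= 'Re (g z * v)) ->
  c * ka <= 'Re (trap g m a b).
Proof.
move=> mD Da Db; elim: m a b c Da Db => [|m ih] a b c Da Db c0 bac hg /=.
  rewrite bac [X in 'Re X](_ : _ = c * 2^-1 * (g a * v) + c * 2^-1 * (g b * v)); last first.
    by field.
  have c2 : c / 2 \is Num.real by rewrite ger0_real// divr_ge0.
  rewrite raddfD /= !(ReMl c2) -mulrDr (_ : c * ka = c / 2 * (ka + ka)).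
    by rewrite ler_wpM2l ?divr_ge0// lerD//; exact: hg.
  by field.
have Dc := mD _ _ Da Db; rewrite raddfD /= [c]splitr mulrDl.
have c2 : 0 <= c / 2 by rewrite divr_ge0.
apply: lerD; apply: ih => //.
  by rewrite (_ : _ - _ = (b - a) / 2); [rewrite bac|]; field.
by rewrite (_ : _ - _ = (b - a) / 2); [rewrite bac|]; field.
Qed.

(** The form [dz / z] is invariant under multiplication by [u], so the four sides of the outline
    contribute equally. *)
Lemma trap_inv_rot m u a b : u != 0 ->
  trap (fun z => z^-1) m (u * a) (u * b) = trap (fun z => z^-1) m a b.
Proof.
move=> u0; elim: m a b => [|m ih] a b /=.
  by rewrite !invfM -mulrDr; set A := a^-1 + b^-1; field.
by rewrite -mulrDr -mulrA !ih.
Qed.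

Definition side u := [set z | exists2 t : C, -1 <= t <= 1 & z = u * (1 + 'i * t)].

Lemma midconvex_side u : midconvex (side u).
Proof.
move=> _ _ [t /andP[t1 t2] ->] [s /andP[s1 s2] ->].
exists ((t + s) / 2); last by field.
have two x : x * 2 = x + x :> C by ring.
by rewrite ler_pdivlMr// ler_pdivrMr// !two !lerD.
Qed.

Lemma side_real (t : C) : -1 <= t <= 1 -> t \is Num.real.
Proof. by move=> /andP[_ /ler_real ->]. Qed.

(** Places the square with vertices [+-1 +-'i] in the annulus on which [cauchy_bound] controls the
    function. *)
Lemma side_norm u z : `|u| = 1 -> side u z -> 1 <= `|z| <= 2.
Proof.
move=> u1 [t t1 ->]; rewrite normrM u1 mul1r; have tr := side_real t1.
rewrite -ler_sqr ?nnegrE// -[X in _ && X]ler_sqr ?nnegrE//.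
rewrite normC2_rect// expr1n lerDl real_exprn_even_ge0//=.
have : t ^+ 2 <= 1.
  rewrite -real_normK// -[leRHS](expr1n _ 2) ler_sqr ?nnegrE//.
  by rewrite real_ler_norml.
by move=> h; rewrite (_ : 2 ^+ 2 = 1 + 3) ?lerD// ?(le_trans h) ?ler1n// -natrX.
Qed.

Lemma side_end u (b : bool) : side u (u * (1 + 'i * (-1) ^+ b)).
Proof.
exists ((-1) ^+ b) => //.
by case: b; rewrite ?expr1 ?expr0 lexx ?andbT/= (le_trans (lerN10 _) ler01).
Qed.

(* Trapezoidal sum along the boundary of the square with vertices [+-1 +-'i]. *)
Definition outline g m : C :=
  \sum_(u <- [:: 1; 'i; -1; - 'i]) trap g m.+1 (u * (1 - 'i)) (u * (1 + 'i)).

(** The large square is cut into four unit squares meeting at [0]: each of its sides, split at its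
    midpoint [u], gives one half to each of two neighbours, and the edges through [0] cancel. *)
Lemma outlineE g m : outline g m =
  \sum_(u <- [:: 1; 'i; -1; - 'i]) square_trap g m 0 u.
Proof.
pose A u := trap g m u (u + 'i * u); pose B u := trap g m (u + 'i * u) ('i * u).
have sq u : square_trap g m 0 u = trap g m 0 u + A u + B u - trap g m 0 ('i * u).
  by rewrite /square_trap !add0r (trapN g m 0 ('i * u)).
have ol u : trap g m.+1 (u * (1 - 'i)) (u * (1 + 'i)) = B (- 'i * u) + A u.
  rewrite /= /A /B; congr (trap g m _ _ + trap g m _ _).
  - rewrite (_ : 'i * (- 'i * u) = - 'i ^+ 2 * u); last by ring.
    by rewrite sqrCi; ring.
  - rewrite (_ : 'i * (- 'i * u) = - 'i ^+ 2 * u); last by ring.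
    by rewrite sqrCi; field.
  - by field.
  - by ring.
have e1 : 'i * 1 = 'i :> C by rewrite mulr1.
have e2 : 'i * 'i = -1 :> C by rewrite -expr2 sqrCi.
have e3 : 'i * -1 = - 'i :> C by rewrite mulrN1.
have e4 : 'i * - 'i = 1 :> C by rewrite mulrN e2 opprK.
rewrite /outline !big_cons !big_nil !ol !sq.
by rewrite !mulNr !e1 !e2 !e3 !e4 !opprK; ring.
Qed.

End TrapezoidOutline.

Section OutlineBounds.
Variable C : numClosedFieldType.
Implicit Types (g : C -> C) (u z : C) (m : nat).

Lemma unit4_norm u : u \in [:: 1; 'i; -1; - 'i] -> `|u| = 1.
Proof.
by rewrite !inE => /or4P[] /eqP ->; rewrite ?normrN ?normCi ?normr1.
Qed.

Lemma side_ends u : side u (u * (1 - 'i)) /\ side u (u * (1 + 'i)).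
Proof.
by split; [have := @side_end C u true|have := @side_end C u false];
  rewrite ?expr1 ?expr0 ?mulrN1 ?mulr1.
Qed.

Lemma le_outline g m B : (forall z, 1 <= `|z| <= 2 -> `|g z| <= B) ->
  `|outline g m| <= 8 * B.
Proof.
move=> gB.
have H u : u \in [:: 1; 'i; -1; - 'i] ->
    `|trap g m.+1 (u * (1 - 'i)) (u * (1 + 'i))| <= B * 2.
  move=> /unit4_norm u1; have [e1 e2] := side_ends u.
  have := le_trap m.+1 (@midconvex_side C u) e1 e2
    (fun z hz => gB z (side_norm u1 hz)).
  rewrite (_ : u * (1 + 'i) - _ = u * 'i * 2); last by ring.
  by rewrite !normrM u1 normCi !mul1r ger0_norm.
rewrite /outline !big_cons big_nil addr0.
have -> : 8 * B = B * 2 + (B * 2 + (B * 2 + B * 2)) by ring.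
by do 3!rewrite (le_trans (ler_normD _ _))// lerD// ?H ?inE ?eqxx ?orbT//.
Qed.

(** The integral would be [2 pi i]; a lower bound away from zero is enough. On the side [u = 1],
    whose increment is [2 * 'i], the factor [- 'i] leads to [2 / z], with real part
    [2 / (1 + t ^+ 2) >= 1]. *)
Lemma outline_inv_ge m : 4 <= `|outline (fun z => z^-1) m|.
Proof.
have -> : outline (fun z : C => z^-1) m =
    4 * trap (fun z => z^-1) m.+1 (1 - 'i) (1 + 'i).
  rewrite /outline !big_cons big_nil addr0.
  rewrite !trap_inv_rot ?oppr_eq0 ?oner_eq0 ?neq0Ci//.
  ring.
rewrite normrM [`|4|]ger0_norm// ler_peMr//.
have [e1 e2] := side_ends 1; rewrite !mul1r in e1 e2.
have h : forall z : C, side 1 z -> 1 <= 'Re ((0 + (- 'i) * z^-1) * (2 * 'i)).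
  move=> z [t t1 ->]; rewrite mul1r add0r; have tr := side_real t1.
  have n0 : 0 < 1 + t ^+ 2 by rewrite ltr_pwDl// real_exprn_even_ge0.
  have n1 : (1 + 'i * t) * (1 - 'i * t) = 1 + t ^+ 2.
    rewrite (_ : (_ * _) = 1 - 'i ^+ 2 * t ^+ 2); last by ring.
    by rewrite sqrCi mulN1r opprK.
  have z0 : 1 + 'i * t != 0.
    by apply: contraTneq n0 => z0; rewrite -n1 z0 mul0r ltxx.
  have -> : (1 + 'i * t)^-1 = (1 - 'i * t) / (1 + t ^+ 2).
    rewrite -n1 invfM mulrCA mulfV ?mulr1//.
    by apply: contraTneq n0 => z1; rewrite -n1 z1 mulr0 ltxx.
  have -> : - 'i * ((1 - 'i * t) / (1 + t ^+ 2)) * (2 * 'i) =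
     2 / (1 + t ^+ 2) + 'i * (- (2 * t / (1 + t ^+ 2))).
    have -> : - 'i * ((1 - 'i * t) / (1 + t ^+ 2)) * (2 * 'i) =
      - 'i ^+ 2 * ((1 - 'i * t) / (1 + t ^+ 2)) * 2 by ring.
    by rewrite sqrCi opprK mul1r; ring.
  have s0 : 1 + t ^+ 2 \is Num.real by rewrite gtr0_real.
  rewrite Re_rect ?rpredN ?rpred_div ?rpredM ?realn//.
  rewrite ler_pdivlMr// mul1r (_ : 2 = 1 + 1) ?lerD2l//.
  rewrite -real_normK// -[leRHS](expr1n _ 2) ler_sqr ?nnegrE//.
  by rewrite real_ler_norml.
have bac : 1 + 'i - (1 - 'i) = 1 * (2 * 'i) :> C by ring.
have := trap_Re m.+1 (@midconvex_side C 1) e1 e2 ler01 bac h.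
rewrite mul1r (trap_lin (fun=> 0)).
have -> : trap (fun=> 0) m.+1 (1 - 'i) (1 + 'i) = 0 :> C.
  have -> : (fun=> 0) = (fun z : C => 0 + 0 * z).
    by apply/funext => z; rewrite mul0r addr0.
  by rewrite trap_affine !mul0r addr0.
rewrite add0r => /le_trans; apply.
apply: le_trans (real_ler_norm (Creal_Re _)) _.
rewrite (le_trans (leif_normC_Re_Creal _).1)// normrM normrN normCi mul1r//.
Qed.

End OutlineBounds.

(** Near [0] differentiability bounds the quotient by [1 + |'d f 0 1|], elsewhere the denominator is
    bounded below; at [0] itself the quotient is [0] by the convention on division. *)
Lemma bounded_quotient (K : numFieldType) (f : K -> K) r B :
  differentiable f 0 -> 0 <= r -> (forall z, `|z| <= r -> `|f z| <= B) ->
  exists H, forall z, `|z| <= r -> `|(f z - f 0) / z| <= H.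
Proof.
move=> dz r0 fB; have f0 : `|f 0| <= B by apply: fB; rewrite normr0.
have /nbhs_ballP[d /= d0 hd] := differentiable_near_linear dz ltr01.
have H0 : 0 <= 2 * B / d.
  by rewrite divr_ge0 ?(ltW d0)// mulr_ge0// (le_trans _ f0).
exists (1 + `|'d f 0 1| + 2 * B / d) => z z2.
have [->|z0] := eqVneq z 0.
  by rewrite subrr mul0r normr0 !addr_ge0.
rewrite normf_div ler_pdivrMr ?normr_gt0//.
have [zd|] := boolP (`|z| < d).
  have := hd z; rewrite -ball_normE/= sub0r normrN subr0 => /(_ zd).
  rewrite diff_scale1 mul1r -[_ *: _]/(z * 'd f 0 1) => zh.
  rewrite -[f z - f 0](subrK (z * 'd f 0 1)) (le_trans (ler_normD _ _))//.
  rewrite 2!mulrDl mul1r -[leRHS]addrA lerD//.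
  by rewrite normrM [leLHS]mulrC lerDl mulr_ge0.
rewrite -real_leNgt ?normr_real ?gtr0_real// => dz'.
rewrite [leRHS]mulrDl (le_trans (ler_normB _ _))//.
rewrite (le_trans (lerD (fB _ z2) f0))//.
rewrite (_ : B + B = 2 * B); last by ring.
apply: le_trans (_ : 2 * B / d * `|z| <= _).
  rewrite -mulrA ler_peMr//; first by rewrite mulr_ge0// (le_trans _ f0).
  by rewrite mulrC ler_pdivlMr// mul1r.
by rewrite lerDr mulr_ge0// addr_ge0.
Qed.

(** * Cauchy's bound at the centre of a square *)

Section CauchyBound.
Variable R : realType.
Local Notation C := (Cx R).
Implicit Types (f : C -> C) (p a u z : C) (m k : nat).

(* The corner [0] is allowed to be singular: subdividing towards it, only the
   smallest square, of side [|u| / 2 ^ k], is estimated by the bound [B]. *)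
Lemma corner_trap f u B :
  (forall x y : R, 0 <= x <= 1 -> 0 <= y <= 1 -> (x != 0) || (y != 0) ->
     differentiable f (grid_point 0 u (x, y))) ->
  (forall z, `|z| <= 2 * `|u| -> `|f z| <= B) ->
  forall e, 0 < e -> exists N, forall m, (N <= m)%N ->
    `|square_trap f m 0 u| <= e.
Proof.
move=> df fB e e0.
suff H k : forall u',
  (forall x y : R, 0 <= x <= 1 -> 0 <= y <= 1 -> (x != 0) || (y != 0) ->
     differentiable f (grid_point 0 u' (x, y))) ->
  (forall z, `|z| <= 2 * `|u'| -> `|f z| <= B) ->
  forall e, 0 < e -> exists N, forall m, (N <= m)%N ->
    `|square_trap f m 0 u'| <= e + 4 * B * `|u'| * 2^-1 ^+ k.
  have B0 : 0 <= B.
    by apply: le_trans (fB 0 _); rewrite ?normr0 ?mulr_ge0.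
  have e20 : 0 < e / 2 by rewrite divr_gt0.
  have M0 : 0 <= 4 * B * `|u| by rewrite !mulr_ge0.
  have [k hk] := Cx_half_small M0 e20.
  have [N hN] := H k u df fB _ e20; exists N => m Nm.
  by rewrite (le_trans (hN m Nm))// [leRHS]splitr lerD2l hk.
elim: k => [|k ih] {df fB e e0}u df fB e e0.
  exists 0%N => m _; rewrite expr0 mulr1.
  pose D := [set z : C | `|z| <= 2 * `|u|].
  have mD : midconvex D.
    move=> z w; rewrite /D /= => zD wD.
    rewrite mulrDl (le_trans (ler_normD _ _))// !normf_div [`|2|]ger0_norm//.
    by rewrite [leRHS]splitr lerD// ler_pM2r// invr_gt0.
  have u2 : `|u| <= 2 * `|u| by rewrite ler_peMl// ler1n.
  have iu : `|'i * u| = `|u| by rewrite normrM normCi mul1r.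
  rewrite (le_trans (le_square_trap m mD _ _ _ _ fB)) ?lerDr ?(ltW e0)//.
  - by rewrite /D /= normr0 mulr_ge0.
  - by rewrite /D /= add0r.
  - by rewrite /D /= add0r (le_trans (ler_normD _ _))// iu mulr_natl mulr2n.
  - by rewrite /D /= add0r iu.
have r2 x : RtoC x / 2 = RtoC (x / 2) :> C.
  by rewrite /RtoC rmorphM/= fmorphV/= rmorph_nat.
have rh : 2^-1 = RtoC (2^-1) :> C by rewrite /RtoC fmorphV/= rmorph_nat.
have itv (x : R) : 0 <= x <= 1 -> 0 <= x / 2 <= 1 /\ 0 <= 2^-1 + x / 2 <= 1.
  by move=> /andP[x0 x1]; split; apply/andP; split; lra.
have h0 (x : R) : 0 <= x <= 1 -> 2^-1 + x / 2 != 0.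
  by move=> /andP[x0 x1]; apply/eqP => h; move: x0; lra.
have u2 : `|u / 2| = `|u| / 2 by rewrite normf_div [`|2|]ger0_norm.
have e4 : 0 < e / 4 by rewrite divr_gt0.
have [N0 H0] : exists N, forall m, (N <= m)%N -> `|square_trap f m 0 (u / 2)|
    <= e / 4 + 4 * B * `|u / 2| * 2^-1 ^+ k.
  apply: (ih (u / 2) _ _ (e / 4) e4) => [x y x01 y01 xy|z hz].
    rewrite (_ : grid_point _ _ _ = grid_point 0 u (x / 2, y / 2)).
      have [x2 _] := itv x x01; have [y2 _] := itv y y01.
      by apply: df => //; rewrite !mulf_eq0 !invr_eq0 !pnatr_eq0 !orbF.
    by rewrite /grid_point /= -!r2; field.
  apply: fB; rewrite (le_trans hz)// u2 ler_wpM2l// ler_pdivrMr//.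
  by rewrite ler_peMr// ler1n.
have [N1 H1] : exists N, forall m, (N <= m)%N ->
    `|square_trap f m (0 + u / 2) (u / 2)| <= e / 4.
  apply: goursat => // x y x01 y01.
  rewrite (_ : grid_point _ _ _ = grid_point 0 u (2^-1 + x / 2, y / 2)).
    have [_ x2] := itv x x01; have [y2 _] := itv y y01.
    by apply: df => //; rewrite h0.
  by rewrite /grid_point /= RtoCD -!r2 -rh; field.
have [N2 H2] : exists N, forall m, (N <= m)%N ->
    `|square_trap f m (0 + 'i * (u / 2)) (u / 2)| <= e / 4.
  apply: goursat => // x y x01 y01.
  rewrite (_ : grid_point _ _ _ = grid_point 0 u (x / 2, 2^-1 + y / 2)).
    have [x2 _] := itv x x01; have [_ y2] := itv y y01.
    by apply: df => //; rewrite h0 ?orbT.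
  by rewrite /grid_point /= RtoCD -!r2 -rh; field.
have [N3 H3] : exists N, forall m, (N <= m)%N ->
    `|square_trap f m (0 + u / 2 + 'i * (u / 2)) (u / 2)| <= e / 4.
  apply: goursat => // x y x01 y01.
  rewrite (_ : grid_point _ _ _ = grid_point 0 u (2^-1 + x / 2, 2^-1 + y / 2)).
    have [_ x2] := itv x x01; have [_ y2] := itv y y01.
    by apply: df => //; rewrite h0.
  by rewrite /grid_point /= !RtoCD -!r2 -rh; field.
exists (maxn (maxn N0 N1) (maxn N2 N3)).+1 => -[//|m].
rewrite ltnS !geq_max => /andP[/andP[m0 m1] /andP[m2 m3]].
rewrite square_trap_split.
have -> : e + 4 * B * `|u| * 2^-1 ^+ k.+1 =
  e / 4 + 4 * B * `|u / 2| * 2^-1 ^+ k + e / 4 + e / 4 + e / 4.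
  by rewrite u2 exprS; field.
move: (H0 m m0) (H1 m m1) (H2 m m2) (H3 m m3) => *.
by rewrite !(le_trans (ler_normD _ _)) ?lerD// !(le_trans (ler_normD _ _))
    ?lerD// (le_trans (ler_normD _ _)) ?lerD.
Qed.

(** Cauchy's formula as an inequality: the sums of [(f z - f 0) / z] become small by [corner_trap],
    so [f 0] times the outline of [1 / z], of norm at least 4, is up to [e] the outline of
    [f z / z], of norm at most [8 * B]. The constant involves only the bound on the annulus, which
    lets [disc_lipschitz] treat quotients that are large near the centre. *)
Lemma cauchy_bound f B0 B : (forall z, `|z| <= 2 -> differentiable f z) ->
  (forall z, `|z| <= 2 -> `|f z| <= B0) ->
  (forall z, 1 <= `|z| <= 2 -> `|f z| <= B) -> `|f 0| <= 2 * B.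
Proof.
move=> df fB0 fB.
pose h z := (f z - f 0) / z.
have f0 : `|f 0| <= B0 by apply: fB0; rewrite normr0.
have dh z : `|z| <= 2 -> z != 0 -> differentiable h z.
  move=> z2 z0; rewrite /h.
  apply: (@differentiableM _ _ (fun z => f z - f 0) (fun z => z^-1)).
    by apply: (@differentiableB _ _ _ f (cst (f 0))) => //; exact: df.
  exact: differentiable_Rinv.
have [H hH] : exists H, forall z, `|z| <= 2 -> `|h z| <= H.
  by apply: (@bounded_quotient _ f 2 B0) => //; apply: df; rewrite normr0.
have n4 u x y : u \in [:: 1; 'i; -1; - 'i] -> 0 <= x <= 1 -> 0 <= y <= 1 ->
    `|grid_point 0 u (x, y)| <= (2 : C).
  move=> /unit4_norm u1 /andP[x0 x1] /andP[y0 y1].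
  rewrite /grid_point /= add0r normrM u1 mul1r (le_trans (ler_normD _ _))//.
  rewrite normrM normCi mul1r (_ : 2 = 1 + 1) ?lerD//.
    by have := @RtoC_norm_le _ x 0; rewrite expr0; apply; rewrite ger0_norm.
  by have := @RtoC_norm_le _ y 0; rewrite expr0; apply; rewrite ger0_norm.
have corner u e : u \in [:: 1; 'i; -1; - 'i] -> 0 < e ->
    exists N, forall m, (N <= m)%N -> `|square_trap h m 0 u| <= e.
  move=> u4 e0; have u1 := unit4_norm u4.
  apply: (@corner_trap h u H) => // [x y x01 y01 xy|z]; last first.
    by rewrite u1 mulr1; exact: hH.
  apply: dh; first exact: n4.
  rewrite /grid_point/= add0r mulf_neq0//; first by rewrite -normr_eq0 u1 oner_eq0.
  apply: contraTneq xy => xy0.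
  have xr (t : R) : RtoC t \is Num.real by rewrite complex_real.
  have x0 : RtoC x = 0 by rewrite -(Re_rect (xr x) (xr y)) xy0 raddf0.
  have y0 : RtoC y = 0 by rewrite -(Im_rect (xr x) (xr y)) xy0 raddf0.
  by case: x0 => ->; case: y0 => ->; rewrite eqxx.
have Bge0 : 0 <= B by apply: le_trans (fB 1 _); rewrite ?normr1 ?lexx//= ler1n.
apply: le_absorb => e e0.
have [N hN] : exists N, forall m, (N <= m)%N -> `|outline h m| <= e.
  have e4 : 0 < e / 4 by rewrite divr_gt0.
  have [|N0 H0] := @corner 1 _ _ e4; first by rewrite !inE eqxx ?orbT.
  have [|N1 H1] := @corner 'i _ _ e4; first by rewrite !inE eqxx ?orbT.
  have [|N2 H2] := @corner (-1) _ _ e4; first by rewrite !inE eqxx ?orbT.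
  have [|N3 H3] := @corner (- 'i) _ _ e4; first by rewrite !inE eqxx ?orbT.
  exists (maxn (maxn N0 N1) (maxn N2 N3)) => m.
  rewrite !geq_max => /andP[/andP[m0 m1] /andP[m2 m3]].
  move: (H0 m m0) (H1 m m1) (H2 m m2) (H3 m m3) => *.
  rewrite outlineE !big_cons big_nil addr0.
  have -> : e = e / 4 + (e / 4 + (e / 4 + e / 4)) by field.
  by do 3!rewrite (le_trans (ler_normD _ _))// lerD//.
pose g z := f z / z.
have : f 0 * outline (fun z => z^-1) N = outline g N - outline h N.
  have -> : h = fun z => g z + (- f 0) * z^-1.
    by apply/funext => z; rewrite /h /g mulrDl.
  rewrite /outline !big_cons !big_nil !trap_lin; ring.
move=> /(congr1 Num.norm); rewrite normrM => fh.
have : `|f 0| * 4 <= 8 * B + e.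
  apply: le_trans (_ : `|f 0| * `|outline (fun z => z^-1) N| <= _).
    by rewrite ler_wpM2l// outline_inv_ge.
  rewrite fh (le_trans (ler_normB _ _))// lerD//; last exact: hN.
  apply: le_outline => z z12; rewrite /g normf_div.
  have z0 : 0 < `|z| by case/andP: z12 => [/(lt_le_trans ltr01)].
  rewrite ler_pdivrMr// (le_trans (fB _ z12))// ler_peMr//.
  by case/andP: z12.
rewrite -ler_pdivlMr// => /le_trans; apply.
rewrite mulrDl addrC lerD//.
  by rewrite ler_pdivrMr// ler_peMr ?ler1n// ltW.
by rewrite (_ : 8 * B / 4 = 2 * B)//; field.
Qed.

End CauchyBound.

Section Lipschitz.
Variable R : realType.
Local Notation C := (Cx R).
Implicit Types (f : C -> C).

(** Takes roots of unbounded order: if [x > y], Bernoulli's inequality makes the powers of [x / y]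
    exceed [d / c]. *)
Lemma le_of_pow_succ_le (x y c d : C) : 0 <= x -> 0 <= y -> 0 < c -> 0 <= d ->
  (forall m, x ^+ m.+1 * c <= d * y ^+ m.+1) -> x <= y.
Proof.
move=> x0 y0 c0 d0 h; apply: contraT; rewrite -real_ltNge ?ger0_real// => yx.
move: y0; rewrite le_eqVlt => /predU1P[y0|y0].
  move: (h 0%N) yx; rewrite -y0 !expr1 mulr0 => xc0 x_gt0.
  by have := lt_le_trans (mulr_gt0 x_gt0 c0) xc0; rewrite ltxx.
have q0 : 0 < x / y - 1 by rewrite subr_gt0 ltr_pdivlMr// mul1r.
have [n hn] := Cx_natr_bound (divr_ge0 d0 (ltW c0)).
have [k hk] := Cx_natr_bound (divr_ge0 (ler0n _ n) (ltW q0)).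
have bern m : 1 + m%:R * (x / y - 1) <= (x / y) ^+ m.
  elim: m => [|m ih]; first by rewrite mul0r addr0 expr0.
  have -> : (x / y) ^+ m.+1 = (x / y) ^+ m + (x / y - 1) * (x / y) ^+ m.
    by rewrite exprS; ring.
  rewrite -natr1 mulrDl mul1r addrA lerD// ler_peMr ?(ltW q0)// exprn_ege1//.
  by rewrite ler_pdivlMr// mul1r ltW.
have : (x / y) ^+ k.+1 <= n%:R.
  apply: le_trans hn; rewrite ler_pdivlMr// expr_div_n mulrAC.
  by rewrite ler_pdivrMr ?exprn_gt0.
move=> /(le_trans (bern k.+1)).
move: hk; rewrite ler_pdivrMr// -natr1 mulrDl mul1r => nk /le_trans/(_ nk).
by rewrite addrCA gerDl lt_geF// addr_gt0.
Qed.

Lemma differentiable_exp (K : numFieldType) (V : normedModType K) (f : V -> K)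
    (m : nat) (z : V) :
  differentiable f z -> differentiable (fun t => f t ^+ m) z.
Proof.
move=> df; elim: m => [|m ih].
  rewrite (_ : (fun _ => _) = cst 1); first exact: differentiable_cst.
  by apply/funext => t; rewrite expr0.
rewrite (_ : (fun _ => _) = (fun t => f t * f t ^+ m)).
  exact: (@differentiableM _ _ f (fun t => f t ^+ m)).
by apply/funext => t; rewrite exprS.
Qed.

(** At [0] the quotient has the default value [0] of a division by zero instead of the derivative.
    The extra factor [t] hides this: the product vanishes at [0] and has derivative
    [('D_1 f 0) ^+ m.+1] there. *)
Lemma differentiable_pow_quotient (K : numFieldType) (f : K -> K) (m : nat) (z : K) :
  differentiable f 0 -> differentiable f z ->
  differentiable (fun t => ((f t - f 0) / t) ^+ m.+1 * t) z.
Proof.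
move=> df0 dfz; have [->|z0] := eqVneq z 0; last first.
  apply: (@differentiableM _ _ (fun t => ((f t - f 0) / t) ^+ m.+1) id) => //.
  apply: (@differentiable_exp _ _ (fun t => ((f t - f 0) / t))).
  apply: (@differentiableM _ _ (fun t => f t - f 0) (fun t => t^-1)).
    by apply: (@differentiableB _ _ _ f (cst (f 0))).
  exact: differentiable_Rinv.
apply/derivable1_diffP; move/derivable1_diffP : df0 => df0.
apply/cvg_ex; exists (('D_1 f 0) ^+ m.+1).
have : (fun h : K => (h^-1 *: (f (h *: 1 + 0) - f 0)) ^+ m.+1) @ 0^' --> ('D_1 f 0) ^+ m.+1.
  apply: (@cvg_comp _ _ _ (fun h : K => h^-1 *: (f (h *: 1 + 0) - f 0)) (fun x => x ^+ m.+1)) df0 _.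
  exact: (differentiable_continuous (@differentiable_exp _ _ id m.+1 _ _)).
apply: cvg_trans; apply: near_eq_cvg.
near=> h.
have h0 : h != 0 by near: h; exact: nbhs_dnbhs_neq.
rewrite /= !mulr0 subr0 addr0 [h *: 1]mulr1 /GRing.scale/=.
by rewrite [RHS]mulrCA mulVf// mulr1 mulrC.
Unshelve. all: by end_near. Qed.

(* [cauchy_bound] is applied to the powers of the difference quotient of [f]: the
   constants in front disappear on taking roots. *)
Lemma disc_lipschitz f B w : (forall z, `|z| <= 3 -> differentiable f z) ->
  (forall z, `|z| <= 3 -> `|f z| <= B) -> `|w| <= 2^-1 ->
  `|f w - f 0| <= 4 * B * `|w|.
Proof.
move=> df fB w2.
have [->|w0] := eqVneq w 0; first by rewrite subrr normr0 mulr0.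
have df0 : differentiable f 0 by apply: df; rewrite normr0.
have B0 : 0 <= B by apply: le_trans (fB 0 _); rewrite ?normr0.
have [H hH] := bounded_quotient df0 (ler0n _ 3) fB.
have w3 z : `|z| <= 2 -> `|z + w| <= 3.
  have -> : 3 = 2 + 1 :> C by ring.
  move=> z2; rewrite (le_trans (ler_normD _ _))// lerD//.
  by rewrite (le_trans w2)// invf_le1 ?ltr0n// ler1n.
rewrite -ler_pdivrMr ?normr_gt0// -normf_div.
apply: (@le_of_pow_succ_le _ _ `|w| (2 * 3)) => //; rewrite ?normr_gt0 ?mulr_ge0//.
move=> m.
(* The shift moves [w] to the centre, where [|g 0|] is the power to be bounded. On the annulus
   [|z + w| >= 1 / 2], so the quotient is at most [2 * B / (1 / 2) = 4 * B], and the extra factor at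
   most 3. *)
pose g z := ((f (z + w) - f 0) / (z + w)) ^+ m.+1 * (z + w).
have := @cauchy_bound R g (H ^+ m.+1 * 3) ((4 * B) ^+ m.+1 * 3).
have -> : 2 * 3 * (4 * B) ^+ m.+1 = 2 * ((4 * B) ^+ m.+1 * 3) by ring.
have -> : `|(f w - f 0) / w| ^+ m.+1 * `|w| = `|g 0|.
  by rewrite /g add0r [RHS]normrM normrX.
apply.
- move=> z /w3 zw3.
  apply: (@differentiable_comp _ _ _ _ (fun z => z + w)
    (fun t => ((f t - f 0) / t) ^+ m.+1 * t)).
    by apply: (@differentiableD _ _ _ id (cst w)); exact: differentiable_cst || exact: ex_diff.
  exact: (differentiable_pow_quotient m df0 (df _ zw3)).
- move=> z /w3 zw3; rewrite /g normrM normrX ler_pM// ?exprn_ge0//.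
  by rewrite lerXn2r ?nnegrE// ?hH// (le_trans _ (hH _ zw3)).
- move=> z /andP[z1 /w3 zw3]; rewrite /g normrM normrX ler_pM// ?exprn_ge0//.
  rewrite lerXn2r ?nnegrE ?mulr_ge0//.
  have zw : 2^-1 <= `|z + w|.
    have := ler_normB (z + w) w; rewrite addrK => h.
    have : 1 <= `|z + w| + 2^-1.
      by rewrite (le_trans z1)// (le_trans h)// lerD2l.
    by rewrite -lerBlDr; apply: le_trans; rewrite [X in X - _]splitr div1r addrK.
  rewrite normf_div ler_pdivrMr ?(lt_le_trans _ zw) ?invr_gt0//.
  rewrite (le_trans (ler_normB _ _))//.
  apply: le_trans (_ : 4 * B * 2^-1 <= _); last by rewrite ler_wpM2l// mulr_ge0.
  rewrite (_ : 4 * B * 2^-1 = B + B); last by field.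
  by rewrite lerD ?fB ?normr0.
Qed.

End Lipschitz.

(** * Holomorphic functions on normed modules *)

Lemma differentiable_line (K : numFieldType) (V : normedModType K) (z v : V) (t : K) :
  differentiable (fun t : K => z + t *: v) t.
Proof.
have d1 : differentiable (cst z : K -> V) t by exact: differentiable_cst.
have d2 : differentiable (fun s : K => s *: v) t by exact: differentiableZl.
exact: (differentiableD d1 d2).
Qed.

Lemma diff_homog (K : numFieldType) (V : normedModType K) (f : V -> K) p k u :
  'd f p (k *: u) = k * 'd f p u.
Proof. exact: linearZ. Qed.

Section Normed.
Variables (R : realType) (V : normedModType (Cx R)).
Local Notation C := (Cx R).
Implicit Types (f g : V -> C) (p z u v : V).

(** Reduction to the complex line through [z] along [u]: with [v] of norm [rho / 6] the disc of
    radius 3 stays within [rho / 2] of [z], and [u = w *: v] with [w = 6 * |u| / rho], whence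
    [24 = 4 * 6]. *)
Lemma ball_lipschitz f p rho B z u : 0 < rho ->
  (forall z, `|z - p| < rho -> differentiable f z) ->
  (forall z, `|z - p| < rho -> `|f z| <= B) ->
  `|z - p| < rho / 2 -> `|u| <= rho / 12 ->
  `|f (z + u) - f z| <= 24 * B / rho * `|u|.
Proof.
move=> r0 df fB zp ur.
have [->|u0] := eqVneq u 0; first by rewrite addr0 subrr !normr0 mulr0.
have nu : 0 < `|u| by rewrite normr_gt0.
pose v := (rho / 6 / `|u|) *: u.
have nv : `|v| = rho / 6.
  by rewrite normrZ ger0_norm ?divr_ge0 ?(ltW r0)// divfK// gt_eqF.
pose w := 6 * `|u| / rho.
have wv : w *: v = u.
  rewrite /v scalerA (_ : _ * _ = 1) ?scale1r// /w; field.
  by rewrite !gt_eqF.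
have w0 : 0 <= w by rewrite divr_ge0 ?mulr_ge0// ltW.
have w2 : `|w| <= 2^-1.
  rewrite ger0_norm// ler_pdivrMr// (_ : 2^-1 * rho = 6 * (rho / 12)); last by field.
  by rewrite ler_pM2l.
have near3 t : `|t| <= 3 -> `|z + t *: v - p| < rho.
  move=> t3; rewrite addrAC (le_lt_trans (ler_normD _ _))//.
  rewrite [ltRHS]splitr ltr_leD// normrZ nv (_ : rho / 2 = 3 * (rho / 6)); last by field.
  by rewrite ler_wpM2r// divr_ge0 ?(ltW r0).
have := @disc_lipschitz R (fun t => f (z + t *: v)) B w _ _ w2.
rewrite wv scale0r addr0.
have -> : 24 * B / rho * `|u| = 4 * B * `|w|.
  by rewrite (ger0_norm w0) /w; field; rewrite gt_eqF.
apply=> t /near3 tz; last exact: fB.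
exact: differentiable_comp (differentiable_line z v t) (df _ tz).
Qed.

Lemma differentiable_shift f z u : differentiable f (z + u) ->
  differentiable (fun z => f (z + u)) z.
Proof.
move=> df; apply: (@differentiable_comp _ _ _ _ (fun z => z + u) f) => //.
Qed.

(** [ball_lipschitz] twice: it bounds [f (z + u) - f z] on the half ball, then the increment of this
    function along [v]. *)
Lemma second_difference f p rho B u v : 0 < rho ->
  (forall z, `|z - p| < rho -> differentiable f z) ->
  (forall z, `|z - p| < rho -> `|f z| <= B) ->
  `|u| <= rho / 24 -> `|v| <= rho / 24 ->
  `|f (p + v + u) - f (p + v) - (f (p + u) - f p)| <=
    2 * 24 ^+ 2 * B / rho ^+ 2 * `|u| * `|v|.
Proof.
move=> r0 df fB ur vr.
have r2 : 0 < rho / 2 by rewrite divr_gt0.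
have ur' : `|u| <= rho / 12.
  rewrite (le_trans ur)// ler_pdivrMr// -mulrA ler_peMr ?(ltW r0)//.
  by rewrite mulrC ler_pdivlMr// mul1r ler_nat.
pose g z := f (z + u) - f z.
have := @ball_lipschitz g p (rho / 2) (24 * B / rho * `|u|) p v r2.
rewrite /g subrr normr0 => H.
have -> : 2 * 24 ^+ 2 * B / rho ^+ 2 * `|u| * `|v| =
    24 * (24 * B / rho * `|u|) / (rho / 2) * `|v|.
  by field; rewrite gt_eqF.
apply: H => [z zp|z zp||].
- have zr : `|z - p| < rho.
    by rewrite (lt_le_trans zp)// ler_pdivrMr// ler_peMr ?(ltW r0)// ler1n.
  apply: (@differentiableB _ _ _ (fun z => f (z + u)) f); last exact: df.
  apply/differentiable_shift/df; rewrite addrAC (le_lt_trans (ler_normD _ _))//.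
  rewrite [ltRHS]splitr ltr_leD// (le_trans ur')// ler_pM2l// lef_pV2 ?posrE//.
  by rewrite ler_nat.
- exact: (@ball_lipschitz f p rho B z u).
- by rewrite divr_gt0.
- by rewrite (le_trans vr)// -mulrA ler_pM2l// -invfM -natrM.
Qed.

(** The defect [phi w - 2 * phi (2^-1 *: w)] of the increment [phi] is a second difference, hence
    quadratic in [w]. Summed over repeated halvings it compares [phi u] with
    [2 ^+ k * phi (2^-1 ^+ k *: u)], which tends to the differential. *)
Lemma taylor1 f p rho B u : 0 < rho ->
  (forall z, `|z - p| < rho -> differentiable f z) ->
  (forall z, `|z - p| < rho -> `|f z| <= B) ->
  `|u| <= rho / 24 ->
  `|f (p + u) - f p - 'd f p u| <= 24 ^+ 2 * B / rho ^+ 2 * `|u| ^+ 2.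
Proof.
move=> r0 df fB ur.
have B0 : 0 <= B by apply: le_trans (fB p _); rewrite ?subrr ?normr0.
set K := 24 ^+ 2 * B / rho ^+ 2.
have K0 : 0 <= K by rewrite divr_ge0 ?mulr_ge0 ?exprn_ge0 ?ler0n ?(ltW r0).
pose phi u := f (p + u) - f p.
have dbl w : `|w| <= rho / 24 ->
    `|phi w - 2 * phi (2^-1 *: w)| <= K / 2 * `|w| ^+ 2.
  move=> wr; have wr' : `|2^-1 *: w| <= rho / 24.
    rewrite normrZ ger0_norm ?invr_ge0// (le_trans _ wr)// ler_piMl//.
    by rewrite invf_le1// ler1n.
  have := second_difference r0 df fB wr' wr'.
  rewrite normrZ (ger0_norm (_ : 0 <= 2^-1)) ?invr_ge0//.
  have -> : p + 2^-1 *: w + 2^-1 *: w = p + w.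
    by rewrite -addrA -scalerDl (_ : 2^-1 + 2^-1 = 1) ?scale1r//; field.
  rewrite (_ : 2 * 24 ^+ 2 * B / rho ^+ 2 * _ * _ = K / 2 * `|w| ^+ 2); last first.
    by rewrite /K; field; rewrite gt_eqF.
  by congr (`|_| <= _); rewrite /phi; ring.
have iter k w : `|w| <= rho / 24 ->
    `|phi w - 2 ^+ k * phi (2^-1 ^+ k *: w)| <= K * `|w| ^+ 2.
  elim: k w => [|k ih] w wr.
    by rewrite !expr0 scale1r mul1r subrr normr0 mulr_ge0// exprn_ge0.
  have wr' : `|2^-1 *: w| <= rho / 24.
    rewrite normrZ ger0_norm ?invr_ge0// (le_trans _ wr)// ler_piMl//.
    by rewrite invf_le1// ler1n.
  have -> : phi w - 2 ^+ k.+1 * phi (2^-1 ^+ k.+1 *: w) =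
    (phi w - 2 * phi (2^-1 *: w)) +
    2 * (phi (2^-1 *: w) - 2 ^+ k * phi (2^-1 ^+ k *: (2^-1 *: w))).
    by rewrite scalerA -exprSr exprS; ring.
  rewrite (le_trans (ler_normD _ _))//.
  have -> : K * `|w| ^+ 2 = K / 2 * `|w| ^+ 2 + 2 * (K * `|2^-1 *: w| ^+ 2).
    by rewrite normrZ (ger0_norm (_ : 0 <= 2^-1)) ?invr_ge0//; field.
  rewrite lerD// ?dbl// normrM [`|2|]ger0_norm// ler_pM2l//.
  exact: ih.
apply: le_absorb => e e0.
have dfp : differentiable f p by apply: df; rewrite subrr normr0.
pose e' := e / (`|u| + 1).
have u1 : 0 < `|u| + 1 by rewrite ltr_wpDl.
have e'0 : 0 < e' by rewrite divr_gt0.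
have /nbhs_ballP[d /= d0 hd] := differentiable_near_linear dfp e'0.
have d20 : 0 < d / 2 by rewrite divr_gt0.
have [k /(_ k (leqnn k)) hk] := Cx_half_small (normr_ge0 u) d20.
have h0 : 0 <= 2^-1 ^+ k :> C by rewrite exprn_ge0// invr_ge0.
have h2 : 2 ^+ k * 2^-1 ^+ k = 1 :> C by rewrite -exprMn divff ?expr1n// pnatr_eq0.
have -> : f (p + u) - f p - 'd f p u = (phi u - 2 ^+ k * phi (2^-1 ^+ k *: u)) +
    2 ^+ k * (phi (2^-1 ^+ k *: u) - 'd f p (2^-1 ^+ k *: u)).
  rewrite diff_homog [RHS](_ : _ = phi u - (2 ^+ k * 2^-1 ^+ k) * 'd f p u).
    by rewrite h2 mul1r.
  by ring.
rewrite (le_trans (ler_normD _ _))// addrC lerD//; last exact: iter.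
rewrite normrM ger0_norm ?exprn_ge0//.
have := hd (p + 2^-1 ^+ k *: u).
have nk : `|2^-1 ^+ k *: u| = 2^-1 ^+ k * `|u| by rewrite normrZ ger0_norm.
rewrite -ball_normE /= [p + _ - p]addrC addKr opprD addNKr normrN nk => h.
apply: le_trans (_ : 2 ^+ k * (e' * (2^-1 ^+ k * `|u|)) <= _).
  rewrite ler_wpM2l ?exprn_ge0//; apply: h.
  by rewrite mulrC (le_lt_trans hk)// ltr_pdivrMr// ltr_pMr// ltr1n.
rewrite (_ : 2 ^+ k * _ = 2 ^+ k * 2^-1 ^+ k * (e' * `|u|)); last by ring.
rewrite h2 mul1r /e' mulrAC ler_pdivrMr// ler_wpM2l ?(ltW e0)//.
by rewrite lerDl.
Qed.

End Normed.

Section Complete.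
Variable R : realType.
Local Notation C := (Cx R).

Lemma Cx_rect (z : C) : z = RtoC (complex.Re z) + 'i * RtoC (complex.Im z).
Proof. by rewrite {1}[z]Crect -complexRe -complexIm. Qed.

Lemma Cx_norm_Re (z : C) : RtoC `|complex.Re z| <= `|z|.
Proof. exact: normc_ge_Re. Qed.

Lemma Cx_norm_Im (z : C) : RtoC `|complex.Im z| <= `|z|.
Proof.
have := @Cx_norm_Re ('i * z); rewrite normrM normCi mul1r; apply: le_trans.
by rewrite -complexiE; case: z => a b; rewrite /= mul0r mul1r sub0r normrN.
Qed.

Lemma Cx_cauchy_cvg (x : nat -> C) :
  (forall e, 0 < e -> exists N, forall m k, (N <= m)%N -> (N <= k)%N ->
     `|x m - x k| <= e) ->
  exists l : C, x m @[m --> \oo] --> l.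
Proof.
move=> xc.
have cR (g : C -> R) : (forall a b, RtoC `|g a - g b| <= `|a - b|) ->
    exists l : R, g (x m) @[m --> \oo] --> l.
  move=> gL; apply/cvg_ex; apply: cauchy_cvg; apply/cauchy_ballP => e e0.
  have e20 : 0 < RtoC (e / 2) by rewrite /RtoC ltcR divr_gt0.
  have [N hN] := xc _ e20.
  rewrite near_map2; near=> m k; rewrite /ball/= /ball_.
  apply: le_lt_trans (_ : e / 2 < e); last by rewrite ltr_pdivrMr// ltr_pMr// ltr1n.
  rewrite -lecR; apply: (le_trans (gL _ _)); apply: hN; [near: m|near: k];

    exact: nbhs_infty_ge.
have [a ha] : exists l : R, complex.Re (x m) @[m --> \oo] --> l.
  by apply: cR => a b; rewrite -raddfB; exact: Cx_norm_Re.
have [b hb] : exists l : R, complex.Im (x m) @[m --> \oo] --> l.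
  by apply: cR => u v; rewrite -raddfB; exact: Cx_norm_Im.
exists (RtoC a + 'i * RtoC b); apply/cvgrPdist_le => e e0.
have e2 : 0 < complex.Re (e / 2).
  have := divr_gt0 e0 (ltr0n _ 2); rewrite [X in 0 < X]Cx_ge0E.
    by rewrite (ltcR 0 _).
  by rewrite divr_ge0// ltW.
move/cvgrPdist_le : ha => /(_ _ e2) ha; move/cvgrPdist_le : hb => /(_ _ e2) hb.
near=> m.
have -> : RtoC a + 'i * RtoC b - x m =
   RtoC (a - complex.Re (x m)) + 'i * RtoC (b - complex.Im (x m)).
  by rewrite !RtoCB {1}(Cx_rect (x m)); ring.
rewrite (le_trans (ler_normD _ _))// normrM normCi mul1r [leRHS]splitr.
have nR (r : R) : `|RtoC r| = RtoC `|r|.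
  by rewrite /RtoC normc_def/= expr0n/= addr0 sqrtr_sqr.
rewrite !nR [e / 2]Cx_ge0E ?divr_ge0 ?(ltW e0)//.
by rewrite lerD// /RtoC lecR; near: m.
Unshelve. all: by end_near. Qed.

End Complete.

Section QuadraticError.
Variables (R : realType) (V : normedModType (Cx R)).
Local Notation C := (Cx R).
Implicit Types (f g : V -> C) (p z u v : V).

Lemma differentiable_quadratic g p (l : V -> C) d K M : linear l -> 0 < d -> 0 <= M -> 0 <= K ->
  (forall u, `|l u| <= M * `|u|) ->
  (forall u, `|u| <= d -> `|g (p + u) - g p - l u| <= K * `|u| ^+ 2) ->
  differentiable g p /\ forall u, 'd g p u = l u.
Proof.
move=> lin d0 M0 K0 lM gK.
pose mL := GRing.isLinear.Build C V C *%R l lin.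
pose L : {linear V -> C^o} := HB.pack l mL.
have Lc : continuous L.
  apply/bounded_linear_continuous/bounded_funP => r; exists (M * r) => x xr.
  by rewrite (le_trans (lM x))// ler_wpM2l.
have gL : g \o shift p = cst (g p) + L +o_ 0 id.
  apply/eqaddoP => e e0.
  have K1 : 0 < K + 1 by rewrite ltr_wpDl.
  near=> h; rewrite !fctE /=.
  have hd : `|h| <= d by near: h; exact: nbhs0_le.
  rewrite [h + p]addrC opprD addrA (le_trans (gK _ hd))//.
  have : K * `|h| <= e.
    apply: le_trans (_ : (K + 1) * `|h| <= e).
      by rewrite ler_wpM2r// lerDl.
    rewrite mulrC -ler_pdivlMr//; near: h.
    exact: nbhs0_le (divr_gt0 e0 K1).
  by move=> Kh; rewrite expr2 mulrA ler_wpM2r.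
have dL := diff_unique Lc gL.
split; last by move=> u; rewrite dL.
by apply/diff_locallyP; rewrite dL.
Unshelve. all: by end_near. Qed.

End QuadraticError.

(** Compares two differentials [d1], [d2] through increments of size [t]: [a1], [a2] approximate the
    limit [a] at the displaced point, and [b1], [b2] the limit [b] at the base point. *)
Lemma increment_dist (C : numFieldType) (t a1 a2 a b1 b2 b d1 d2 e : C) :
  `|a - a1| <= t * (e / 8) -> `|a - a2| <= t * (e / 8) ->
  `|b - b1| <= t * (e / 8) -> `|b - b2| <= t * (e / 8) ->
  `|a1 - b1 - t * d1| <= t * (e / 4) -> `|a2 - b2 - t * d2| <= t * (e / 4) ->
  `|t * (d1 - d2)| <= t * e.
Proof.
move=> h1 h2 h3 h4 h5 h6.
  have -> : t * (d1 - d2) = (a2 - b2 - t * d2) - (a1 - b1 - t * d1) +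
     ((a - a2) - (a - a1)) + ((b - b1) - (b - b2)) by ring.
  have -> : t * e = (t * (e / 4) + t * (e / 4)) + (t * (e / 8) + t * (e / 8))
    + (t * (e / 8) + t * (e / 8)) by field.
  rewrite (le_trans (ler_normD _ _))// lerD//; last first.
    by rewrite (le_trans (ler_normB _ _))// lerD.
  rewrite (le_trans (ler_normD _ _))// lerD//;
    by rewrite (le_trans (ler_normB _ _))// lerD.
Qed.

(** * Limits of holomorphic functions *)

Section Limits.
Variables (R : realType) (V : normedModType (Cx R)).
Local Notation C := (Cx R).
Implicit Types (f g : V -> C) (p z u v : V).

Lemma cvg_norm_le (x : nat -> C) l b : x m @[m --> \oo] --> l ->
  (forall m, `|x m| <= b) -> `|l| <= b.
Proof.
move=> xl xb; apply: le_absorb => e e0.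
move/cvgrPdist_le : xl => /(_ e e0)[N _ /(_ N (leqnn N))] /= h.
rewrite -[l](subrK (x N)) (le_trans (ler_normD _ _))// lerD//.
Qed.

Lemma diff_bound f p rho B u : 0 < rho ->
  (forall z, `|z - p| < rho -> differentiable f z) ->
  (forall z, `|z - p| < rho -> `|f z| <= B) ->
  `|'d f p u| <= 3 * 24 * B / rho * `|u|.
Proof.
move=> r0 df fB.
have [->|u0] := eqVneq u 0; first by rewrite linear0 !normr0 mulr0.
have nu : 0 < `|u| by rewrite normr_gt0.
pose s := rho / 24 / `|u|.
have s0 : 0 < s by rewrite !divr_gt0.
have nsu : `|s *: u| = rho / 24 by rewrite normrZ gtr0_norm// divfK// gt_eqF.
have := @taylor1 R V f p rho B (s *: u) r0 df fB; rewrite nsu lexx => /(_ isT).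
rewrite diff_homog => h.
have pr : `|p + s *: u - p| < rho.
  by rewrite addrAC subrr add0r nsu ltr_pdivrMr// ltr_pMr// ltr1n.
have : `|s * 'd f p u| <= 3 * B.
  have -> : s * 'd f p u = f (p + s *: u) - f p -
    (f (p + s *: u) - f p - s * 'd f p u) by ring.
  rewrite (_ : 3 * B = (B + B) + B); last by ring.
  rewrite (le_trans (ler_normB _ _))// lerD//.
    rewrite (le_trans (ler_normB _ _))// lerD ?fB//.
    by rewrite subrr normr0.
  rewrite (le_trans h)// le_eqVlt; apply/orP; left; apply/eqP; field.
  by rewrite gt_eqF.
rewrite normrM gtr0_norm// mulrC -ler_pdivlMr// => /le_trans; apply.
rewrite le_eqVlt; apply/orP; left; apply/eqP; rewrite /s; field.
by rewrite !gt_eqF.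
Qed.

(** Pointwise convergence suffices because the constant of [taylor1] is common to all [f m]: it
    makes the differentials at [p] a Cauchy sequence, and in the limit it is a quadratic estimate
    for [g] with the limit of the differentials. *)
Lemma limit_holomorphic (f : nat -> V -> C) g p rho B : 0 < rho ->
  (forall m z, `|z - p| < rho -> differentiable (f m) z) ->
  (forall m z, `|z - p| < rho -> `|f m z| <= B) ->
  (forall z, `|z - p| < rho -> f m z @[m --> \oo] --> g z) ->
  differentiable g p /\
  forall u, 'd (f m) p u @[m --> \oo] --> 'd g p u.
Proof.
move=> r0 df fB fg.
set K := 24 ^+ 2 * B / rho ^+ 2.
have B0 : 0 <= B by apply: le_trans (fB 0%N p _); rewrite ?subrr ?normr0.
have K0 : 0 <= K by rewrite divr_ge0 ?mulr_ge0 ?exprn_ge0 ?ler0n ?(ltW r0).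
have r24 : 0 < rho / 24 by rewrite divr_gt0.
have pin u : `|u| <= rho / 24 -> `|p + u - p| < rho.
  move=> ur; rewrite addrAC subrr add0r (le_lt_trans ur)//.
  by rewrite ltr_pdivrMr// ltr_pMr// ltr1n.
have T m u : `|u| <= rho / 24 ->
    `|f m (p + u) - f m p - 'd (f m) p u| <= K * `|u| ^+ 2.
  exact: (taylor1 r0 (df m) (fB m)).
have cauchy u : exists l : C, 'd (f m) p u @[m --> \oo] --> l.
  apply: Cx_cauchy_cvg => e e0.
  have e4 : 0 < e / 4 by rewrite divr_gt0.
  have [k1 hk1] := Cx_half_small (normr_ge0 u) r24.
  have [|k2 hk2] := @Cx_half_small _ (K * `|u| ^+ 2) (e / 4) _ e4.
    by rewrite mulr_ge0// exprn_ge0.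
  set k := maxn k1 k2.
  set t : C := 2^-1 ^+ k.
  have t0 : 0 < t by rewrite exprn_gt0// invr_gt0.
  have tu1 : `|t *: u| <= rho / 24.
    by rewrite normrZ gtr0_norm// mulrC hk1// leq_maxl.
  have tu2 m : `|f m (p + t *: u) - f m p - t * 'd (f m) p u| <= t * (e / 4).
    rewrite -diff_homog (le_trans (T m _ tu1))// normrZ gtr0_norm// exprMn expr2.
    rewrite (_ : K * _ = t * (K * `|u| ^+ 2 * t)); last by ring.
    by rewrite ler_pM2l// hk2// leq_maxr.
  have te : 0 < t * (e / 8) by rewrite mulr_gt0// divr_gt0.
  have /cvgrPdist_le/(_ _ te)[N1 _ hN1] := fg _ (pin _ tu1).
  have pp : `|p - p| < rho by rewrite subrr normr0.
  have /cvgrPdist_le/(_ _ te)[N2 _ hN2] := fg _ pp.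
  exists (maxn N1 N2) => m j; rewrite !geq_max => /andP[m1 m2] /andP[j1 j2].
  rewrite -(ler_pM2l t0) -{1}(gtr0_norm t0) -normrM.
  exact: (increment_dist (hN1 _ m1) (hN1 _ j1) (hN2 _ m2) (hN2 _ j2) (tu2 m) (tu2 j)).
have [l hl] := boolp.choice cauchy.
have lin : linear l.
  move=> a u v; apply: (@cvg_unique _ (@norm_hausdorff _ C) ('d (f m) p (a *: u + v) @[m --> \oo])).
    exact: hl.
  rewrite (_ : (fun m => _) = fun m => a * 'd (f m) p u + 'd (f m) p v).
    by apply: cvgD; [apply: cvgM; [exact: cvg_cst|exact: hl]|exact: hl].
  by apply/funext => m; rewrite linearD diff_homog.
have lM u : `|l u| <= 3 * 24 * B / rho * `|u|.
  by apply: cvg_norm_le (hl u) _ => m; exact: (diff_bound _ r0 (df m) (fB m)).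
have M0 : 0 <= 3 * 24 * B / rho by rewrite divr_ge0 ?mulr_ge0// ltW.
have [|dg dgl] := @differentiable_quadratic R V g p l _ _ _ lin r24 M0 K0 lM.
  move=> u ur; apply: (@cvg_norm_le (fun m => f m (p + u) - f m p - 'd (f m) p u)).
    apply: cvgB; [apply: cvgB|exact: hl]; apply: fg; first exact: pin.
    by rewrite subrr normr0.
  by move=> m; exact: T.
split; first exact: dg.
by move=> u; have := hl u; rewrite -(dgl u).
Qed.

Lemma holomorphic_ball f p : (\forall z \near p, differentiable f z) ->
  exists rho B, [/\ 0 < rho, forall z, `|z - p| < rho -> differentiable f z &
    forall z, `|z - p| < rho -> `|f z| <= B].
Proof.
move=> fh.
have fp : \forall z \near p, `|f p - f z| <= 1.
  have /differentiable_continuous/cvgrPdist_le := nbhs_singleton fh; exact.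
have fq : \forall z \near p, differentiable f z /\ `|f p - f z| <= 1.
  by apply: filterS2 fh fp => z h1 h2; split.
have /nbhs_ballP[rho /= r0 hr] := fq.
have fr z : `|z - p| < rho -> differentiable f z /\ `|f p - f z| <= 1.
  by move=> zr; have := hr z; rewrite -ball_normE /= distrC => /(_ zr)[].
exists rho, (`|f p| + 1); split; [exact: r0|by move=> z /fr[]|move=> z /fr[_ h]].
by rewrite -[f z](subKr (f p)) (le_trans (ler_normB _ _))// lerD2l.
Qed.

Definition delta_quotient f e (t : C) z := t^-1 * (f (z + t *: e) - f z).

Lemma differentiable_delta_quotient f e t z : differentiable f z ->
  differentiable f (z + t *: e) -> differentiable (delta_quotient f e t) z /\
  forall u, 'd (delta_quotient f e t) z u =
    t^-1 * ('d f (z + t *: e) u - 'd f z u).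
Proof.
move=> df1 df2.
pose sh (z : V) := z + t *: e.
have dsh : is_diff z sh (id : V -> V).
  by have := is_diffD (is_diff_id z) (is_diff_cst (t *: e) z); rewrite addr0.
have [dF eF] := is_diffZ t^-1 (is_diffB
  (is_diff_comp dsh (differentiableP df2)) (differentiableP df1)).
by split; [exact: dF|move=> u; exact: (congr1 (fun F => F u) eF)].
Qed.

Lemma delta_quotient_cvg f e z (t : nat -> C) : differentiable f z ->
  (forall m, t m != 0) -> t m @[m --> \oo] --> 0 ->
  delta_quotient f e (t m) z @[m --> \oo] --> 'd f z e.
Proof.
move=> df t0 tc; apply/cvgrPdist_le => ep ep0.
have u1 : 0 < `|e| + 1 by rewrite ltr_wpDl.
have e'0 : 0 < ep / (`|e| + 1) by rewrite divr_gt0.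
have H := differentiable_near_linear df e'0.
have zc : z + t m *: e @[m --> \oo] --> z.
  rewrite -[X in _ --> X]addr0 -[X in _ --> _ + X](scale0r e).
  by apply: cvgD; [exact: cvg_cst|apply: cvgZr_tmp].
have : \forall m \near \oo, `|f (z + t m *: e) - f z - 'd f z (z + t m *: e - z)|
   <= ep / (`|e| + 1) * `|z + t m *: e - z| by exact: zc H.
apply: filterS => m.
rewrite (_ : z + t m *: e - z = t m *: e); last by rewrite addrC addKr.
rewrite diff_homog normrZ => h.
have tm0 : 0 < `|t m| by rewrite normr_gt0.
rewrite distrC -(ler_pM2l tm0) -normrM.
have -> : t m * (delta_quotient f e (t m) z - 'd f z e) =
  f (z + t m *: e) - f z - t m * 'd f z e.
  by rewrite mulrBr /delta_quotient mulrA mulfV// mul1r.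
rewrite (le_trans h)// mulrCA ler_wpM2l// mulrAC ler_pdivrMr//.
by rewrite ler_pM2l// lerDl.
Qed.

End Limits.

Section Derivatives.
Variables (R : realType) (V : normedModType (Cx R)).
Local Notation C := (Cx R).
Implicit Types (f g : V -> C) (p z u v e : V).

Lemma half_cvg0 k0 : (2^-1 : C) ^+ (m + k0) @[m --> \oo] --> 0.
Proof.
apply/cvgrPdist_le => e e0.
have [K hK] := Cx_half_small (ler01 : 0 <= (1 : C)) e0.
exists K => // m /= Km; have := hK (m + k0)%N (leq_trans Km (leq_addr _ _)).
by rewrite sub0r normrN mul1r ger0_norm// exprn_ge0// invr_ge0.
Qed.

Definition holomorphic_at (W : normedModType C) (f : V -> W) p :=
  \forall z \near p, differentiable f z.

(** The difference quotients in direction [e] are uniformly bounded by [ball_lipschitz], so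
    [limit_holomorphic] applies to them. The offset [k0] keeps all steps inside the ball; the
    convergence of the differentials is recorded for [diff_diffC]. *)
Lemma delta_quotient_limit f p e : holomorphic_at f p -> exists k0,
  differentiable (fun z => 'd f z e) p /\
  forall u, delta_quotient (fun z => 'd f z u) e (2^-1 ^+ (m + k0)) p @[m --> \oo]
    --> 'd (fun z => 'd f z e) p u.
Proof.
move=> /holomorphic_ball[rho [B [r0 df fB]]].
have r48 : 0 < rho / 48 by rewrite divr_gt0 ?ltr0n.
have [k0 hk0] := Cx_half_small (normr_ge0 e) r48.
pose t m : C := 2^-1 ^+ (m + k0).
have t0 m : 0 < t m by rewrite exprn_gt0// invr_gt0.
have te m : `|t m *: e| <= rho / 48.
  by rewrite normrZ gtr0_norm// mulrC hk0// leq_addl.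
have te12 m : `|t m *: e| <= rho / 12.
  by rewrite (le_trans (te m))// ler_pM2l// lef_pV2 ?posrE// ler_nat.
have te2 m : `|t m *: e| <= rho / 2.
  by rewrite (le_trans (te m))// ler_pM2l// lef_pV2 ?posrE// ler_nat.
have r2 : 0 < rho / 2 by rewrite divr_gt0.
have sub z : `|z - p| < rho / 2 -> `|z - p| < rho.
  move=> /lt_le_trans; apply; rewrite ler_pdivrMr// ler_peMr ?(ltW r0)// ler1n//.
have subt m z : `|z - p| < rho / 2 -> `|z + t m *: e - p| < rho.
  move=> zp; rewrite addrAC (le_lt_trans (ler_normD _ _))//.
  by rewrite [ltRHS]splitr ltr_leD.
have tn0 m : t m != 0 by rewrite gt_eqF.
have [||z zp|dL cL] := @limit_holomorphic R V (fun m => delta_quotient f e (t m))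
    (fun z => 'd f z e) p (rho / 2) (24 * B / rho * `|e|) r2.
- move=> m z zp; apply: (differentiable_delta_quotient _ _).1.
    exact/df/sub.
  exact/df/subt.
- move=> m z zp; rewrite /delta_quotient normrM normfV (gtr0_norm (t0 m)).
  rewrite mulrC ler_pdivrMr//.
  have := ball_lipschitz r0 df fB zp (te12 m).
  by rewrite normrZ (gtr0_norm (t0 m)) mulrCA mulrC.
- apply: delta_quotient_cvg; [exact/df/sub|exact: tn0|exact: half_cvg0].
exists k0; split; first exact: dL.
move=> u; have := cL u; apply: cvg_trans; apply: near_eq_cvg; near=> m.
have pp : `|p - p| < rho / 2 by rewrite subrr normr0.
have [_ ->] := @differentiable_delta_quotient R V f e (t m) p (df _ (sub _ pp))
  (df _ (subt m _ pp)).
by [].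
Unshelve. all: by end_near. Qed.

Lemma differentiable_diff f p e : holomorphic_at f p ->
  differentiable (fun z => 'd f z e) p.
Proof. by move=> /(delta_quotient_limit e)[k0 []]. Qed.

(** Both sides are limits of the same difference quotients of ['d f z u] in direction [e]: the left
    one by [delta_quotient_limit], the right one by [delta_quotient_cvg]. *)
Lemma diff_diffC f p e u : holomorphic_at f p ->
  'd (fun z => 'd f z e) p u = 'd (fun z => 'd f z u) p e.
Proof.
move=> fp; have [k0 [_ /(_ u) h]] := delta_quotient_limit e fp.
apply: (@cvg_unique _ (@norm_hausdorff _ C) _ _ _ _ h).
apply: delta_quotient_cvg; [exact: differentiable_diff| |exact: half_cvg0].
by move=> m; rewrite gt_eqF// exprn_gt0// invr_gt0.
Qed.

Lemma holomorphic_diff f p e : holomorphic_at f p ->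
  holomorphic_at (fun z => 'd f z e) p.
Proof.
rewrite /holomorphic_at => /nbhs_interior; apply: filterS => z fz.
by apply: differentiable_diff; exact: fz.
Qed.

End Derivatives.

(** * Hadamard's lemma *)

Section Hadamard.
Variables (R : realType) (V : normedModType (Cx R)).
Local Notation C := (Cx R).
Implicit Types (f g : V -> C) (p z u v e : V).

Lemma telescope_bound (y : nat -> V) f (d : C) e b N :
  (forall j, (j < N)%N -> `|f (y j.+1) - f (y j) - d * 'd f (y j) e| <= b) ->
  `|f (y N) - f (y 0%N) - d * (\sum_(j < N) 'd f (y j) e)| <= N%:R * b.
Proof.
elim: N => [|N ih] h; first by rewrite big_ord0 mulr0 subrr subr0 normr0 mul0r.
rewrite big_ord_recr /=.
have -> : f (y N.+1) - f (y 0%N) - d * (\sum_(j < N) 'd f (y j) e + 'd f (y N) e)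
  = (f (y N) - f (y 0%N) - d * (\sum_(j < N) 'd f (y j) e)) +
    (f (y N.+1) - f (y N) - d * 'd f (y N) e) by ring.
rewrite (le_trans (ler_normD _ _))// -natr1 mulrDl mul1r lerD ?h//.
by apply: ih => j jN; apply: h; exact: leqW.
Qed.

(** The quotient is the integral of ['d f (y s z) e] for [s] from 0 to 1, where [y s z] runs from
    [z - a z *: e] to [z]. Its Riemann sums [G m] are holomorphic and uniformly bounded near [p], so
    [limit_holomorphic] gives the holomorphy of their limit. *)
Lemma hadamard f p (a : V -> C) e : holomorphic_at f p ->
  (forall z, differentiable a z) -> (forall z, `|a z| <= `|z - p|) -> `|e| <= 1 ->
  exists h, holomorphic_at h p /\ forall z, f z = f (z - a z *: e) + a z * h z.
Proof.
move=> fh da aB e1; have [rho [B [r0 df fB]]] := holomorphic_ball fh.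
pose h z := if a z == 0 then 'd f z e else (f z - f (z - a z *: e)) / a z.
exists h; split; last first.
  move=> z; rewrite /h; case: eqP => [->|/eqP az].
    by rewrite scale0r subr0 mul0r addr0.
  by rewrite mulrC divfK// addrC subrK.
have B0 : 0 <= B by apply: le_trans (fB p _); rewrite ?subrr ?normr0.
have r2 : 0 < rho / 2 by rewrite divr_gt0.
have r8 : 0 < rho / 8 by rewrite divr_gt0.
have r16 : 0 < rho / 16 by rewrite divr_gt0.
pose y (s : C) z := z + ((s - 1) * a z) *: e.
have ynear s z : 0 <= s <= 1 -> `|z - p| < rho / 8 -> `|y s z - p| < rho / 4.
  move=> /andP[s0 s1] zp; rewrite /y addrAC (le_lt_trans (ler_normD _ _))//.
  rewrite (_ : rho / 4 = rho / 8 + rho / 8); last by field.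
  rewrite ltr_leD// !normrZ distrC.
  have s1' : `|1 - s| <= 1 by rewrite ger0_norm ?subr_ge0// gerBl.
  rewrite -[leRHS]mulr1 ler_pM// -[leRHS]mul1r ler_pM//.
  exact: le_trans (aB z) (ltW zp).
have yball s z w : 0 <= s <= 1 -> `|z - p| < rho / 8 -> `|w - y s z| < rho / 2 ->
    `|w - p| < rho.
  move=> s01 zp wy; rewrite -[w](subrK (y s z)) -addrA.
  rewrite (le_lt_trans (ler_normD _ _))// [ltRHS]splitr ltrD//.
  rewrite (lt_trans (ynear _ _ s01 zp))// ltr_pM2l// ltf_pV2 ?posrE//.
  by rewrite ltr_nat.
have ydf s z w : 0 <= s <= 1 -> `|z - p| < rho / 8 -> `|w - y s z| < rho / 2 ->
    differentiable f w by move=> s01 zp wy; exact: (df _ (yball _ _ _ s01 zp wy)).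
have yfB s z w : 0 <= s <= 1 -> `|z - p| < rho / 8 -> `|w - y s z| < rho / 2 ->
    `|f w| <= B by move=> s01 zp wy; exact: (fB _ (yball _ _ _ s01 zp wy)).
have dy s z : differentiable (y s) z.
  have d1 : differentiable (id : V -> V) z by exact: ex_diff.
  have d2 : differentiable (fun z => ((s - 1) * a z) *: e) z.
    apply: (@differentiableZl _ _ _ (fun z => (s - 1) * a z)).
    exact: (differentiableM (differentiable_cst _ _) (da z)).
  exact: (differentiableD d1 d2).
pose g (s : C) z := 'd f (y s z) e.
have dg s z : 0 <= s <= 1 -> `|z - p| < rho / 8 -> differentiable (g s) z.
  move=> s01 zp; have hy : holomorphic_at f (y s z).
    apply/nbhs_ballP; exists (rho / 2) => //= w; rewrite -ball_normE /= distrC => wy.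
    exact: (ydf s z w).
  exact: (differentiable_comp (dy s z) (differentiable_diff e hy)).
have gB s z : 0 <= s <= 1 -> `|z - p| < rho / 8 ->
    `|g s z| <= 3 * 24 * B / (rho / 2).
  move=> s01 zp; have := @diff_bound R V f (y s z) (rho / 2) B e r2.
  move=> /(_ (fun w => ydf s z w s01 zp) (fun w => yfB s z w s01 zp)).
  move=> /le_trans; apply; rewrite ler_piMr// divr_ge0 ?mulr_ge0 ?ler0n// ltW//.
pose t (m j : nat) : C := j%:R / m.+1%:R.
have t01 m (j : 'I_m.+1) : 0 <= t m j <= 1.
  by rewrite divr_ge0//= ler_pdivrMr// mul1r ler_nat ltnW.
pose G m z := m.+1%:R^-1 * \sum_(j < m.+1) g (t m j) z.
have dG m z : `|z - p| < rho / 8 -> differentiable (G m) z.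
  move=> zp; have dS : differentiable (\sum_(j < m.+1) g (t m j)) z.
    by apply: differentiable_sum => j; exact: dg.
  have -> : G m = cst (m.+1%:R^-1) * \sum_(j < m.+1) g (t m j).
    by apply/funext => w; rewrite /G !fctE fct_sumE.
  exact: (differentiableM (differentiable_cst (m.+1%:R^-1 : C) z) dS).
have GB m z : `|z - p| < rho / 8 -> `|G m z| <= 3 * 24 * B / (rho / 2).
  move=> zp; rewrite /G normrM normfV (ger0_norm (ler0n _ m.+1)) mulrC ler_pdivrMr ?ltr0n//.
  rewrite (le_trans (ler_norm_sum _ _ _))//.
  apply: le_trans (ler_sum _ (fun j _ => gB _ _ (t01 m j) zp)) _.
  by rewrite sumr_const card_ord -[leLHS]mulr_natr.
have Gh z : `|z - p| < rho / 8 -> G m z @[m --> \oo] --> h z.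
  move=> zp; rewrite /h; case: eqP => [az|/eqP az].
    rewrite (_ : (fun m => G m z) = cst ('d f z e)); first exact: cvg_cst.
    apply/funext => m; rewrite /G /g /y az.
    under eq_bigr do rewrite mulr0 scale0r addr0.
    by rewrite sumr_const card_ord -[X in _ * X]mulr_natr mulrCA mulVf// mulr1.
  apply/cvgrPdist_le => ep ep0.
  pose K := 24 ^+ 2 * B / (rho / 2) ^+ 2.
  have K0 : 0 <= K by rewrite divr_ge0 ?exprn_ge0 ?(ltW r2) ?mulr_ge0 ?exprn_ge0 ?ler0n.
  have na : 0 < `|a z| by rewrite normr_gt0.
  have r48 : 0 < rho / 2 / 24 by rewrite divr_gt0.
  have [n1 hn1] := Cx_natr_bound (divr_ge0 (normr_ge0 (a z)) (ltW r48)).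
  have [n2 hn2] : exists n : nat, K * `|a z| / ep <= n%:R.
    exact: (Cx_natr_bound (divr_ge0 (mulr_ge0 K0 (normr_ge0 (a z))) (ltW ep0))).
  exists (maxn n1 n2) => // m /=; rewrite geq_max => /andP[m1 m2].
  pose N : C := m.+1%:R; have N0 : 0 < N by rewrite /N ltr0n.
  (* Consecutive nodes differ by [(a z / N) *: e], so each costs a quadratic error and the total is
     of order [1 / N]. *)
  have step j : (j < m.+1)%N -> `|f (y (t m j.+1) z) - f (y (t m j) z)
      - a z / N * 'd f (y (t m j) z) e| <= K * (`|a z| / N) ^+ 2.
    move=> jm; have s01 := t01 m (Ordinal jm); rewrite /= in s01.
    have -> : y (t m j.+1) z = y (t m j) z + (a z / N) *: e.
      rewrite /y -addrA -scalerDl; congr (_ + _ *: _).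
      by rewrite /t -natr1; ring.
    have ne : `|(a z / N) *: e| <= `|a z| / N.
      by rewrite normrZ normf_div (gtr0_norm N0) ler_piMr// divr_ge0// ltW.
    have := @taylor1 R V f (y (t m j) z) (rho / 2) B ((a z / N) *: e) r2
      (fun w => ydf _ z w s01 zp) (fun w => yfB _ z w s01 zp).
    rewrite diff_homog => H; apply: le_trans (H _) _.
      rewrite (le_trans ne)// ler_pdivrMr// mulrC -ler_pdivrMr// (le_trans hn1)//.
      by rewrite ler_nat (leq_trans m1).
    by rewrite ler_wpM2l// lerXn2r ?nnegrE// divr_ge0// ltW.
  have := @telescope_bound (fun j => y (t m j) z) f (a z / N) e _ m.+1 step.
  have -> : y (t m m.+1) z = z.
    by rewrite /y /t divff ?pnatr_eq0// subrr mul0r scale0r addr0.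
  have -> : y (t m 0) z = z - a z *: e.
    by rewrite /y /t mul0r sub0r mulN1r scaleNr.
  move=> H; rewrite -(ler_pM2r na) -normrM mulrBl divfK//.
  rewrite (_ : G m z * a z = a z / N * (\sum_(j < m.+1) 'd f (y (t m j) z) e)); last first.
    by rewrite /G /g -/N; ring.
  rewrite (le_trans H)// -/N.
  rewrite (_ : N * (K * (`|a z| / N) ^+ 2) = K * `|a z| / N * `|a z|); last first.
    by field; rewrite gt_eqF.
  rewrite (ler_pM2r na) (ler_pdivrMr _ _ N0) [leRHS]mulrC -(ler_pdivrMr _ _ ep0) (le_trans hn2)//.
  by rewrite ler_nat (leq_trans m2).
apply/nbhs_ballP; exists (rho / 16) => //= q; rewrite -ball_normE /= distrC => qp.
have sub z : `|z - q| < rho / 16 -> `|z - p| < rho / 8.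
  move=> zq; rewrite -[z](subrK q) -addrA (le_lt_trans (ler_normD _ _))//.
  by rewrite (_ : rho / 8 = rho / 16 + rho / 16) ?ltrD//; field.
have [] := @limit_holomorphic R V G h q (rho / 16) (3 * 24 * B / (rho / 2)) r16.
- by move=> m z /sub; exact: dG.
- by move=> m z /sub; exact: GB.
- by move=> z /sub; exact: Gh.
by [].
Qed.

End Hadamard.

(** * Matrices of positive weight *)

Section WeightWords.
Variables (F : numClosedFieldType) (n : nat).
Implicit Types (A X Y : 'M[F]_n) (s : seq 'M[F]_n).

Definition weight A X (d : nat) := A *m X - X *m A = d%:R *: X.

Definition raising A X := exists2 d, (0 < d)%N & weight A X d.

Definition mxword s : 'M[F]_n := foldr mulmx 1%:M s.

Lemma mxword_cat s t : mxword (s ++ t) = mxword s *m mxword t.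
Proof. by elim: s => [|X s ih] /=; rewrite ?mul1mx// ih mulmxA. Qed.

(** With matrices acting on row vectors, right multiplication by [X] maps the eigenspace of [l] into
    that of [l - d]. *)
Lemma weight_shift A X d l : weight A X d ->
  (A - l%:M) *m X = X *m (A - (l - d%:R)%:M).
Proof.
move=> AX; rewrite mulmxBl mulmxBr raddfB /= mulmxBr mul_scalar_mx !mul_mx_scalar.
have -> : A *m X = X *m A + d%:R *: X by rewrite -AX addrC subrK.
by rewrite opprB addrA.
Qed.

Lemma weight_mxword A s (d : 'M[F]_n -> nat) :
  (forall X, X \in s -> weight A X (d X)) ->
  weight A (mxword s) (\sum_(X <- s) d X).
Proof.
elim: s => [|X s ih] h.
  by rewrite /weight /= mul1mx mulmx1 subrr big_nil scale0r.
have hd := h X (mem_head _ _).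
have he := ih (fun Y Ys => h Y (mem_behead (s := X :: s) Ys)).
rewrite /weight /= big_cons natrD scalerDl scalemxAl -hd scalemxAr -he.
by rewrite mulmxBl mulmxBr !mulmxA addrA subrK.
Qed.

End WeightWords.

Section Nilpotent.
Variables (F : numClosedFieldType).

(* A letter of weight [d > 0] shifts generalized eigenvectors to the eigenvalue
   lowered by [d], so a nonzero word would produce [n + 2] distinct eigenvalues. *)
Lemma geigen_word n (A : 'M[F]_n.+1) s l k : (n.+1 <= size s)%N ->
  (forall X, X \in s -> raising A X) ->
  kermxpoly A (('X - l%:P) ^+ k) *m mxword s = 0.
Proof.
move=> ns hs; apply/row_matrixP => i; rewrite row0 row_mul.
set v := row i _; apply/eqP; apply: contraT => vw0.
have vk : v *m (A - l%:M) ^+ k = 0.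
  have /sub_kermxP : (v <= kermxpoly A (('X - l%:P) ^+ k))%MS by exact: row_sub.
  by rewrite rmorphXn/= rmorphB/= horner_mx_X horner_mx_C.
have dex (X : 'M[F]_n.+1) : exists d, X \in s -> (0 < d)%N /\ weight A X d.
  have [/hs[d d0 dX]|Xs] := boolP (X \in s); first by exists d.
  by exists 0%N.
have [d dP] := boolp.choice dex.
pose e j := (\sum_(X <- take j s) d X)%N.
have we j : weight A (mxword (take j s)) (e j).
  by apply: weight_mxword => X /mem_take Xs; have [] := dP X Xs.
have pw (B B' Y : 'M[F]_n.+1) m : B *m Y = Y *m B' -> B ^+ m *m Y = Y *m B' ^+ m.
  move=> BY; elim: m => [|m ih]; first by rewrite !expr0 mul1mx mulmx1.
  by rewrite exprSr -mulmxE -mulmxA BY mulmxA ih -mulmxA mulmxE -exprSr.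
(* If this were not an eigenvalue, [weight_shift] would make the prefix of length [j] annihilate
   [v], hence also the whole word. *)
have ev j : eigenvalue A (l - (e j)%:R).
  apply: contraT => nev.
  have u : A - (l - (e j)%:R)%:M \in unitmx.
    move: nev; rewrite /eigenvalue /eigenspace kermx_eq0 negbK row_free_unit//.
  have := congr1 (mulmx^~ (mxword (take j s))) vk; rewrite mul0mx -mulmxA.
  rewrite (pw _ _ _ _ (weight_shift l (we j))) mulmxA.
  move=> /(congr1 (mulmx^~ (invmx ((A - (l - (e j)%:R)%:M) ^+ k)))).
  have uk : (A - (l - (e j)%:R)%:M) ^+ k \in unitmx.
    by rewrite -[unitmx]/(GRing.unit : {pred 'M[F]_n.+1}); apply: unitrX.
  rewrite mulmxK// mul0mx => vj0.
  by move: vw0; rewrite -(cat_take_drop j s) mxword_cat mulmxA vj0 mul0mx eqxx.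
have emono i1 i2 : (i1 < i2)%N -> (i2 <= size s)%N -> (e i1 < e i2)%N.
  elim: i2 => // i2 ih; rewrite ltnS => i12 si2.
  have ei2 : (e i2 < e i2.+1)%N.
    rewrite /e (take_nth 0)// -cats1 big_cat big_seq1 /= -[X in (X < _)%N]addn0.
    by rewrite ltn_add2l; have [] := dP _ (mem_nth 0 si2).
  move: i12; rewrite leq_eqVlt => /predU1P[->//|i12].
  exact: ltn_trans (ih i12 (ltnW si2)) ei2.
pose rs := [seq l - (e j)%:R : F | j <- iota 0 n.+2].
have := max_poly_roots (_ : char_poly A != 0) (_ : all (root (char_poly A)) rs)
  (_ : uniq rs).
rewrite size_map size_iota size_char_poly ltnn; apply.
- by rewrite monic_neq0 ?char_poly_monic.
- by apply/allP => _ /mapP[j _ ->]; rewrite -eigenvalue_root_char.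
rewrite map_inj_in_uniq ?iota_uniq// => i1 i2; rewrite !mem_iota /= add0n !ltnS.
move=> h1 h2 /addrI/oppr_inj/eqP; rewrite eqr_nat => /eqP e12.
have [i12|i21|//] := ltngtP i1 i2.
  by have := emono _ _ i12 (leq_trans h2 ns); rewrite e12 ltnn.
by have := emono _ _ i21 (leq_trans h1 ns); rewrite e12 ltnn.
Qed.

(** Primary decomposition: splitting off one root at a time extends [geigen_word] from generalized
    eigenspaces to the kernel of any nonzero polynomial in [A]; for the characteristic polynomial
    this is the whole space, by Cayley-Hamilton. *)
Lemma raising_word_eq0 n (A : 'M[F]_n) s : (n <= size s)%N ->
  (forall X, X \in s -> raising A X) -> mxword s = 0.
Proof.
case: n A s => [|n] A s ns hs; first exact: flatmx0.
have H (q : {poly F}) : q != 0 -> kermxpoly A q *m mxword s = 0.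
  elim: {q}(size q) {-2}q (leqnn (size q)) => [|m ih] q.
    by rewrite leqn0 size_poly_eq0 => /eqP ->; rewrite eqxx.
  move=> qm q0; have [/eqP sq|] := boolP (size q == 1%N).
    have qc : q = (q`_0)%:P by apply: size1_polyC; rewrite sq.
    by rewrite qc kermxpolyC ?mul0mx//; move: q0; rewrite {1}qc polyC_eq0.
  move=> /closed_rootP[l ql].
  have [k [q1 q1l qE]] := multiplicity_XsubC q l.
  rewrite q0 /= in q1l.
  have cop : coprimep q1 (('X - l%:P) ^+ k).
    by apply: coprimep_expr; rewrite coprimep_XsubC.
  have q10 : q1 != 0 by apply: contraNneq q1l => ->; rewrite root0.
  have q1m : (size q1 <= m)%N.
    rewrite -ltnS (leq_trans _ qm)// qE size_Mmonic ?monic_exp ?monicXsubC//.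
    rewrite size_exp_XsubC addnS /= -[X in (X < _)%N]addn0 ltn_add2l lt0n.
    apply: contraTneq ql => k0; move: qE; rewrite k0 expr0 mulr1 => ->.
    exact: q1l.
  have := kermxpolyM A cop; rewrite -qE => e.
  have [h1 h2] := (ih q1 q1m q10, geigen_word l k ns hs).
  apply/eqP; rewrite -submx0 (eqmxMr (mxword s) e) addsmxMr h1 h2.
  by rewrite addsmx0 submx_refl.
have := H (char_poly A); rewrite monic_neq0 ?char_poly_monic// => /(_ isT).
have e := kermxpoly_min (mxminpoly_dvd_char A) => ws.
apply/eqP; rewrite -submx0 -[mxword s]mul1mx -(eqmxMr (mxword s) e) ws.
exact: sub0mx.
Qed.

End Nilpotent.

(** Differentiability together with a single value of the differential, so that directional
    derivatives are computed rule by rule without naming whole differentials. *)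
Definition has_diff (K : numFieldType) (V W : normedModType K) (f : V -> W)
    (z u : V) (a : W) := differentiable f z /\ 'd f z u = a.

Section DiffRules.
Variables (K : numFieldType) (V : normedModType K).
Implicit Types (f g : V -> K) (z u : V).

Lemma has_diff_eq (W : normedModType K) (f : V -> W) z u a b :
  has_diff f z u a -> a = b -> has_diff f z u b.
Proof. by move=> h <-. Qed.

Lemma has_diff_mul f g z u a b : has_diff f z u a -> has_diff g z u b ->
  has_diff (fun z => f z * g z) z u (f z * b + g z * a).
Proof.
move=> [df <-] [dg <-].
have [d e] := is_diffM (differentiableP df) (differentiableP dg).
by split; [exact: d|exact: (congr1 (fun F => F u) e)].
Qed.

Lemma has_diff_add (W : normedModType K) (f g : V -> W) z u a b :
  has_diff f z u a -> has_diff g z u b ->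
  has_diff (fun z => f z + g z) z u (a + b).
Proof.
move=> [df <-] [dg <-].
have [d e] := is_diffD (differentiableP df) (differentiableP dg).
by split; [exact: d|exact: (congr1 (fun F => F u) e)].
Qed.

Lemma has_diff_scale (W : normedModType K) (g : V -> W) k z u b :
  has_diff g z u b -> has_diff (fun z => k *: g z) z u (k *: b).
Proof.
move=> [dg <-]; have [d e] := is_diffZ k (differentiableP dg).
by split; [exact: d|exact: (congr1 (fun F => F u) e)].
Qed.

Lemma has_diff_scalel (W : normedModType K) f (e : W) z u a : has_diff f z u a ->
  has_diff (fun z => f z *: e) z u (a *: e).
Proof.
move=> [df <-]; split; first exact: differentiableZl.
by have := congr1 (fun F => F u) (diffZl e df).
Qed.

Lemma has_diff_cst (W : normedModType K) (e : W) z u : has_diff (fun _ : V => e) z u 0.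
Proof.
split; first exact: differentiable_cst.
exact: (congr1 (fun F => F u) (diff_cst e z)).
Qed.

Lemma has_diff_id z u : has_diff (fun z : V => z) z u u.
Proof.
by have [d e] := is_diff_id z; split; [exact: d|exact: (congr1 (fun F => F u) e)].
Qed.

Lemma has_diff_exp f z m u a : has_diff f z u a ->
  has_diff (fun z => f z ^+ m) z u (m%:R * f z ^+ m.-1 * a).
Proof.
move=> df; elim: m => [|m ih].
  rewrite (_ : (fun z => f z ^+ 0) = fun=> 1); last by apply/funext => t; rewrite expr0.
  by apply: has_diff_eq (has_diff_cst (1 : K) z u) _; rewrite !mul0r.
rewrite (_ : (fun z => f z ^+ m.+1) = fun z => f z * f z ^+ m); last first.
  by apply/funext => t; rewrite exprS.
apply: has_diff_eq (has_diff_mul df ih) _.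
case: m {ih} => [|m]; first by rewrite /= !expr0; ring.
by rewrite /= exprS -[in RHS]natr1; ring.
Qed.

Lemma near_eq_has_diff (W : normedModType K) (f g : V -> W) z u a :
  (\forall y \near z, f y = g y) -> has_diff f z u a -> has_diff g z u a.
Proof.
move=> fg [df <-]; have dg := near_eq_differentiable fg df; split; first exact: dg.
by have := near_eq_derive u fg; rewrite (deriveE u df) (deriveE u dg).
Qed.

End DiffRules.

(** * Monomials centred at a point *)

Section Monomials.
Variables (R : realType) (n : nat) (p : 'rV[Cx R]_n).
Local Notation C := (Cx R).
Local Notation E := 'rV[C]_n.
Implicit Types (f g : E -> C) (i j l : 'I_n) (J I : 'I_n -> nat) (z u : E).

Definition pcoord i z : C := z 0 i - p 0 i.

Definition monomial J z : C := \prod_i pcoord i z ^+ J i.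

Definition dmx i : E := delta_mx 0 i.

Definition shiftmi J i (a : nat) := fun l => (J l + a *+ (l == i))%N.

(** Truncation of the subtraction is harmless in derivatives: the coefficient, [J i] or a falling
    factorial, is zero whenever it occurs. *)
Definition midec J i (a : nat) := fun l => (J l - a *+ (l == i))%N.

Lemma has_diff_pcoord i z u : has_diff (pcoord i) z u (u 0 i).
Proof.
have @L : {linear E -> C}.
  by exists (fun N : E => N 0 i); do 2![eexists]; do ?[constructor];
     rewrite ?mxE// => ? *; rewrite ?mxE//; move=> ?; rewrite !mxE.
have Lc : continuous L by exact: coord_continuous.
have dL : is_diff z L L.
  by apply: DiffDef; [exact: linear_differentiable|rewrite diff_lin].
have [d e] := is_diffB dL (is_diff_cst (p 0 i) z).
by split; [exact: d|have := congr1 (fun F => F u) e; rewrite subr0].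
Qed.

Lemma pcoord_self i : pcoord i p = 0. Proof. exact: subrr. Qed.

Lemma monomial_add J i a z :
  monomial (shiftmi J i a) z = pcoord i z ^+ a * monomial J z.
Proof.
rewrite /monomial (bigD1 i)//= [in RHS](bigD1 i)//= /shiftmi eqxx mulr1n.
rewrite addnC exprD -!mulrA; congr (_ * (_ * _)); apply: eq_bigr => l /negbTE li.
by rewrite li mulr0n addn0.
Qed.

Lemma monomial_p J : (exists i, 0 < J i)%N -> monomial J p = 0.
Proof.
move=> [i Ji]; rewrite /monomial (bigD1 i)//= pcoord_self expr0n.
by rewrite gtn_eqF// mul0r.
Qed.

Lemma has_diff_monomial J z u : has_diff (monomial J) z u
  (\sum_i (J i)%:R * u 0 i * monomial (midec J i 1) z).
Proof.
pose P (s : seq 'I_n) J z : C := \prod_(i <- s) pcoord i z ^+ J i.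
suff H s : uniq s -> has_diff (P s J) z u
    (\sum_(i <- s) (J i)%:R * u 0 i * P s (midec J i 1) z).
  exact: (H (index_enum _) (index_enum_uniq _)).
elim: s => [|i s ih] /=.
  rewrite big_nil (_ : P [::] J = fun=> 1); first by move=> _; exact: has_diff_cst.
  by apply/funext => w; rewrite /P big_nil.
move=> /andP[is_ /ih {}ih].
have -> : P (i :: s) J = fun w => pcoord i w ^+ J i * P s J w.
  by apply/funext => w; rewrite /P big_cons.
apply: has_diff_eq (has_diff_mul (has_diff_exp (J i) (has_diff_pcoord i z u)) ih) _.
rewrite big_cons addrC; congr (_ + _).
  rewrite {2}/P big_cons /midec eqxx mulr1n subn1.
  rewrite (_ : \prod_(l <- s) _ = P s J z); first by ring.
  rewrite /P big_seq [in RHS]big_seq; apply: eq_bigr => l ls.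
  by rewrite (_ : (l == i) = false) ?subn0//; apply: contraNF is_ => /eqP <-.
rewrite mulr_sumr big_seq [in RHS]big_seq; apply: eq_bigr => l ls.
rewrite {2}/P big_cons /midec (_ : (i == l) = false) ?subn0; last first.
  by apply: contraNF is_ => /eqP ->.
by rewrite -/(P s _ z); ring.
Qed.

Lemma midecK J i z : (0 < J i)%N -> pcoord i z * monomial (midec J i 1) z = monomial J z.
Proof.
move=> Ji; rewrite -[pcoord i z]expr1 -monomial_add; apply: eq_bigr => l _.
congr (_ ^+ _); rewrite /shiftmi /midec; case: eqP => [->|_]; last by rewrite subn0 addn0.
by rewrite mulr1n subnK.
Qed.

Lemma euler_monomial J z :
  has_diff (monomial J) z (z - p) ((\sum_i J i)%:R * monomial J z).
Proof.
apply: has_diff_eq (has_diff_monomial J z (z - p)) _.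
rewrite natr_sum mulr_suml; apply: eq_bigr => i _.
rewrite !mxE -[z 0 i - p 0 i]/(pcoord i z) -mulrA.
case Ji : (J i) => [|a]; first by rewrite !mul0r.
by rewrite -Ji midecK// Ji.
Qed.

Lemma diff_monomial J z l : has_diff (monomial J) z (dmx l)
  ((J l)%:R * monomial (midec J l 1) z).
Proof.
apply: has_diff_eq (has_diff_monomial J z (dmx l)) _.
rewrite /dmx (bigD1 l)//= !mxE !eqxx mulr1 big1 ?addr0// => i /negbTE il.
by rewrite !mxE il andbF mulr0 mul0r.
Qed.

End Monomials.

Lemma has_diff_scalelr (K : numFieldType) (V W : normedModType K)
    (f : V -> K) (g : V -> W) z u a b :
  has_diff f z u a -> has_diff g z u b ->
  has_diff (fun z => f z *: g z) z u (f z *: b + a *: g z).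
Proof.
move=> [df <-] [dg <-].
have bilB : bilinear_for
    (GRing.Scale.Law.clone _ _ *:%R _) (GRing.Scale.Law.clone _ _ *:%R _)
    (@GRing.scale K W).
  split=> [w|c] x y t /=; first by rewrite scalerDl scalerA.
  by rewrite scalerDr !scalerA mulrC.
pose mB := bilinear_isBilinear.Build K K W W _ _ (@GRing.scale K W) bilB.
pose B : {bilinear K -> W -> W} := HB.pack (@GRing.scale K W) mB.
have Bc : continuous (fun q : K * W => B q.1 q.2).
  by move=> q; exact: scale_continuous.
have dB q : is_diff q (fun q : K * W => B q.1 q.2) (fun w => B q.1 w.2 + B w.1 q.2).
  by apply: DiffDef; [exact: differentiable_bilin|exact: diff_bilin].
have [d e] := is_diff_comp (is_diff_pair (differentiableP df) (differentiableP dg))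
  (dB (f z, g z)).
by split; [exact: d|exact: (congr1 (fun F => F u) e)].
Qed.

Lemma has_diff_homog (K : numFieldType) (V W : normedModType K) (f : V -> W) z u a k :
  has_diff f z u a -> has_diff f z (k *: u) (k *: a).
Proof. by move=> [df <-]; split; [exact: df|exact: linearZ]. Qed.

Lemma holomorphic_scale (R : realType) (V W : normedModType (Cx R)) (f : V -> W) k p :
  holomorphic_at f p -> holomorphic_at (fun z => k *: f z) p.
Proof. by apply: filterS => z dz; exact: (has_diff_scale k (conj dz (erefl ('d f z 0)))).1. Qed.

Lemma holomorphic_add (R : realType) (V W : normedModType (Cx R)) (f g : V -> W) p :
  holomorphic_at f p -> holomorphic_at g p -> holomorphic_at (fun z => f z + g z) p.
Proof. by apply: filterS2 => z df dg; exact: (has_diff_add (conj df (erefl ('d f z 0))) (conj dg erefl)).1. Qed.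

Lemma holomorphic_mul (R : realType) (V : normedModType (Cx R)) (f g : V -> Cx R) p :
  holomorphic_at f p -> holomorphic_at g p -> holomorphic_at (fun z => f z * g z) p.
Proof. by apply: filterS2 => z df dg; exact: (has_diff_mul (conj df (erefl ('d f z 0))) (conj dg erefl)).1. Qed.

Lemma near_eq_holomorphic (R : realType) (V W : normedModType (Cx R)) (f g : V -> W) p :
  holomorphic_at f p -> (\forall z \near p, f z = g z) -> holomorphic_at g p.
Proof.
move=> hf /nbhs_interior fg; apply: filterS2 hf fg => z df fgz.
exact: near_eq_differentiable fgz df.
Qed.

(** A letter that is a bracket can be exchanged for two longer words; this is how degree is traded
    for length. *)
Lemma word_bracket (F : numClosedFieldType) r (c : F) (X B Y S T : 'M[F]_r) :
  c != 0 -> c *: X = B *m Y - Y *m B ->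
  S *m B *m (Y *m T) = 0 -> S *m Y *m B *m T = 0 -> S *m X *m T = 0.
Proof.
move=> c0 cX h1 h2; apply: (scalerI c0).
rewrite scaler0 scalemxAl scalemxAr cX mulmxBr mulmxBl !mulmxA h2 subr0.
by rewrite -h1 !mulmxA.
Qed.

(** * The isotropy representation on monomial fields *)

Section Isotropy.
Variables (R : realType) (n r : nat) (p : 'rV[Cx R]_n).
Local Notation C := (Cx R).
Local Notation E := 'rV[C]_n.
(** Abstract form of the Lie map on germs at [p], with the value of the symbol and a matrix as
    components. The commutator below is reversed because matrices act on row coordinates, so that
    operators compose in the opposite order. *)
Variable rho : (E -> E) -> E * 'M[C]_r.
Hypothesis rho_lin : forall a v w, holomorphic_at v p -> holomorphic_at w p ->
  rho (fun z => a *: v z + w z) = a *: rho v + rho w.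
Hypothesis rho_val : forall v, holomorphic_at v p -> (rho v).1 = v p.
Hypothesis rho_bracket : forall v w b, holomorphic_at v p -> holomorphic_at w p ->
  holomorphic_at b p -> v p = 0 -> w p = 0 ->
  (\forall z \near p, b z = 'd w z (v z) - 'd v z (w z)) ->
  (rho b).2 = (rho w).2 *m (rho v).2 - (rho v).2 *m (rho w).2.

Implicit Types (i j l : 'I_n) (J I : 'I_n -> nat) (z u : E).

Definition field (g : E -> C) j z : E := g z *: dmx R j.

Lemma holomorphic_field g j : holomorphic_at g p -> holomorphic_at (field g j) p.
Proof. by apply: filterS => z dg; exact: differentiableZl. Qed.

Lemma holomorphic_monomial J : holomorphic_at (monomial p J) p.
Proof. by apply: filterE => z; have [d _] := has_diff_monomial p J z 0. Qed.

Definition euler z : E := z - p.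

Lemma has_diff_euler z u : has_diff euler z u u.
Proof.
apply: has_diff_eq (has_diff_add (has_diff_id z u) (has_diff_cst (- p) z u)) _.
by rewrite addr0.
Qed.

(** A quadratic field of weight one whose brackets with the [mono J j], for [j != i], are multiples
    of single monomial fields. *)
Definition xeuler i z : E := pcoord p i z *: euler z.

Lemma has_diff_xeuler i z u :
  has_diff (xeuler i) z u (pcoord p i z *: u + u 0 i *: euler z).
Proof.
exact: has_diff_scalelr (has_diff_pcoord p i z u) (has_diff_euler z u).
Qed.

Lemma holomorphic_euler : holomorphic_at euler p.
Proof. by apply: filterE => z; have [d _] := has_diff_euler z 0. Qed.

Lemma holomorphic_xeuler i : holomorphic_at (xeuler i) p.
Proof. by apply: filterE => z; have [d _] := has_diff_xeuler i z 0. Qed.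

Lemma euler_p : euler p = 0. Proof. exact: subrr. Qed.

Lemma xeuler_p i : xeuler i p = 0. Proof. by rewrite /xeuler euler_p scaler0. Qed.

Definition mono J j := field (monomial p J) j.

Lemma holomorphic_mono J j : holomorphic_at (mono J j) p.
Proof. exact/holomorphic_field/holomorphic_monomial. Qed.

Lemma mono_p J j : (0 < \sum_i J i)%N -> mono J j p = 0.
Proof.
move=> J0; rewrite /mono /field monomial_p ?scale0r//.
apply: contrapT => /forallNP h; move: J0; rewrite big1// => i _.
by apply/eqP; rewrite -leqn0 leqNgt; apply/negP; exact: h.
Qed.

Lemma has_diff_mono J j z u a : has_diff (monomial p J) z u a ->
  has_diff (mono J j) z u (a *: dmx R j).
Proof. exact: has_diff_scalel. Qed.

Lemma rhoZ a v : holomorphic_at v p -> rho (fun z => a *: v z) = a *: rho v.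
Proof.
move=> hv; have h0 : holomorphic_at (fun _ : E => 0 : E) p.
  by apply: filterE => z; exact: differentiable_cst.
have r0 : rho (fun=> 0) = 0.
  have := rho_lin (-1) h0 h0.
  rewrite (_ : (fun z => _) = fun=> 0); last by apply/funext => z; rewrite scaler0 addr0.
  by rewrite scaleN1r addNr.
have := rho_lin a hv h0; rewrite r0 addr0 => <-.
by congr rho; apply/funext => z; rewrite addr0.
Qed.

(** The sign compensates for the reversed commutator, so that degree [d + 1] gets weight [d]. *)
Definition gen := - (rho euler).2.

Lemma rho_bracketE v w b : holomorphic_at v p -> holomorphic_at w p ->
  holomorphic_at b p -> v p = 0 -> w p = 0 ->
  (\forall z \near p, exists x y,
     [/\ has_diff w z (v z) x, has_diff v z (w z) y & b z = x - y]) ->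
  (rho b).2 = (rho w).2 *m (rho v).2 - (rho v).2 *m (rho w).2.
Proof.
move=> hv hw hb vp wp h; apply: rho_bracket hv hw hb vp wp _.
by apply: filterS h => z [x [y [[_ <-] [_ <-] ->]]].
Qed.

Lemma weight_bracket v d : holomorphic_at v p -> v p = 0 ->
  (forall z, has_diff v z (euler z) (v z + d%:R *: v z)) ->
  weight gen (rho v).2 d.
Proof.
move=> hv vp dv.
have := @rho_bracketE euler v (fun z => d%:R *: v z) holomorphic_euler hv
  (holomorphic_scale _ hv) euler_p vp.
rewrite (rhoZ _ hv) /weight /gen mulNmx mulmxN opprK addrC => <- //.
apply: filterE => z; exists (v z + d%:R *: v z), (v z); split; [exact: dv| |].
  exact: has_diff_euler.
by rewrite addrAC subrr add0r.
Qed.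

Lemma weight_mono J j a : (\sum_i J i = a.+1)%N -> weight gen (rho (mono J j)).2 a.
Proof.
move=> Ja; apply: weight_bracket; first exact: holomorphic_mono.
  by rewrite mono_p// Ja.
move=> z; apply: has_diff_eq (has_diff_mono j (euler_monomial p J z)) _.
by rewrite Ja /mono /field -natr1 mulrDl mul1r scalerDl scalerA addrC.
Qed.

Lemma weight_xeuler i : weight gen (rho (xeuler i)).2 1.
Proof.
apply: weight_bracket; [exact: holomorphic_xeuler|exact: xeuler_p|move=> z].
apply: has_diff_eq (has_diff_xeuler i z (euler z)) _.
by rewrite scale1r /xeuler; congr (_ + _ *: _); rewrite !mxE.
Qed.

Lemma bracket_fields (f g : E -> C) i j (a b : C) z (c : E) : has_diff f z (dmx R i) a ->
  has_diff g z (dmx R j) b -> c = (g z * a) *: dmx R j - (f z * b) *: dmx R i ->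
  exists x y, [/\ has_diff (field f j) z (field g i z) x,
    has_diff (field g i) z (field f j z) y & c = x - y].
Proof.
move=> df dg ->; exists ((g z * a) *: dmx R j), ((f z * b) *: dmx R i); split=> //.
  have h : has_diff f z (field g i z) (g z * a) by exact: has_diff_homog df.
  exact: (has_diff_scalel (dmx R j) h).
have h : has_diff g z (field f j z) (f z * b) by exact: has_diff_homog dg.
exact: (has_diff_scalel (dmx R i) h).
Qed.

(** Since [i != j], the derivative of [x_i] along [d_j] vanishes, and Euler's identity reduces the
    bracket of [x_i E] with [x^J d_j], where [E] is the Euler field, to [(|J| - 1) x_i x^J d_j]. *)
Lemma rho_shift J i j a : i != j -> (\sum_i J i = a.+1)%N ->
  a%:R *: (rho (mono (shiftmi J i 1) j)).2 =
  (rho (mono J j)).2 *m (rho (xeuler i)).2 - (rho (xeuler i)).2 *m (rho (mono J j)).2.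
Proof.
move=> ij Ja; have hm := holomorphic_mono (shiftmi J i 1) j.
rewrite -[LHS]/(_ *: rho _).2 -(rhoZ _ hm); apply: rho_bracketE.
- exact: holomorphic_xeuler.
- exact: holomorphic_mono.
- exact: holomorphic_scale.
- exact: xeuler_p.
- by rewrite mono_p// Ja.
apply: filterE => z.
have h : has_diff (monomial p J) z (xeuler i z)
    (pcoord p i z * ((\sum_i J i)%:R * monomial p J z)).
  exact: (has_diff_homog (pcoord p i z) (euler_monomial p J z)).
exists ((pcoord p i z * ((\sum_i J i)%:R * monomial p J z)) *: dmx R j),
  (pcoord p i z *: mono J j z + mono J j z 0 i *: euler z); split.
- exact: (has_diff_mono j h).
- exact: has_diff_xeuler.
rewrite /mono /field !mxE (negbTE ij) andbF mulr0 scale0r addr0 Ja.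
rewrite monomial_add expr1 !scalerA -scalerBl; congr (_ *: _).
by rewrite -[a.+1%:R]natr1 /GRing.scale /=; ring.
Qed.

(** Covers the powers of [x_j] alone, which [rho_shift] does not reach. The factor is
    [(a + 2) - 2 = a], so the step is effective only from [a = 1] on, that is for [x_j^4 d_j] and
    higher. *)
Lemma rho_power J j a : (\sum_i J i = a.+2)%N -> J j = a.+2 ->
  a%:R *: (rho (mono (shiftmi J j 1) j)).2 =
  (rho (mono J j)).2 *m (rho (mono (shiftmi (fun=> 0%N) j 2) j)).2 -
  (rho (mono (shiftmi (fun=> 0%N) j 2) j)).2 *m (rho (mono J j)).2.
Proof.
move=> Ja Jj; have hm := holomorphic_mono (shiftmi J j 1) j.
set Q := shiftmi (fun=> 0%N) j 2.
have Qs : (\sum_i Q i = 2)%N.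
  rewrite (bigD1 j)//= big1 ?addn0 /Q /shiftmi ?eqxx// => l /negbTE ->.
  by rewrite mulr0n.
rewrite -[LHS]/(_ *: rho _).2 -(rhoZ _ hm); apply: rho_bracketE.
- exact: holomorphic_mono.
- exact: holomorphic_mono.
- exact: holomorphic_scale.
- by rewrite mono_p// Qs.
- by rewrite mono_p// Ja.
apply: filterE => z.
apply: (bracket_fields (diff_monomial p J z j) (diff_monomial p Q z j)).
rewrite /mono /field -scalerBl scalerA; congr (_ *: _).
have m0 : monomial p (fun=> 0%N) z = 1 by rewrite /monomial big1// => l _; rewrite expr0.
have Qj : Q j = 2 by rewrite /Q /shiftmi eqxx.
have -> : monomial p (midec Q j 1) z = pcoord p j z.
  have <- : monomial p (shiftmi (fun=> 0%N) j 1) z = pcoord p j z.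
    by rewrite monomial_add m0 mulr1 expr1.
  apply: eq_bigr => l _; congr (_ ^+ _); rewrite /midec /Q /shiftmi.
  by case: eqP.
have mQ : monomial p Q z = pcoord p j z ^+ 2 by rewrite monomial_add m0 mulr1.
have mJ : pcoord p j z * monomial p (midec J j 1) z = monomial p J z.
  by rewrite midecK// Jj.
rewrite monomial_add expr1 mQ Qj Jj -mJ -(@natr1 _ a.+1) -(@natr1 _ a); ring.
Qed.

Lemma raising_mono J j : (2 <= \sum_i J i)%N -> raising gen (rho (mono J j)).2.
Proof.
case Ja : (\sum_i J i)%N => [|[|a]]// _.
by exists a.+1 => //; exact: weight_mono.
Qed.

(* Each step of the induction trades a bracket with a field of weight one for a
   letter, so that a monomial field of high degree is a sum of long words. *)
Lemma rho_mono_word m J j (s t : seq 'M[C]_r) : (m.+3 <= \sum_i J i)%N ->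
  (forall X, X \in s ++ t -> raising gen X) -> (r <= size s + size t + m.+1)%N ->
  mxword s *m (rho (mono J j)).2 *m mxword t = 0.
Proof.
elim: m J s t => [|m ih] J s t.
  move=> J3 st rs; have := @raising_word_eq0 _ _ gen (s ++ (rho (mono J j)).2 :: t).
  rewrite mxword_cat /= mulmxA; apply; first by move: rs; rewrite size_cat /= !(addnS, addn0).
  move=> X; rewrite mem_cat inE => /or3P[Xs|/eqP ->|Xt].
  - by apply: st; rewrite mem_cat Xs.
  - by apply: raising_mono; exact: ltnW.
  - by apply: st; rewrite mem_cat Xt orbT.
move=> J4 st rs.
have step J' Y : (m.+3 <= \sum_i J' i)%N -> raising gen Y ->
    mxword s *m (rho (mono J' j)).2 *m (Y *m mxword t) = 0 /\
    mxword s *m Y *m (rho (mono J' j)).2 *m mxword t = 0.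
  move=> J'3 gY; split.
    apply: (ih J' s (Y :: t) J'3) => /=; last by move: rs; rewrite !addnS addSn.
    move=> X; rewrite mem_cat inE => /or3P[Xs|/eqP ->//|Xt].
    - by apply: st; rewrite mem_cat Xs.
    - by apply: st; rewrite mem_cat Xt orbT.
  have := ih J' (rcons s Y) t J'3.
  rewrite -cats1 mxword_cat /= mulmx1; apply; last by move: rs; rewrite size_cat /= !addnS !addSn addn0.
  move=> X; rewrite !mem_cat inE => /orP[/orP[Xs|/eqP ->//]|Xt].
  - by apply: st; rewrite mem_cat Xs.
  - by apply: st; rewrite mem_cat Xt orbT.
have decK i : (0 < J i)%N -> shiftmi (midec J i 1) i 1 = J.
  move=> Ji; apply/funext => l; rewrite /shiftmi /midec.
  by case: eqP => [->|_]; rewrite ?mulr1n ?mulr0n ?subn0 ?addn0// subnK.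
have decS i : (0 < J i)%N -> (\sum_l midec J i 1 l = (\sum_l J l).-1)%N.
  move=> Ji; rewrite (bigD1 i)//= [in RHS](bigD1 i)//= /midec eqxx mulr1n.
  rewrite (eq_bigr J); first by lia.
  by move=> l /negbTE ->; rewrite mulr0n subn0.
have [[i ij Ji]|nJ] := pselect (exists2 i, i != j & (0 < J i)%N).
  pose a := (\sum_l J l - 2)%N.
  have Ja : (\sum_l midec J i 1 l = a.+1)%N by rewrite decS// /a; lia.
  have := rho_shift ij Ja; rewrite decK// => E1.
  have [|h1 h2] := step (midec J i 1) (rho (xeuler i)).2 _ (ex_intro2 _ _ 1%N isT (weight_xeuler i)).
    by rewrite Ja /a; lia.
  apply: (word_bracket _ E1 h1 h2); rewrite pnatr_eq0 /a; lia.
have J0 i : i != j -> J i = 0%N.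
  move=> ij; apply/eqP; rewrite -leqn0 leqNgt; apply/negP => Ji.
  by apply: nJ; exists i.
have Jj : J j = (\sum_l J l)%N by rewrite (bigD1 j)//= big1 ?addn0// => i /J0.
have Jj0 : (0 < J j)%N by rewrite Jj; lia.
pose a := (\sum_l J l - 3)%N.
have Ja : (\sum_l midec J j 1 l = a.+2)%N by rewrite decS// /a; lia.
have Jja : midec J j 1 j = a.+2 by rewrite /midec eqxx mulr1n Jj /a; lia.
have := rho_power Ja Jja; rewrite decK// => E1.
have [||h1 h2] := step (midec J j 1) (rho (mono (shiftmi (fun=> 0%N) j 2) j)).2.
- by rewrite Ja /a; lia.
- by apply: raising_mono; rewrite (bigD1 j)//= /shiftmi eqxx.
by apply: (word_bracket _ E1 h1 h2); rewrite pnatr_eq0 /a; lia.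
Qed.

Lemma rho_mono1 J j : (0 < \sum_i J i)%N -> (rho (mono J j)).2 = 0 -> rho (mono J j) = 0.
Proof.
move=> J0 h; have := rho_val (holomorphic_mono J j); rewrite mono_p//.
by case: (rho _) h => a b /= -> ->.
Qed.

(** Degree [r + 2] is the case [m = r - 1] of [rho_mono_word] with empty words on both sides; for
    [r = 0] the matrices are empty. *)
Lemma rho_mono_eq0 J j : (r.+2 <= \sum_i J i)%N -> rho (mono J j) = 0.
Proof.
move=> Jr; apply: rho_mono1; first by rewrite (leq_trans _ Jr).
have [r0|r0] := eqVneq r 0%N.
  by apply/matrixP => i; have := ltn_ord i; rewrite [X in (_ < X)%N]r0.
have := @rho_mono_word r.-1 J j [::] [::]; rewrite /= mul1mx mulmx1; apply=> //.
  by rewrite prednK// lt0n.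
by rewrite prednK// lt0n.
Qed.

Lemma rho_mono_line J j : r = 1%N -> (2 <= \sum_i J i)%N -> rho (mono J j) = 0.
Proof.
move=> r1 J2; apply: rho_mono1; first exact: ltnW.
have [a Ja] : exists a, (\sum_i J i = a.+2)%N by exists (\sum_i J i - 2)%N; lia.
have := weight_mono j Ja; rewrite /weight.
have -> : gen *m (rho (mono J j)).2 = (rho (mono J j)).2 *m gen.
  move: gen (rho _).2; rewrite r1 => A B.
  by rewrite [A]mx11_scalar [B]mx11_scalar -!scalar_mxM mulrC.
by rewrite subrr => /esym/eqP; rewrite scaler_eq0 pnatr_eq0 => /eqP.
Qed.

End Isotropy.

(** * Taylor expansion *)

Section Jets.
Variables (R : realType) (n : nat) (p : 'rV[Cx R]_n).
Local Notation C := (Cx R).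
Local Notation E := 'rV[C]_n.
Implicit Types (f g h : E -> C) (i j l : 'I_n) (J I : 'I_n -> nat) (z u : E).

Local Notation "f ~= g" := (\forall z \near p, f z = g z) (at level 70).

Lemma near_eq_refl f : f ~= f.
Proof. by apply: filterE. Qed.

Lemma near_eqW f g : (forall z, f z = g z) -> f ~= g.
Proof. by move=> fg; apply: filterE. Qed.

Lemma near_eq_sym f g : f ~= g -> g ~= f.
Proof. by apply: filterS => z ->. Qed.

Lemma near_eq_trans f g h : f ~= g -> g ~= h -> f ~= h.
Proof. by apply: filterS2 => z -> ->. Qed.

Lemma norm_entry_le z l : `|z 0 l| <= `|z|.
Proof.
rewrite -[leRHS]/(mx_norm z) mx_normE.
exact: (le_bigmax _ (fun i : 'I_1 * 'I_n => `|z i.1 i.2|%:nng) (0, l)).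
Qed.

Lemma norm_dmx_le l : `|dmx R l : E| <= 1.
Proof.
have [->//|/mx_norm_neq0[i e]] := eqVneq `|dmx R l : E| 0.
rewrite [leLHS]e /dmx mxE; case: (_ && _); by rewrite ?normr1 ?normr0.
Qed.

Definition partial l f z : C := 'D_(dmx R l) f z.

Lemma near_eq_partial l f g : f ~= g -> partial l f ~= partial l g.
Proof. by move=> /nbhs_interior; apply: filterS => z; exact: near_eq_derive. Qed.

Lemma partialE l f : holomorphic_at f p -> partial l f ~= fun z => 'd f z (dmx R l).
Proof. by apply: filterS => z df; exact: deriveE. Qed.

Lemma holomorphic_partial l f : holomorphic_at f p -> holomorphic_at (partial l f) p.
Proof.
move=> hf; apply: near_eq_holomorphic (holomorphic_diff (dmx R l) hf) _.
exact: near_eq_sym (partialE l hf).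
Qed.

(** The recursion of [mi_derive], to which it is convertible on [enum 'I_n], over an arbitrary list
    so that induction applies. *)
Definition partials (I : 'I_n -> nat) (s : seq 'I_n) f :=
  foldr (fun l g => iter (I l) (partial l) g) f s.

Lemma near_eq_iter l m f g : f ~= g -> iter m (partial l) f ~= iter m (partial l) g.
Proof. by move=> fg; elim: m => //= m ih; exact: near_eq_partial. Qed.

Lemma holomorphic_iter l m f : holomorphic_at f p ->
  holomorphic_at (iter m (partial l) f) p.
Proof. by move=> hf; elim: m => //= m ih; exact: holomorphic_partial. Qed.

Lemma holomorphic_partials I s f : holomorphic_at f p -> holomorphic_at (partials I s f) p.
Proof. by move=> hf; elim: s => //= l s ih; exact: holomorphic_iter. Qed.

Definition lin (c : C) f g z := c * f z + g z.

Lemma holomorphic_lin c f g : holomorphic_at f p -> holomorphic_at g p ->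
  holomorphic_at (lin c f g) p.
Proof.
move=> hf hg; apply: holomorphic_add hg; apply: holomorphic_mul hf.
by apply: filterE => z; exact: differentiable_cst.
Qed.

Lemma near_eq_lin c f f' g g' : f ~= f' -> g ~= g' -> lin c f g ~= lin c f' g'.
Proof. by apply: filterS2 => z; rewrite /lin => -> ->. Qed.

Lemma partial_lin l c f g : holomorphic_at f p -> holomorphic_at g p ->
  partial l (lin c f g) ~= lin c (partial l f) (partial l g).
Proof.
move=> hf hg; apply: near_eq_trans (partialE l (holomorphic_lin c hf hg)) _.
apply: near_eq_trans (near_eq_lin c (near_eq_sym (partialE l hf)) (near_eq_sym (partialE l hg))).
apply: filterS2 hf hg => z df dg.
by have [_ e] := has_diff_add (has_diff_scale c (conj df (erefl ('d f z (dmx R l)))))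
  (conj dg (erefl ('d g z (dmx R l)))).
Qed.

Lemma iter_lin l m c f g : holomorphic_at f p -> holomorphic_at g p ->
  iter m (partial l) (lin c f g) ~= lin c (iter m (partial l) f) (iter m (partial l) g).
Proof.
move=> hf hg; elim: m => [|m ih] /=; first exact: near_eq_refl.
apply: near_eq_trans (near_eq_partial l ih) _.
by apply: partial_lin; exact: holomorphic_iter.
Qed.

Lemma partials_lin I s c f g : holomorphic_at f p -> holomorphic_at g p ->
  partials I s (lin c f g) ~= lin c (partials I s f) (partials I s g).
Proof.
move=> hf hg; elim: s => [|l s ih] /=; first exact: near_eq_refl.
apply: near_eq_trans (near_eq_iter l _ ih) _.
by apply: iter_lin; exact: holomorphic_partials.
Qed.

Lemma partial_monomial l J :
  partial l (monomial p J) ~= fun z => (J l)%:R * monomial p (midec J l 1) z.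
Proof.
apply: filterE => z; have [d <-] := diff_monomial p J z l; exact: deriveE.
Qed.

Lemma iter_monomial l m J : iter m (partial l) (monomial p J) ~=
  fun z => (J l ^_ m)%:R * monomial p (midec J l m) z.
Proof.
elim: m => [|m ih].
  apply: near_eqW => z; rewrite /= ffactn0 mul1r; congr (monomial p _ z).
  by apply/funext => i; rewrite /midec mul0rn subn0.
apply: near_eq_trans (near_eq_partial l ih) _.
set c : C := (J l ^_ m)%:R; set J' := midec J l m.
have h0 : holomorphic_at (fun=> 0 : C) p by apply: filterE => z; exact: differentiable_cst.
have e : (fun z => c * monomial p J' z) = lin c (monomial p J') (fun=> 0).
  by apply/funext => z; rewrite /lin addr0.
rewrite e; apply: near_eq_trans (partial_lin l c (holomorphic_monomial p J') h0) _.
have p0 : partial l (fun=> 0 : C) ~= (fun=> 0).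
  by apply: near_eqW => z; exact: derive_cst.
apply: near_eq_trans (near_eq_lin c (partial_monomial l J') p0) _.
apply: near_eqW => z; rewrite /lin addr0 mulrA /c -natrM; congr (_%:R * monomial p _ z).
  by rewrite /J' /midec eqxx mulr1n ffactnSr.
apply/funext => i; rewrite /J' /midec; case: eqP => _; rewrite ?mulr1n ?mulr0n ?subn0//.
by rewrite subn1 subnS.
Qed.

Lemma partials_monomial I s J : uniq s -> partials I s (monomial p J) ~=
  fun z => (\prod_(l <- s) (J l ^_ I l))%:R *
    monomial p (fun l => if l \in s then J l - I l else J l)%N z.
Proof.
elim: s => [|l s ih] /=.
  by move=> _; apply: near_eqW => z; rewrite big_nil mul1r.
move=> /andP[ls /ih {}ih].
apply: near_eq_trans (near_eq_iter l (I l) ih) _.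
set c : C := (\prod_(_ <- _) _)%:R; set J' := fun l => _.
have h0 : holomorphic_at (fun=> 0 : C) p by apply: filterE => z; exact: differentiable_cst.
have e : (fun z => c * monomial p J' z) = lin c (monomial p J') (fun=> 0).
  by apply/funext => z; rewrite /lin addr0.
rewrite e; apply: near_eq_trans (iter_lin l _ c (holomorphic_monomial p J') h0) _.
have p0 m : iter m (partial l) (fun=> 0 : C) ~= (fun=> 0).
  elim: m => [|m ihm]; first exact: near_eq_refl.
  apply: near_eq_trans (near_eq_partial l ihm) _.
  by apply: near_eqW => z; exact: derive_cst.
apply: near_eq_trans (near_eq_lin c (iter_monomial l (I l) J') (p0 _)) _.
apply: near_eqW => z; rewrite /lin addr0 mulrA /c -natrM big_cons mulnC.
congr ((_ * _)%:R * monomial p _ z); first by rewrite /J' (negbTE ls).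
apply/funext => i; rewrite /J' /midec inE; case: eqP => [->|_] /=.
  by rewrite (negbTE ls) mulr1n.
by rewrite mulr0n subn0.
Qed.

(** Up to factorials the derivatives at [p] are dual to the centred monomials: too many derivatives
    give a vanishing falling factorial, too few leave a factor that is zero at [p]. *)
Lemma partials_monomial_p I J : partials I (enum 'I_n) (monomial p J) p =
  if [forall l, I l == J l] then (\prod_l (J l)`!)%:R else 0.
Proof.
rewrite (nbhs_singleton (partials_monomial I J (enum_uniq _))) big_enum /=.
case: ifPn => [/forallP IJ|/forallPn[l Il]].
  have e l : I l = J l by exact/eqP.
  rewrite /monomial [X in _ * X]big1 ?mulr1; last first.
    by move=> l _; rewrite mem_enum e subnn expr0.
  by congr _%:R; apply: eq_bigr => l _; rewrite e ffactnn.
have [JI|IJ|IJ] := ltngtP (J l) (I l); last by rewrite IJ eqxx in Il.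
  by rewrite (bigD1 l)//= ffact_small// mul0n mul0r.
rewrite monomial_p ?mulr0//; exists l; by rewrite mem_enum subn_gt0.
Qed.

(** Only derivatives along [i] lower the power of [pcoord i], each by at most one; the cofactor
    changes but stays holomorphic. *)
Lemma partial_power i l a h : holomorphic_at h p -> exists h',
  holomorphic_at h' p /\ partial l (fun z => pcoord p i z ^+ a * h z) ~=
    fun z => pcoord p i z ^+ (a - (l == i)) * h' z.
Proof.
move=> hh.
have hp m : holomorphic_at (fun z => pcoord p i z ^+ m) p.
  apply: filterE => z; exact: (has_diff_exp m (has_diff_pcoord p i z 0)).1.
have hdh := holomorphic_diff (dmx R l) hh.
have H : partial l (fun z => pcoord p i z ^+ a * h z) ~=
    fun z => pcoord p i z ^+ a * 'd h z (dmx R l) +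
      h z * (a%:R * pcoord p i z ^+ a.-1 * (l == i)%:R).
  apply: near_eq_trans (partialE l (holomorphic_mul (hp a) hh)) _.
  apply: filterS hh => z dh.
  have [_ e] := has_diff_mul (has_diff_exp a (has_diff_pcoord p i z (dmx R l)))
    (conj dh (erefl ('d h z (dmx R l)))).
  apply: (etrans e); by rewrite [dmx R l 0 i]mxE eqxx (eq_sym i).
case: eqP H => [->|_] H; last first.
  exists (fun z => 'd h z (dmx R l)); split; first exact: hdh.
  apply: near_eq_trans H _; apply: near_eqW => z.
  by rewrite !mulr0 addr0 subn0.
case: a H => [|a] H.
  exists (fun z => 'd h z (dmx R i)); split; first exact: (holomorphic_diff (dmx R i) hh).
  apply: near_eq_trans H _; apply: near_eqW => z.
  by rewrite sub0n mulr0n !mul0r mulr0 addr0.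
exists (fun z => pcoord p i z * 'd h z (dmx R i) + a.+1%:R * h z); split.
  apply: holomorphic_add; last exact: (holomorphic_scale a.+1%:R hh).
  exact: holomorphic_mul (hp 1%N) (holomorphic_diff (dmx R i) hh).
apply: near_eq_trans H _; apply: near_eqW => z.
by rewrite subn1 /= exprS; ring.
Qed.

Lemma partials_power I i a h : holomorphic_at h p -> (I i < a)%N ->
  partials I (enum 'I_n) (fun z => pcoord p i z ^+ a * h z) p = 0.
Proof.
move=> hh Ia.
have it l m b g : holomorphic_at g p -> exists h', holomorphic_at h' p /\
    iter m (partial l) (fun z => pcoord p i z ^+ b * g z) ~=
    fun z => pcoord p i z ^+ (b - m * (l == i)) * h' z.
  move=> hg; elim: m => [|m [h1 [hh1 e1]]].
    by exists g; split=> //; apply: near_eqW => z; rewrite mul0n subn0.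
  have [h2 [hh2 e2]] := partial_power i l (b - m * (l == i)) hh1.
  exists h2; split=> //; apply: near_eq_trans (near_eq_partial l e1) _.
  apply: near_eq_trans e2 _; apply: near_eqW => z.
  by rewrite -subnDA mulSn addnC.
have its s : uniq s -> exists h', holomorphic_at h' p /\
    partials I s (fun z => pcoord p i z ^+ a * h z) ~=
    fun z => pcoord p i z ^+ (a - I i * (i \in s)) * h' z.
  elim: s => [|l s ih] /=.
    by move=> _; exists h; split=> //; apply: near_eqW => z; rewrite muln0 subn0.
  move=> /andP[ls /ih[h1 [hh1 e1]]].
  have [h2 [hh2 e2]] := it l (I l) (a - I i * (i \in s))%N h1 hh1.
  exists h2; split=> //; apply: near_eq_trans (near_eq_iter l _ e1) _.
  apply: near_eq_trans e2 _; apply: near_eqW => z.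
  congr (_ ^+ _ * _); rewrite inE (eq_sym i); case: eqP => [<-|_] /=.
    by rewrite (negbTE ls) muln0 subn0.
  by rewrite muln0 subn0.
have [h' [_ e]] := its _ (enum_uniq 'I_n).
rewrite (nbhs_singleton e) pcoord_self mem_enum muln1 expr0n subn_eq0 leqNgt Ia.
by rewrite mul0r.
Qed.

End Jets.

Lemma holomorphic_comp (R : realType) (U V W : normedModType (Cx R))
    (g : U -> V) (f : V -> W) p :
  holomorphic_at g p -> holomorphic_at f (g p) -> holomorphic_at (f \o g) p.
Proof.
move=> hg hf; have /differentiable_continuous gc := nbhs_singleton hg.
have h : \forall z \near p, differentiable f (g z) by exact: gc hf.
by apply: filterS2 hg h => z dg df; exact: differentiable_comp dg df.
Qed.

Section TaylorFormula.
Variables (R : realType) (n r : nat) (p : 'rV[Cx R]_n).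
Local Notation C := (Cx R).
Local Notation E := 'rV[C]_n.
Variable rho : (E -> E) -> E * 'M[C]_r.
Hypothesis rho_lin : forall a v w, holomorphic_at v p -> holomorphic_at w p ->
  rho (fun z => a *: v z + w z) = a *: rho v + rho w.
Hypothesis rho_val : forall v, holomorphic_at v p -> (rho v).1 = v p.
Hypothesis rho_bracket : forall v w b, holomorphic_at v p -> holomorphic_at w p ->
  holomorphic_at b p -> v p = 0 -> w p = 0 ->
  (\forall z \near p, b z = 'd w z (v z) - 'd v z (w z)) ->
  (rho b).2 = (rho w).2 *m (rho v).2 - (rho v).2 *m (rho w).2.
Variable k : nat.
Hypothesis rho_mono0 : forall J j, (k < \sum_i J i)%N -> rho (mono p J j) = 0.

Implicit Types (f g h : E -> C) (i j l : 'I_n) (J : 'I_n -> nat) (z u : E) (S : {set 'I_n}).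

Definition powermi i a : 'I_n -> nat := shiftmi (fun=> 0%N) i a.

Lemma monomial_power i a z : monomial p (powermi i a) z = pcoord p i z ^+ a.
Proof.
by rewrite monomial_add [X in _ * X]big1 ?mulr1// => l _; rewrite expr0.
Qed.

Lemma sum_powermi i a : (\sum_l powermi i a l = a)%N.
Proof.
rewrite (bigD1 i)//= big1 ?addn0 /powermi /shiftmi ?eqxx ?mulr1n// => l /negbTE ->.
by rewrite mulr0n.
Qed.

Lemma holomorphic_pcoord_exp i a : holomorphic_at (fun z => pcoord p i z ^+ a) p.
Proof.
by apply: filterE => z; exact: (has_diff_exp a (has_diff_pcoord p i z 0)).1.
Qed.

(* The bracket of [x_i ^ a d_i] and [x_i ^ b h d_j]. *)
Lemma rho_power_bracket i j a b h : holomorphic_at h p -> (k < a)%N ->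
  rho (field (fun z => (b.+1%:R - a%:R * (i == j)%:R) * (pcoord p i z ^+ (a + b) * h z)
     + pcoord p i z ^+ (a + b.+1) * 'd h z (dmx R i)) j) = 0.
Proof.
move=> hh ka; set d : C := (i == j)%:R; set w := field _ j.
have a0 : (0 < a)%N by exact: leq_ltn_trans ka.
have hdh := holomorphic_diff (dmx R i) hh.
have hX m := holomorphic_pcoord_exp i m.
have hw : holomorphic_at w p.
  apply: holomorphic_field; apply: holomorphic_add.
    exact/holomorphic_scale/holomorphic_mul.
  exact: holomorphic_mul.
have wp : w p = 0.
  rewrite /w /field pcoord_self !expr0n addnS addn_eq0 (gtn_eqF a0) /=.
  by rewrite !mul0r mulr0 addr0 scale0r.
have w1 : (rho w).1 = 0 by rewrite rho_val.
suff w2 : (rho w).2 = 0 by move: w1 w2; case: (rho w) => ? ? /= -> ->.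
have r0 : rho (mono p (powermi i a) i) = 0 by apply: rho_mono0; rewrite sum_powermi.
have -> : (rho w).2 =
  (rho (field (fun z => pcoord p i z ^+ b.+1 * h z) j)).2 *m (rho (mono p (powermi i a) i)).2
  - (rho (mono p (powermi i a) i)).2 *m (rho (field (fun z => pcoord p i z ^+ b.+1 * h z) j)).2.
  apply: (rho_bracketE rho_bracket) => //.
  - exact: holomorphic_mono.
  - exact/holomorphic_field/holomorphic_mul.
  - by rewrite mono_p// sum_powermi.
  - by rewrite /field pcoord_self expr0n mul0r scale0r.
  apply: filterS hh => z dh.
  have df : has_diff (fun z => pcoord p i z ^+ b.+1 * h z) z (dmx R i)
    (pcoord p i z ^+ b.+1 * 'd h z (dmx R i) + h z * (b.+1%:R * pcoord p i z ^+ b * 1)).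
    have c1 : dmx R i 0 i = 1 :> C by rewrite mxE !eqxx.
    have := has_diff_exp b.+1 (has_diff_pcoord p i z (dmx R i)); rewrite c1 => e.
    exact: (has_diff_mul e (conj dh erefl)).
  have dg : has_diff (monomial p (powermi i a)) z (dmx R j) (a%:R * pcoord p i z ^+ a.-1 * d).
    rewrite (_ : monomial p _ = fun z => pcoord p i z ^+ a); last first.
      by apply/funext => y; exact: monomial_power.
    have c1 : dmx R j 0 i = d :> C by rewrite mxE eqxx.
    by have := has_diff_exp a (has_diff_pcoord p i z (dmx R j)); rewrite c1.
  apply: (bracket_fields df dg).
  rewrite /w /field monomial_power /d.
  case: eqP => [<-|_]; last first.
    by rewrite !mulr0 scale0r !subr0; congr (_ *: _); rewrite !exprD exprS; ring.
  rewrite -scalerBl; congr (_ *: _).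
  by case: a a0 {ka r0 dg w wp hw w1} => // a _; rewrite !exprD !exprS /=; ring.
by rewrite r0 /= mulmx0 mul0mx subrr.
Qed.

(* The brackets of [rho_power_bracket] for [(a, b) = (k + 1, 1)] and [(k + 2, 0)] have
   the same term in ['d h], and their difference is [1 + (i == j)] times this field. *)
Lemma rho_power_eq0 i j h : holomorphic_at h p ->
  rho (field (fun z => pcoord p i z ^+ k.+2 * h z) j) = 0.
Proof.
move=> hh; have hdh := holomorphic_diff (dmx R i) hh.
have hX m := holomorphic_pcoord_exp i m.
have := rho_power_bracket i j 1 hh (ltnSn k).
have := rho_power_bracket i j 0 hh (ltnW (ltnSn k.+1)).
set v := field _ j; set w := field _ j => v0 w0.
pose d : C := (i == j)%:R.
have d1 : 1 + d != 0 by rewrite /d; case: (i == j); rewrite -?natrD ?addr0 ?pnatr_eq0.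
apply: (scalerI d1); rewrite scaler0.
have hf : holomorphic_at (field (fun z => pcoord p i z ^+ k.+2 * h z) j) p.
  exact/holomorphic_field/holomorphic_mul.
have hF m1 m2 (c : C) : holomorphic_at (field (fun z => c * (pcoord p i z ^+ m1 * h z)
     + pcoord p i z ^+ m2 * 'd h z (dmx R i)) j) p.
  apply: holomorphic_field; apply: holomorphic_add; last exact: holomorphic_mul.
  exact/holomorphic_scale/holomorphic_mul.
rewrite -(rhoZ rho_lin _ hf).
have := rho_lin (-1) (hF _ _ _ : holomorphic_at v p) (hF _ _ _ : holomorphic_at w p).
rewrite v0 w0 scaler0 addr0 => <-; congr rho; apply/funext => z.
rewrite /v /w /field !scalerA -scalerDl; congr (_ *: _).
rewrite !addn0 addn1 addn2 addn1 /d -(@natr1 _ k.+1); ring.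
Qed.

Definition mfact J : C := (\prod_l (J l)`!)%:R.

Definition taylor_formula f j := rho (field f j) =
  \sum_(I : multiIndex n k | (mi_deg I <= k)%N)
    partials (fun l => I l : nat) (enum 'I_n) f p *:
      ((mfact (fun l => I l : nat))^-1 *: rho (mono p (fun l => I l : nat) j)).

Lemma taylor_lin c f g j : holomorphic_at f p -> holomorphic_at g p ->
  taylor_formula f j -> taylor_formula g j -> taylor_formula (lin c f g) j.
Proof.
move=> hf hg Tf Tg; rewrite /taylor_formula.
have -> : field (lin c f g) j = fun z => c *: field f j z + field g j z.
  by apply/funext => z; rewrite /field scalerA -scalerDl.
rewrite rho_lin; [|exact: holomorphic_field|exact: holomorphic_field].
rewrite Tf Tg scaler_sumr -big_split; apply: eq_bigr => I _ /=.
rewrite (nbhs_singleton (partials_lin _ (enum 'I_n) c hf hg)) /lin.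
by rewrite scalerDl scalerA.
Qed.

(** Above degree [k] both sides vanish; otherwise only the index [I = J] survives and its factorial
    cancels [mfact]. *)
Lemma taylor_monomial J j : taylor_formula (monomial p J) j.
Proof.
rewrite /taylor_formula; under eq_bigr do rewrite partials_monomial_p.
have [kJ|Jk] := ltnP k (\sum_i J i).
  rewrite [LHS](rho_mono0 j kJ) big1// => I Ik; case: ifP => [/forallP IJ|]; last first.
    by rewrite scale0r.
  suff : mi_deg I = (\sum_i J i)%N by move=> IJs; move: kJ; rewrite -IJs ltnNge Ik.
  by apply: eq_bigr => l _; exact/eqP.
have Jlt l : (J l < k.+1)%N.
  by rewrite ltnS (leq_trans _ Jk)// (bigD1 l)//= leq_addr.
pose I0 : multiIndex n k := [ffun l => Ordinal (Jlt l)].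
have I0E l : I0 l = J l :> nat by rewrite ffunE.
have I0k : (mi_deg I0 <= k)%N.
  by rewrite /mi_deg (eq_bigr (fun l => J l))// => l _; rewrite I0E.
rewrite (bigD1 I0)//= [X in _ = _ + X]big1 ?addr0; last first.
  move=> I /andP[_ II0]; case: ifP => [/forallP IJ|]; last by rewrite scale0r.
  case/eqP: II0; apply/ffunP => l; apply/val_inj; rewrite /= I0E; exact/eqP.
have -> : (fun l => I0 l : nat) = J by apply/funext => l; rewrite I0E.
rewrite (_ : [forall l, I0 l == J l :> nat]); last by apply/forallP => l; rewrite I0E.
rewrite scalerA mulfV ?scale1r// pnatr_eq0.
by rewrite -lt0n prodn_gt0// => l; rewrite fact_gt0.
Qed.

(* The projection setting the coordinates in [S] to those of [p]. *)
Definition freeze (S : {set 'I_n}) z : E :=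
  p + \sum_l (if l \in S then 0 else pcoord p l z) *: dmx R l.

Lemma pcoord_freeze S i z : pcoord p i (freeze S z) = if i \in S then 0 else pcoord p i z.
Proof.
rewrite {1}/pcoord /freeze mxE addrAC subrr add0r summxE (bigD1 i)//= big1 ?addr0.
  by rewrite /dmx !mxE !eqxx mulr1.
by move=> l /negbTE li; rewrite !mxE eq_sym li andbF mulr0.
Qed.

Lemma freezeU S i z : i \notin S ->
  freeze (i |: S)%SET z = freeze S z - pcoord p i (freeze S z) *: dmx R i.
Proof.
move=> iS; rewrite pcoord_freeze (negbTE iS) /freeze -addrA; congr (_ + _).
rewrite (bigD1 i)//= finset.setU11 scale0r add0r [in RHS](bigD1 i)//= (negbTE iS).
rewrite addrAC subrr add0r; apply: eq_bigr => l li.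
by rewrite !inE (negbTE li).
Qed.

Lemma freeze_set0 z : freeze finset.set0 z = z.
Proof.
apply/rowP => i; have := pcoord_freeze finset.set0 i z; rewrite inE /pcoord.
exact: addIr.
Qed.

Lemma freezeT z : freeze finset.setT z = p.
Proof. by rewrite /freeze big1 ?addr0// => l _; rewrite inE scale0r. Qed.

Lemma freeze_p S : freeze S p = p.
Proof.
by rewrite /freeze big1 ?addr0// => l _; rewrite pcoord_self if_same scale0r.
Qed.

Lemma differentiable_freeze S z : differentiable (freeze S) z.
Proof.
have d1 l : differentiable (fun z => (if l \in S then 0 else pcoord p l z) *: dmx R l : E) z.
  apply: differentiableZl; case: (l \in S); first exact: differentiable_cst.
  exact: (has_diff_pcoord p l z 0).1.
have := differentiableD (differentiable_cst p z) (differentiable_sum d1).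
rewrite (_ : _ + _ = freeze S)//.
by apply/funext => w; rewrite !fctE fct_sumE.
Qed.

Lemma holomorphic_freeze S f : holomorphic_at f p -> holomorphic_at (f \o freeze S) p.
Proof.
move=> hf; apply: holomorphic_comp; last by rewrite freeze_p.
by apply: filterE => z; exact: differentiable_freeze.
Qed.

(* Induction on the number of coordinates that [g] still depends on: Hadamard's lemma
   freezes one more coordinate [i] at the cost of a remainder divisible by a power
   of [pcoord i] as high as needed for [rho_power_eq0]. *)
Lemma taylor_holomorphic f j : holomorphic_at f p -> taylor_formula f j.
Proof.
move=> hf.
suff H m S J g : (#|(~: S)%SET| <= m)%N -> holomorphic_at g p ->
    taylor_formula (fun z => monomial p J z * g (freeze S z)) j.
  have := H _ finset.set0 (fun=> 0%N) f (leqnn _) hf; congr (taylor_formula _ _).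
  by apply/funext => z; rewrite freeze_set0 [X in X * _]big1 ?mul1r// => l _; rewrite expr0.
elim: m S J g => [|m ih] S J g.
  rewrite leqn0 cards_eq0 => /eqP ST hg.
  have {ST} -> : S = finset.setT by rewrite -[S]finset.setCK ST finset.setC0.
  (* All coordinates are frozen, so the coefficient is the constant [g p] times the monomial,
     written as [g p - 1] copies plus one to fit [lin]. *)
  have := taylor_lin (g p - 1) (holomorphic_monomial p J) (holomorphic_monomial p J)
    (taylor_monomial J j) (taylor_monomial J j).
  congr (taylor_formula _ _); apply/funext => z; rewrite /lin freezeT; ring.
have [S0|nS0] := eqVneq (~: S)%SET finset.set0.
  by move=> _; apply: ih; rewrite S0 cards0.
have [i0 iS0] : exists i, i \in (~: S)%SET.
  apply: contrapT => /forallNP h; case/eqP: nS0; apply/finset.setP => i.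
  by rewrite finset.in_set0; apply/negbTE/negP; exact: h.
move: i0 iS0 => i; rewrite inE => iS Sm.
have hmul J' S' g' : holomorphic_at g' p ->
    holomorphic_at (fun z => monomial p J' z * g' (freeze S' z)) p.
  by move=> hg'; exact: holomorphic_mul (holomorphic_monomial p J') (holomorphic_freeze S' hg').
(* The left side vanishes by [rho_power_eq0], the right side because at most [k] derivatives leave a
   positive power of [pcoord i]. *)
have terminal J' g' : (k.+2 <= J' i)%N -> holomorphic_at g' p ->
    taylor_formula (fun z => monomial p J' z * g' (freeze S z)) j.
  move=> kJ hg'; pose h z := monomial p (midec J' i k.+2) z * g' (freeze S z).
  have hh : holomorphic_at h p by exact: hmul.
  have -> : (fun z => monomial p J' z * g' (freeze S z)) =
      fun z => pcoord p i z ^+ k.+2 * h z.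
    apply/funext => z; rewrite /h mulrA -monomial_add; congr (monomial p _ z * _).
    apply/funext => l; rewrite /shiftmi /midec.
    by case: eqP => [->|_]; rewrite ?mulr1n ?mulr0n ?subn0 ?addn0// subnK.
  rewrite /taylor_formula rho_power_eq0// big1// => I _.
  by rewrite partials_power ?scale0r//; exact: ltn_trans (ltn_ord _) _.
(* Inner induction on the missing exponent: each use of [hadamard] raises the power of [pcoord i] by
   one and leaves a term with [i] frozen to the outer induction. *)
suff H d J' g' : (k.+2 - J' i <= d)%N -> holomorphic_at g' p ->
    taylor_formula (fun z => monomial p J' z * g' (freeze S z)) j.
  by apply: H; exact: leqnn.
elim: d J' g' => [|d ihd] J' g'.
  by rewrite leqn0 subn_eq0; exact: terminal.
have [kJ _|Jk Jd hg'] := leqP k.+2 (J' i); first exact: terminal.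
have dpc z : differentiable (pcoord p i) z by exact: (has_diff_pcoord p i z 0).1.
have pcn z : `|pcoord p i z| <= `|z - p|.
  by have := norm_entry_le (z - p) i; rewrite !mxE.
have [h [hh gE]] := hadamard hg' dpc pcn (norm_dmx_le R i).
have := taylor_lin 1 (hmul J' (i |: S)%SET _ hg') (hmul (shiftmi J' i 1) S _ hh).
rewrite (_ : lin _ _ _ = fun z => monomial p J' z * g' (freeze S z)); last first.
  apply/funext => z; rewrite /lin mul1r freezeU// monomial_add expr1.
  by rewrite [in RHS]gE pcoord_freeze (negbTE iS); ring.
apply; last first.
  by apply: ihd => //; rewrite /shiftmi eqxx mulr1n; lia.
apply: (ih (i |: S)%SET J' _ _ hg'); rewrite (_ : (~: (i |: S) = ~: S :\ i)%SET).
  by move: Sm; rewrite (cardsD1 i) inE iS.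
by apply/finset.setP => l; rewrite !inE negb_or.
Qed.

End TaylorFormula.

(** * Charts and jets of the Lie map *)

Section Vectorial.
Variables (R : realType) (n : nat).
Local Notation C := (Cx R).
Local Notation E := 'rV[C]_n.

Lemma has_diff_sum (K : numFieldType) (U W : normedModType K) (I : Type) (s : seq I)
    (f : I -> U -> W) z u (a : I -> W) : (forall i, has_diff (f i) z u (a i)) ->
  has_diff (fun z => \sum_(i <- s) f i z) z u (\sum_(i <- s) a i).
Proof.
move=> h; elim: s => [|i s ih].
  rewrite big_nil (_ : (fun z => _) = fun=> 0); first exact: has_diff_cst.
  by apply/funext => t; rewrite big_nil.
rewrite big_cons (_ : (fun z => _) = fun z => f i z + \sum_(i <- s) f i z).
  exact: has_diff_add (h i) ih.
by apply/funext => t; rewrite big_cons.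
Qed.

Lemma holomorphic_sum (U W : normedModType C) (I : Type) (s : seq I)
    (f : I -> U -> W) p : (forall i, holomorphic_at (f i) p) ->
  holomorphic_at (fun z => \sum_(i <- s) f i z) p.
Proof.
move=> h; elim: s => [|i s ih].
  rewrite (_ : (fun z => _) = fun=> 0).
    by apply: filterE => z; exact: differentiable_cst.
  by apply/funext => t; rewrite big_nil.
rewrite (_ : (fun z => _) = fun z => f i z + \sum_(i <- s) f i z).
  exact: holomorphic_add (h i) ih.
by apply/funext => t; rewrite big_cons.
Qed.

Lemma rV_decomp (u : E) : u = \sum_l u 0 l *: dmx R l.
Proof. exact: row_sum_delta. Qed.

Lemma has_diff_coord (l : 'I_n) (z u : E) : has_diff (fun z : E => z 0 l : C) z u (u 0 l).
Proof.
have := has_diff_pcoord (0 : E) l z u; congr (has_diff _ _ _ _).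
by apply/funext => w; rewrite /pcoord mxE subr0.
Qed.

Lemma has_diff_comp (K : numFieldType) (T U W : normedModType K) (g : T -> U)
    (f : U -> W) z u a b : has_diff g z u a -> has_diff f (g z) a b ->
  has_diff (fun z => f (g z)) z u b.
Proof.
move=> [dg <-] [df <-].
have [d e] := is_diff_comp (differentiableP dg) (differentiableP df).
by split; [exact: d|exact: (congr1 (fun F => F u) e)].
Qed.

Lemma holomorphic_coord (U : normedModType C) (w : U -> E) l p : holomorphic_at w p ->
  holomorphic_at (fun z => w z 0 l : C) p.
Proof.
move=> hw; apply: (holomorphic_comp hw (f := fun z : E => z 0 l : C)).
by apply: filterE => z; have [] := has_diff_coord l z 0.
Qed.

Lemma holomorphic_of_coord (U : normedModType C) (w : U -> E) p :
  (forall l, holomorphic_at (fun z => w z 0 l : C) p) -> holomorphic_at w p.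
Proof.
move=> hw; rewrite (_ : w = fun z => \sum_l w z 0 l *: dmx R l); last first.
  by apply/funext => z; exact: rV_decomp.
apply: holomorphic_sum => l; move: (hw l); apply: filterS => z.
exact: differentiableZl.
Qed.

Lemma diff_decomp (f : E -> C) z u : 'd f z u = \sum_l u 0 l * 'd f z (dmx R l).
Proof.
rewrite {1}(rV_decomp u) linear_sum; apply: eq_bigr => l _; exact: diff_homog.
Qed.

(** Product rule in [f] and [w]. Symmetry of second derivatives frees [u] to be the inner direction,
    the form in which these terms cancel in brackets. *)
Lemma has_diff_diff (f : E -> C) (w : E -> E) z u : holomorphic_at f z ->
  differentiable w z -> has_diff (fun z => 'd f z (w z)) z u
    ('d (fun z => 'd f z u) z (w z) + 'd f z ('d w z u)).
Proof.
move=> hf dw.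
rewrite (_ : (fun z => _) = fun z => \sum_l w z 0 l * 'd f z (dmx R l)); last first.
  by apply/funext => t; exact: diff_decomp.
apply: has_diff_eq.
  apply: has_diff_sum => l; apply: has_diff_mul.
    exact: has_diff_comp (conj dw (erefl ('d w z u))) (has_diff_coord l _ _).
  exact: conj (differentiable_diff (dmx R l) hf) (erefl ('d (fun z => 'd f z (dmx R l)) z u)).
rewrite big_split; congr (_ + _).
  apply: (etrans _ (esym (diff_decomp _ _ _))); apply: eq_bigr => l _.
  by congr (_ * _); exact: diff_diffC.
apply: (etrans _ (esym (diff_decomp _ _ _))); apply: eq_bigr => l _.
exact: mulrC.
Qed.

Lemma holomorphic_diff_field (f : E -> C) (w : E -> E) p : holomorphic_at f p ->
  holomorphic_at w p -> holomorphic_at (fun z => 'd f z (w z)) p.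
Proof.
move=> /nbhs_interior hf hw; apply: filterS2 hf hw => z hfz dw.
by have [] := has_diff_diff 0 hfz dw.
Qed.

Lemma diff_coord (F : E -> E) z u l : differentiable F z ->
  'd F z u 0 l = 'd (fun z => F z 0 l : C) z u.
Proof.
move=> dF; have [_ e] := has_diff_comp (conj dF (erefl ('d F z u))) (has_diff_coord l _ _).
exact: esym e.
Qed.

Lemma holomorphic_diff_map (F w : E -> E) p : holomorphic_at F p ->
  holomorphic_at w p -> holomorphic_at (fun z => 'd F z (w z)) p.
Proof.
move=> hF hw; apply: holomorphic_of_coord => l.
have := holomorphic_diff_field (holomorphic_coord l hF) hw.
move=> /near_eq_holomorphic; apply.
by apply: filterS hF => z dF; exact/esym/diff_coord.
Qed.

End Vectorial.

(** * Changes of charts *)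

Section Charts.
Variables (R : realType) (n : nat) (M : complexManifold R n).
Local Notation C := (Cx R).
Local Notation E := 'rV[C]_n.
Implicit Types (b c : atlas M) (x y : M).

Lemma near_chart c y (U : set M) : open U -> U y -> dom c y ->
  \forall z \near chart c y, [/\ U (chartV c z), dom c (chartV c z) & chart c (chartV c z) = z].
Proof.
move=> Uo Uy cy.
have h1 : \forall z \near chart c y, U (chartV c z).
  apply: (chartV_continuous cy); rewrite /= chartK//; exact: open_nbhs_nbhs.
have h2 : \forall z \near chart c y, [set chart c w | w in dom c] z.
  by apply: open_nbhs_nbhs; split; [exact: open_chart|exists y].
by apply: filterS2 h1 h2 => z Uz [w cw wz]; rewrite -wz chartK// -{1}(chartK cw) wz.
Qed.

Lemma transition_holomorphic_at c b y : dom c y -> dom b y ->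
  holomorphic_at (chart b \o chartV c) (chart c y).
Proof.
move=> cy by_; have := near_chart (open_dom b) by_ cy.
apply: filterS => z [bz cz e]; rewrite -e; exact: (transition_holomorphic cz bz).
Qed.

Lemma near_transition (T : Type) (f : M -> T) c b y : dom c y -> dom b y ->
  \forall z \near chart b y, (f \o chartV c) ((chart c \o chartV b) z) = (f \o chartV b) z.
Proof.
move=> cy by_; have := near_chart (open_dom c) cy by_.
by apply: filterS => z [cz bz _] /=; rewrite chartK.
Qed.

Lemma has_diff_transition (W : normedModType C) (f : M -> W) c b y u a :
  dom c y -> dom b y ->
  has_diff (f \o chartV c) (chart c y) ('d (chart c \o chartV b) (chart b y) u) a ->
  has_diff (f \o chartV b) (chart b y) u a.
Proof.
move=> cy by_ hf; apply: near_eq_has_diff (near_transition f cy by_) _.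
have dt := transition_holomorphic by_ cy.
apply: has_diff_comp (conj dt (erefl ('d (chart c \o chartV b) (chart b y) u))) _.
by rewrite /= chartK.
Qed.

Lemma holomorphic_on_chart (W : normedModType C) (U : set M) (f : M -> W) c :
  U `<=` dom c -> (forall y, U y -> differentiable (f \o chartV c) (chart c y)) ->
  holomorphic_on U f.
Proof.
move=> Uc df b y Uy by_.
have := has_diff_transition (Uc _ Uy) by_ (conj (df y Uy) (erefl ('d (f \o chartV c) (chart c y)
  ('d (chart c \o chartV b) (chart b y) 0)))).
by case.
Qed.

Lemma holomorphic_on_at (W : normedModType C) (U : set M) (f : M -> W) c y :
  open U -> holomorphic_on U f -> U y -> dom c y -> holomorphic_at (f \o chartV c) (chart c y).
Proof.
move=> Uo hf Uy cy; have := near_chart Uo Uy cy.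
apply: filterS => z [Uz cz e]; rewrite -e; exact: (hf _ _ Uz cz).
Qed.

End Charts.

Section VectorFields.
Variables (R : realType) (n : nat) (M : complexManifold R n).
Local Notation C := (Cx R).
Local Notation E := 'rV[C]_n.
Local Notation TM := (tangentBundle M).
Implicit Types (b c : atlas M) (x y : M).

Lemma has_diff_chart c y (u : E) : dom c y -> has_diff (chart c \o chartV c) (chart c y) u u.
Proof.
move=> cy; apply: near_eq_has_diff (has_diff_id (chart c y) u).
have := near_chart (open_dom c) cy cy.
by apply: filterS => z [_ _ e]; exact: esym e.
Qed.

(** Tangent vectors at [y] are stored in the chart [chart_at y]; passing through it composes two
    Jacobians, and the chain rule removes the intermediate chart. *)
Lemma tangent_tmap_tinv b c y (u : E) : dom b y -> dom c y ->
  @tmap _ _ _ _ TM b y (@tinv _ _ _ _ TM c y u) = 'd (chart b \o chartV c) (chart c y) u.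
Proof.
move=> by_ cy; have c0 := mem_chart_at y.
have dt := transition_holomorphic c0 by_.
have [_ e] := has_diff_transition c0 cy
  (conj dt (erefl ('d (chart b \o chartV (chart_at y)) (chart (chart_at y) y)
     ('d (chart (chart_at y) \o chartV c) (chart c y) u)))).
exact: esym e.
Qed.

Lemma tangent_tinvK c y : dom c y -> cancel (@tinv _ _ _ _ TM c y) (@tmap _ _ _ _ TM c y).
Proof.
by move=> cy u; rewrite tangent_tmap_tinv//; have [_] := has_diff_chart u cy.
Qed.

Lemma tangent_tmapK c y : dom c y -> cancel (@tmap _ _ _ _ TM c y) (@tinv _ _ _ _ TM c y).
Proof.
move=> cy u; have c0 := mem_chart_at y.
have dt := transition_holomorphic cy c0.
have [_ e] := has_diff_transition cy c0
  (conj dt (erefl ('d (chart (chart_at y) \o chartV c) (chart c y)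
     ('d (chart c \o chartV (chart_at y)) (chart (chart_at y) y) u)))).
have [_ e'] := has_diff_chart u c0.
exact: etrans (esym e) e'.
Qed.

Lemma vf_act_chart c (v : forall x, TM x) (f : M -> C) y : dom c y ->
  differentiable (f \o chartV c) (chart c y) ->
  vf_act v f y = 'd (f \o chartV c) (chart c y) (@tmap _ _ _ _ TM c y (v y)).
Proof.
move=> cy df; have c0 := mem_chart_at y.
have [_ e] := has_diff_transition cy c0
  (conj df (erefl ('d (f \o chartV c) (chart c y)
     ('d (chart c \o chartV (chart_at y)) (chart (chart_at y) y) (v y))))).
exact: e.
Qed.

Section Field.
Variables (c : atlas M) (W : opens M) (Wc : W `<=` dom c) (w : E -> E).
Hypothesis hw : forall y, W y -> holomorphic_at w (chart c y).

Lemma is_section_vf : is_section W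
  (restr_fun (E := TM) W (fun y => @tinv _ _ _ _ TM c y (w (chart c y)))).
Proof.
apply: is_section_restr => b.
apply: (@holomorphic_on_chart _ _ _ _ _ _ c); first by move=> y [/Wc].
move=> y [Wy by_]; have cy := Wc Wy.
have h := holomorphic_diff_map (transition_holomorphic_at cy by_) (hw Wy).
apply: near_eq_differentiable _ (nbhs_singleton h).
have Wb : open (W `&` dom b) by apply: openI; [exact: openP|exact: open_dom].
have := near_chart Wb (conj Wy by_) cy.
apply: filterS => z [[Wz bz] cz e].
by apply: esym; apply: etrans (tangent_tmap_tinv _ bz cz) _; rewrite e.
Qed.

Definition chart_vf : sect TM W := Sect is_section_vf.

Lemma vf_coord_chart_vf y : W y -> vf_coord c chart_vf y = w (chart c y).
Proof.
move=> Wy; rewrite /vf_coord /= /restr_fun; case: asboolP => // _.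
exact: tangent_tinvK (Wc Wy) _.
Qed.

End Field.

Lemma vf_coord_inj c (W : opens M) (v w : sect TM W) : W `<=` dom c ->
  (forall y, W y -> vf_coord c v y = vf_coord c w y) -> v = w.
Proof.
move=> Wc vw; apply: sect_ext => y.
have [Wy|nWy] := pselect (W y); last by rewrite (sectP v).2 // (sectP w).2.
exact: can_inj (tangent_tmapK (Wc _ Wy)) _ _ (vw y Wy).
Qed.

Lemma vf_coord_restr c (W U : opens M) (WU : W `<=` U) (v : sect TM U) y : W y ->
  vf_coord c (restr WU v) y = vf_coord c v y.
Proof. by move=> Wy; rewrite /vf_coord /= /restr_fun; case: asboolP. Qed.

(** The second derivatives of [f] in the two iterated actions cancel by [diff_diffC], which leaves
    the first order part. *)
Lemma vf_bracket_chart c (U : opens M) (v w b : sect TM U) (v' w' : E -> E) :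
  U `<=` dom c ->
  (forall y, U y -> holomorphic_at v' (chart c y)) ->
  (forall y, U y -> holomorphic_at w' (chart c y)) ->
  (forall y, U y -> vf_coord c v y = v' (chart c y)) ->
  (forall y, U y -> vf_coord c w y = w' (chart c y)) ->
  (forall y, U y -> vf_coord c b y =
     'd w' (chart c y) (v' (chart c y)) - 'd v' (chart c y) (w' (chart c y))) ->
  is_vf_bracket v w b.
Proof.
move=> Uc hv hw cv cw cb W f WU hf y Wy.
have Uy := WU _ Wy; have cy := Uc _ Uy; set p := chart c y.
pose F := f \o chartV c.
have hF : holomorphic_at F p by exact: holomorphic_on_at (openP W) hf Wy cy.
have act (u : sect TM U) (u' : E -> E) : (forall y, U y -> vf_coord c u y = u' (chart c y)) ->
    \forall z \near p, 'd F z (u' z) = (vf_act u f \o chartV c) z.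
  move=> cu; have := near_chart (openP W) Wy cy.
  apply: filterS2 (nbhs_interior hF) => z /nbhs_singleton dF [Wz cz e].
  rewrite -e in dF; apply: esym; apply: etrans (vf_act_chart u cz dF) _.
  by rewrite -/(vf_coord c u (chartV c z)) cu ?e//; exact: WU.
have [dv dw] := (nbhs_singleton (hv y Uy), nbhs_singleton (hw y Uy)).
have h1 : has_diff (vf_act w f \o chartV c) p (v' p)
    ('d (fun z => 'd F z (v' p)) p (w' p) + 'd F p ('d w' p (v' p))).
  apply: near_eq_has_diff (act w w' cw) _; exact: has_diff_diff.
have h2 : has_diff (vf_act v f \o chartV c) p (w' p)
    ('d (fun z => 'd F z (w' p)) p (v' p) + 'd F p ('d v' p (w' p))).
  apply: near_eq_has_diff (act v v' cv) _; exact: has_diff_diff.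
rewrite (vf_act_chart v cy h1.1) (vf_act_chart w cy h2.1).
rewrite (vf_act_chart b cy (nbhs_singleton hF)).
rewrite -/(vf_coord c v y) -/(vf_coord c w y) -/(vf_coord c b y) cv// cw// cb//.
have [_ e1] := h1; have [_ e2] := h2.
apply: (etrans _ (congr2 (fun s t : C => s - t) (esym e1) (esym e2))).
have aux (s t d1 d2 d : C) : s = t -> d = d1 - d2 -> d = s + d1 - (t + d2).
  by move=> -> ->; ring.
exact: (aux _ _ _ _ _ (diff_diffC (v' p) (w' p) hF) (linearB _ _ _)).
Qed.

End VectorFields.

(** * Coordinates on the Atiyah algebra *)

Section AtiyahCoordinates.
Variables (R : realType) (n : nat) (M : complexManifold R n) (r : nat).
Variables (V : vectorBundle M r) (c : atlas M) (a : triv V).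
Local Notation C := (Cx R).
Local Notation E := 'rV[C]_n.
Local Notation TM := (tangentBundle M).
Implicit Types (U W : opens M) (y : M).

Lemma at_coord_lin W (Wa : W `<=` tdom a) (k : C) (A B : atiyah V W) y :
  at_coord c Wa (k *: A + B) y = k *: at_coord c Wa A y + at_coord c Wa B y.
Proof.
apply: (@eq_trans _ _ (k *: vf_coord c (symbol A) y + vf_coord c (symbol B) y,
  k *: (at_coord c Wa A y).2 + (at_coord c Wa B y).2)) => //.
congr (_, _); first exact: linearP.
apply/row_matrixP => i; rewrite [RHS]linearP /= !rowK.
exact: linearP.
Qed.

Lemma frame_restr U W (Ua : U `<=` tdom a) (Wa : W `<=` tdom a) (WU : W `<=` U) i :
  restr WU (frame Ua i) = frame Wa i.
Proof.
apply: sect_ext => y /=; rewrite /restr_fun; case: asboolP => // Wy.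
by case: asboolP => // nUy; case: nUy; exact: WU.
Qed.

Lemma at_coord_restr U W (Ua : U `<=` tdom a) (Wa : W `<=` tdom a) (WU : W `<=` U)
    (A : atiyah V U) y : W y ->
  at_coord c Wa (at_restr WU A) y = at_coord c Ua A y.
Proof.
move=> Wy; congr (_, _); first exact: vf_coord_restr.
apply/matrixP => i j; rewrite !mxE /= -(frame_restr Ua Wa WU).
rewrite (at_op_restr A (@subset_refl _ U) _ WU) /= /restr_fun.
by case: asboolP.
Qed.

Lemma sect_sumE U (I : Type) (s : seq I) (f : I -> sect V U) y :
  (\sum_(i <- s) f i) y = \sum_(i <- s) f i y.
Proof.
elim: s => [|i s ih]; first by rewrite !big_nil.
by rewrite !big_cons -ih.
Qed.

Lemma at_op_sum U W (WU : W `<=` U) (A : atiyah V U) (I : Type) (s : seq I)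
    (f : I -> sect V W) :
  at_op A WU (\sum_(i <- s) f i) = \sum_(i <- s) at_op A WU (f i).
Proof.
have op0 : at_op A WU 0 = 0.
  have := at_op_linear A WU (-1) 0 0; rewrite !scaleN1r oppr0 addr0 => ->.
  by rewrite addNr.
elim: s => [|i s ih]; first by rewrite !big_nil.
rewrite !big_cons -ih; have := at_op_linear A WU 1 (f i) (\sum_(i <- s) f i).
by rewrite !scale1r.
Qed.

Section Components.
Variables (W : opens M) (Wa : W `<=` tdom a) (s : sect V W).

Definition component i y : C := tmap a y (s y) 0 i.

Lemma holomorphic_component i : holomorphic_on W (component i).
Proof.
move=> b y Wy by_; have := (sectP s).1 a b y (conj Wy (Wa Wy)) by_.
move=> h.
have [] := has_diff_comp (conj h (erefl ('d _ _ 0))) (has_diff_coord i _ _).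
by [].
Qed.

Lemma sect_frame_decomp :
  s = \sum_i fsect (holomorphic_component i) (frame Wa i).
Proof.
apply: sect_ext => y; rewrite sect_sumE.
have [Wy|nWy] := pselect (W y); last first.
  rewrite (sectP s).2// big1// => i _ /=; rewrite /restr_fun.
  by case: asboolP => // _; rewrite scaler0.
apply: (can_inj (tmapK (Wa Wy))); rewrite linear_sum.
rewrite [LHS]row_sum_delta; apply: eq_bigr => i _ /=.
rewrite /restr_fun; case: asboolP => // _.
by rewrite linearZ /= tinvK//; exact: Wa.
Qed.

(** Where the symbol vanishes the Leibniz rule loses its derivative term, so the operator acts on
    the fibre, by right multiplication on row coordinates. *)
Lemma tmap_at_op (A : atiyah V W) y : W y -> symbol A y = 0 ->
  tmap a y (at_op A (@subset_refl _ W) s y) = tmap a y (s y) *m (at_coord c Wa A y).2.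
Proof.
move=> Wy Ay; rewrite {1}sect_frame_decomp at_op_sum sect_sumE linear_sum.
rewrite mulmx_sum_row; apply: eq_bigr => i _.
rewrite at_op_leibniz// /vf_act Ay linear0 scale0r addr0 linearZ /=.
by congr (_ *: _); rewrite rowK.
Qed.

End Components.

(** The image of a frame section under [B] is acted on by the matrix of [A] from the right, hence
    the reversed products. *)
Lemma at_coord_bracket W (Wa : W `<=` tdom a) (A B D : atiyah V W) y : W y ->
  is_at_bracket A B D -> symbol A y = 0 -> symbol B y = 0 ->
  (at_coord c Wa D y).2 = (at_coord c Wa B y).2 *m (at_coord c Wa A y).2 -
    (at_coord c Wa A y).2 *m (at_coord c Wa B y).2.
Proof.
move=> Wy [_ AB] Ay By; apply/row_matrixP => i; rewrite rowK AB linearB /=.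
rewrite scaleN1r [LHS]linearB /=.
rewrite (tmap_at_op Wa (at_op B _ (frame Wa i)) Wy Ay).
by rewrite (tmap_at_op Wa (at_op A _ (frame Wa i)) Wy By) !row_mul !rowK.
Qed.

Lemma holomorphic_at_coord W (Wa : W `<=` tdom a) (A : atiyah V W) : W `<=` dom c ->
  holomorphic_on W (at_coord c Wa A).
Proof.
move=> Wc b y Wy by_.
have d1 : differentiable (vf_coord c (symbol A) \o chartV b) (chart b y).
  exact: ((sectP (symbol A)).1 c b y (conj Wy (Wc _ Wy)) by_).
apply: (differentiable_pair d1).
have dentry i : differentiable
    ((fun y => tmap a y (at_op A (@subset_refl _ W) (frame Wa i) y)) \o chartV b) (chart b y).
  exact: ((sectP (at_op A (@subset_refl _ W) (frame Wa i))).1 a b y (conj Wy (Wa _ Wy)) by_).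
pose m z : 'M[C]_r := \sum_i \sum_j
  tmap a (chartV b z) (at_op A (@subset_refl _ W) (frame Wa i) (chartV b z)) 0 j
    *: delta_mx i j.
have dm : differentiable m (chart b y).
  suff [] : has_diff m (chart b y) 0 (\sum_i \sum_j
    ('d ((fun y => tmap a y (at_op A (@subset_refl _ W) (frame Wa i) y)) \o chartV b)
      (chart b y) 0) 0 j *: delta_mx i j) by [].
  apply: has_diff_sum => i; apply: has_diff_sum => j; apply: has_diff_scalel.
  exact: has_diff_comp (conj (dentry i) (erefl _)) (has_diff_coord j _ _).
rewrite (_ : (fun x => _) = m)//; apply/funext => z.
rewrite [LHS]matrix_sum_delta; apply: eq_bigr => i _; apply: eq_bigr => j _.
by rewrite mxE.
Qed.

End AtiyahCoordinates.

(** * The Lie map on germs of fields *)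

Section LieMapJets.
Variables (R : realType) (n : nat) (M : complexManifold R n) (r : nat).
Variables (V : vectorBundle M r) (L : lieMap V) (c : atlas M) (a : triv V).
Local Notation C := (Cx R).
Local Notation E := 'rV[C]_n.
Local Notation TM := (tangentBundle M).
Implicit Types (U W : opens M) (y : M) (w : E -> E).

Lemma open_near_chart (P : set E) :
  open [set y | dom c y /\ \forall z \near chart c y, P z].
Proof.
rewrite openE => y [cy Py].
have h1 : nbhs y (dom c) by apply: open_nbhs_nbhs; split=> //; exact: open_dom.
have h2 : nbhs (chart c y) [set z | nbhs z P] by exact: nbhs_interior Py.
have := chart_continuous cy h2; rewrite nbhs_filterE => h3.
have {}h3 : nbhs y (chart c @^-1` [set z | nbhs z P]) := h3.
by apply: filterS2 h1 h3 => t ct Pt; split.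
Qed.

Definition near_opens (U0 : opens M) (P : set E) : opens M :=
  Opens (openI (openP U0) (open_near_chart P)).

Definition triv_opens : opens M := Opens (open_tdom a).

(** A domain determined by [w] alone (with [c] and [a] fixed), so that [jet] needs no choice of
    neighbourhood and is total in [w]. *)
Definition hol_opens w : opens M := near_opens triv_opens (fun z => differentiable w z).

Lemma hol_opens_triv w : hol_opens w `<=` tdom a.
Proof. by move=> y []. Qed.

Lemma hol_opens_dom w : hol_opens w `<=` dom c.
Proof. by move=> y [_ []]. Qed.

Lemma hol_opens_at w y : hol_opens w y -> holomorphic_at w (chart c y).
Proof. by move=> [_ []]. Qed.

(* The value at [y] of the Lie map on the germ of the field with coordinates [w]. *)
Definition jet y w : E * 'M[C]_r := at_coord c (@hol_opens_triv w)
  (L (hol_opens w) (chart_vf (@hol_opens_dom w) (@hol_opens_at w))) y.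

(** The Lie map commutes with restriction, so its value at [y] depends only on the germ: both fields
    are restricted to an open set [U] on which they coincide. *)
Lemma jetE W (Wa : W `<=` tdom a) (Wc : W `<=` dom c) (v : sect TM W) w y : W y ->
  holomorphic_at w (chart c y) ->
  (\forall z \near chart c y, vf_coord c v (chartV c z) = w z) ->
  at_coord c Wa (L W v) y = jet y w.
Proof.
move=> Wy hw vw; pose H : opens M := Opens (openI (openP W) (openP (hol_opens w))).
pose U := near_opens H (fun z => vf_coord c v (chartV c z) = w z).
have UW : U `<=` W by move=> t [[]].
have UH : U `<=` hol_opens w by move=> t [[]].
have Uy : U y.
  split; last by split=> //; exact: Wc.
  by split=> //; split; [exact: Wa|split=> //; exact: Wc].
have Ua : U `<=` tdom a by move=> t /UW /Wa.
rewrite -(at_coord_restr c Wa Ua UW _ Uy) -lie_restr.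
rewrite /jet -(at_coord_restr c _ Ua UH _ Uy) -lie_restr.
congr (at_coord c Ua (L U _) y); apply: (@vf_coord_inj _ _ _ c) => [t /UW /Wc//|t Ut].
rewrite !vf_coord_restr// vf_coord_chart_vf; last exact: UH.
by have [_ [ct /nbhs_singleton]] := Ut; rewrite chartK.
Qed.

Lemma jet_chart_vf W (Wa : W `<=` tdom a) (Wc : W `<=` dom c) w
    (hw : forall y, W y -> holomorphic_at w (chart c y)) y : W y ->
  at_coord c Wa (L W (chart_vf Wc hw)) y = jet y w.
Proof.
move=> Wy; apply: jetE => //; first exact: hw.
have := near_chart (openP W) Wy (Wc _ Wy).
by apply: filterS => z [Wz _ e]; rewrite vf_coord_chart_vf// e.
Qed.

Section Point.
Variable y : M.
Hypotheses (cy : dom c y) (ay : tdom a y).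
Let p := chart c y.

Lemma jet_lin (k : C) v w : holomorphic_at v p -> holomorphic_at w p ->
  jet y (fun z => k *: v z + w z) = k *: jet y v + jet y w.
Proof.
move=> hv hw.
pose U : opens M := Opens (openI (openP (hol_opens v)) (openP (hol_opens w))).
have Uc : U `<=` dom c by move=> t [/hol_opens_dom].
have Ua : U `<=` tdom a by move=> t [/hol_opens_triv].
have Uv t : U t -> holomorphic_at v (chart c t) by move=> [/hol_opens_at].
have Uw t : U t -> holomorphic_at w (chart c t) by move=> [_ /hol_opens_at].
have Uy : U y by [].
rewrite -(jet_chart_vf Ua Uc Uv Uy) -(jet_chart_vf Ua Uc Uw Uy) -at_coord_lin -linearP.
apply/esym/jetE => //; first exact: holomorphic_add (holomorphic_scale k hv) hw.
have := near_chart (openP U) Uy cy.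
apply: filterS => z [Uz _ e].
apply: (etrans (linearP (@tmap _ _ _ _ TM c _) _ _ _)).
by rewrite -/(vf_coord _ _ _) -/(vf_coord _ _ _) !vf_coord_chart_vf// e.
Qed.

Lemma jet_val v : holomorphic_at v p -> (jet y v).1 = v p.
Proof.
by move=> hv; rewrite /jet /= lie_symbol vf_coord_chart_vf.
Qed.

Lemma jet_bracket v w b : holomorphic_at v p -> holomorphic_at w p ->
  holomorphic_at b p -> v p = 0 -> w p = 0 ->
  (\forall z \near p, b z = 'd w z (v z) - 'd v z (w z)) ->
  (jet y b).2 = (jet y w).2 *m (jet y v).2 - (jet y v).2 *m (jet y w).2.
Proof.
move=> hv hw hb vp wp bE.
pose H : opens M := Opens (openI (openP (hol_opens v))
  (openI (openP (hol_opens w)) (openP (hol_opens b)))).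
pose U := near_opens H (fun z => b z = 'd w z (v z) - 'd v z (w z)).
have Uc : U `<=` dom c by move=> t [_ []].
have Ua : U `<=` tdom a by move=> t [[/hol_opens_triv]].
have Uv t : U t -> holomorphic_at v (chart c t) by move=> [[/hol_opens_at]].
have Uw t : U t -> holomorphic_at w (chart c t) by move=> [[_ [/hol_opens_at]]].
have Ub t : U t -> holomorphic_at b (chart c t) by move=> [[_ [_ /hol_opens_at]]].
have Uy : U y by [].
rewrite -(jet_chart_vf Ua Uc Uv Uy) -(jet_chart_vf Ua Uc Uw Uy) -(jet_chart_vf Ua Uc Ub Uy).
have zero u (hu : forall t, U t -> holomorphic_at u (chart c t)) : u p = 0 ->
    symbol (L U (chart_vf Uc hu)) y = 0.
  move=> up; rewrite lie_symbol; apply: (can_inj (tangent_tmapK cy)).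
  by rewrite -/(vf_coord _ _ _) vf_coord_chart_vf// up linear0.
apply: at_coord_bracket => //; [|exact: zero|exact: zero].
apply: lie_bracket; apply: (@vf_bracket_chart _ _ _ c _ _ _ _ v w) => //.
- by move=> t Ut; exact: vf_coord_chart_vf.
- by move=> t Ut; exact: vf_coord_chart_vf.
- move=> t Ut; rewrite vf_coord_chart_vf//.
  by have [_ [_ /nbhs_singleton]] := Ut.
Qed.

End Point.

End LieMapJets.

(** * Separation of variables *)

Section Separation.
Variables (R : realType) (n : nat).
Local Notation C := (Cx R).
Local Notation E := 'rV[C]_n.

Definition separable (F : E -> E -> C) := exists (K : finType) (A B : K -> E -> C),
  (forall k z, differentiable (A k) z /\ differentiable (B k) z) /\
  forall p z, F p z = \sum_k A k p * B k z.

Lemma separable1 : separable (fun _ _ => 1).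
Proof.
exists unit, (fun _ _ => 1), (fun _ _ => 1); split=> [k z|p z].
  by split; exact: differentiable_cst.
by rewrite big_const cardT enumT unlock /= mulr1 addr0.
Qed.

Lemma separable_mul F G : separable F -> separable G ->
  separable (fun p z => F p z * G p z).
Proof.
move=> [K [A [B [dAB FE]]]] [K' [A' [B' [dAB' GE]]]].
exists (K * K')%type, (fun k z => A k.1 z * A' k.2 z), (fun k z => B k.1 z * B' k.2 z).
split=> [[k k'] z|p z] /=.
  have [[dA dB] [dA' dB']] := (dAB k z, dAB' k' z).
  split; first exact: (has_diff_mul (conj dA (erefl ('d _ _ 0))) (conj dA' (erefl ('d _ _ 0)))).1.
  exact: (has_diff_mul (conj dB (erefl ('d _ _ 0))) (conj dB' (erefl ('d _ _ 0)))).1.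
rewrite FE GE big_distrlr pair_big /=; apply: eq_bigr => -[k k'] _ /=.
exact: mulrACA.
Qed.

Lemma separable_pcoord (i : 'I_n) : separable (fun p => pcoord p i).
Proof.
have dc z : differentiable (fun z : E => z 0 i : C) z by exact: (has_diff_coord i z 0).1.
exists bool, (fun b z => if b then 1 else - (z 0 i)), (fun b z => if b then z 0 i else 1).
split=> [[] z|p z] /=.
- by split; [exact: differentiable_cst|exact: dc].
- by split; [exact: differentiableN|exact: differentiable_cst].
- by rewrite big_bool mul1r mulr1.
Qed.

Lemma separable_monomial (J : 'I_n -> nat) : separable (fun p => monomial p J).
Proof.
rewrite (_ : (fun p => _) = fun p z => \prod_(i <- index_enum 'I_n) pcoord p i z ^+ J i)//.
elim: (index_enum _) => [|i s ih].
  rewrite (_ : (fun p => _) = fun _ _ => 1); first exact: separable1.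
  by apply/funext => p; apply/funext => z; rewrite big_nil.
rewrite (_ : (fun p => _) = fun p z => pcoord p i z ^+ J i *
  \prod_(i <- s) pcoord p i z ^+ J i); last first.
  by apply/funext => p; apply/funext => z; rewrite big_cons.
apply: separable_mul ih; elim: (J i) => [|m ihm].
  rewrite (_ : (fun p => _) = fun _ _ => 1); first exact: separable1.
  by apply/funext => p; apply/funext => z; rewrite expr0.
rewrite (_ : (fun p => _) = fun p z => pcoord p i z * pcoord p i z ^+ m).
  exact: separable_mul (separable_pcoord i) ihm.
by apply/funext => p; apply/funext => z; rewrite exprS.
Qed.

End Separation.

(** * The order of the Lie map *)

Section LieMapOrder.
Variables (R : realType) (n : nat) (M : complexManifold R n) (r : nat).
Variables (V : vectorBundle M r) (L : lieMap V).
Local Notation C := (Cx R).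
Local Notation E := 'rV[C]_n.
Local Notation TM := (tangentBundle M).

Section Trivialised.
Variables (c : atlas M) (a : triv V).
Implicit Types (U W : opens M) (y : M) (w : E -> E).

Lemma jet_sum y (I : Type) (s : seq I) (k : I -> C) (f : I -> E -> E) :
  dom c y -> tdom a y -> (forall i, holomorphic_at (f i) (chart c y)) ->
  jet L c a y (fun z => \sum_(i <- s) k i *: f i z) =
  \sum_(i <- s) k i *: jet L c a y (f i).
Proof.
move=> cy ay hf; have h0 : holomorphic_at (fun=> 0 : E) (chart c y).
  by apply: filterE => z; exact: differentiable_cst.
elim: s => [|i s ih].
  rewrite big_nil (_ : (fun z => _) = fun=> 0); last by apply/funext => z; rewrite big_nil.
  have := jet_lin L cy ay 1 h0 h0; rewrite (_ : (fun z => _) = fun=> 0); last first.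
    by apply/funext => z; rewrite scaler0 addr0.
  by rewrite scale1r => /(congr1 (fun u => u - jet L c a y (fun=> 0))); rewrite subrr addrK.
rewrite big_cons -ih (_ : (fun z => _) = fun z => k i *: f i z + \sum_(i <- s) k i *: f i z).
  apply: jet_lin => //; apply: holomorphic_sum => j; exact: holomorphic_scale.
by apply/funext => z; rewrite big_cons.
Qed.

Definition chart_opens : opens M := Opens (openI (open_dom c) (open_tdom a)).

Lemma chart_opens_dom : chart_opens `<=` dom c. Proof. by move=> y []. Qed.

Lemma chart_opens_triv : chart_opens `<=` tdom a. Proof. by move=> y []. Qed.

(* Separating the variables of a monomial centred at [chart c y] reduces its jet to
   those of fields that do not depend on [y]. *)
Lemma holomorphic_jet_mono J j :
  holomorphic_on chart_opens (fun y => jet L c a y (mono (chart c y) J j)).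
Proof.
have [K [A [B [dAB AB]]]] := separable_monomial R J.
have hB k y : chart_opens y -> holomorphic_at (field (B k) j) (chart c y).
  move=> _; apply: filterE => z; apply: differentiableZl; exact: (dAB k z).2.
pose G k y := at_coord c chart_opens_triv (L chart_opens (chart_vf chart_opens_dom (hB k))) y.
apply: (holomorphic_on_chart chart_opens_dom) => y Wy; have cy := chart_opens_dom Wy.
have d k : differentiable (fun z => A k z *: (G k \o chartV c) z) (chart c y).
  apply: differentiable_scale; first exact: (dAB k _).1.
  exact: (holomorphic_at_coord chart_opens_triv _ chart_opens_dom Wy cy).
have dS : differentiable (fun z => \sum_k A k z *: (G k \o chartV c) z) (chart c y).
  exact: (has_diff_sum (index_enum K) (fun k => conj (d k) (erefl ('d _ _ 0)))).1.
apply: near_eq_differentiable _ dS; have := near_chart (openP chart_opens) Wy cy.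
apply: filterS => z [Wz cz e] /=.
have [_ az] := Wz.
rewrite (_ : mono _ J j = fun t => \sum_k A k z *: field (B k) j t).
  rewrite jet_sum// => [|k]; last exact: (hB k).
  by apply: eq_bigr => k _; rewrite /G jet_chart_vf.
apply/funext => t; rewrite /mono /field e AB scaler_suml.
by apply: eq_bigr => k _; rewrite scalerA.
Qed.

Lemma holomorphic_vf_coord W (v : sect TM W) y : W y -> dom c y ->
  holomorphic_at (vf_coord c v \o chartV c) (chart c y).
Proof.
move=> Wy cy; have Wc : open (W `&` dom c) by apply: openI; [exact: openP|exact: open_dom].
exact: holomorphic_on_at Wc ((sectP v).1 c) (conj Wy cy) cy.
Qed.

End Trivialised.

(** The coefficients are the jets of the monomial fields divided by factorials; the formula is
    [taylor_holomorphic] at each point separately, on the whole common domain of chart and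
    trivialisation. *)
Lemma diff_op_le_of_jets k :
  (forall c a y, dom c y -> tdom a y -> forall J j, (k < \sum_i J i)%N ->
    jet L c a y (mono (chart c y) J j) = 0) ->
  diff_op_le k (fun U => L U).
Proof.
move=> jet0 c a x cx ax.
exists (chart_opens c a), (@chart_opens_triv c a), (fun (I : multiIndex n k) j y =>
  (mfact R (fun l => I l : nat))^-1 *: jet L c a y (mono (chart c y) (fun l => I l : nat) j)).
split=> //; first exact: chart_opens_dom.
  move=> I j b y Wy by_; apply: differentiableZ; exact: holomorphic_jet_mono Wy by_.
move=> W WW v y Wy; have [cy ay] := WW _ Wy.
have hv := holomorphic_vf_coord v Wy cy.
rewrite (@jetE _ _ _ _ _ L c a W _ _ v (vf_coord c v \o chartV c) y Wy hv); first last.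
- by apply: filterE.
- by move=> t /WW [].
pose f j z : C := vf_coord c v (chartV c z) 0 j.
have hf j : holomorphic_at (f j) (chart c y) := holomorphic_coord j hv.
rewrite (_ : _ \o _ = fun z => \sum_j 1 *: field (f j) j z); last first.
  by apply/funext => z; under eq_bigr do rewrite scale1r; exact: rV_decomp.
rewrite jet_sum// => [|j]; last exact: holomorphic_field.
rewrite exchange_big /=; apply: eq_bigr => j _; rewrite scale1r.
apply: taylor_holomorphic (hf j).
- exact: jet_lin.
- exact: jet_val.
- exact: jet_bracket.
- exact: jet0.
Qed.

End LieMapOrder.

Theorem theorem1p1 (R : realType) (n : nat) (X : complexManifold R n) (r : nat)
    (V : infEquivariantBundle X r) :
  diff_op_le r.+1 (fun U => equiv_lie V U) /\
  (r = 1%N -> diff_op_le 1 (fun U => equiv_lie V U)).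
Proof.
split=> [|r1]; apply: diff_op_le_of_jets => c a y cy ay J j kJ.
  apply: rho_mono_eq0 kJ; [exact: jet_lin|exact: jet_val|exact: jet_bracket].
apply: rho_mono_line r1 kJ; [exact: jet_lin|exact: jet_val|exact: jet_bracket].
Qed.
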